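(* For the class of bounded-density graphs, the Secluded Path problem can be approximated in polynomial time within a ratio of $O(1)$, and the Secluded Steiner Tree problem with $k$ terminals within a ratio of $\Theta(\log k)$.
   Context: A class of bounded-density graphs is a hereditary class $\mathcal{G}$ of graphs (closed under taking subgraphs) such that $|E(G)|\le\ell\cdot|V(G)|$ for all $G\in\mathcal{G}$, for some constant $\ell$ (e.g., planar graphs). For $u\in V(G)$, $N[u]$ is $u$ together with its neighbors; for a subgraph $G'$, $N[G']=\bigcup_{u\in V(G')}N[u]$ and $\mathrm{Cost}(G')=|N[G']|$. Secluded Path problem: given $G$ and nodes $s,t$, find an $s$-$t$ path minimizing $\mathrm{Cost}$. Secluded Steiner Tree problem: given $G$ and $k$ terminals, find a tree containing all terminals minimizing $\mathrm{Cost}$. *)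

(* Defs.v *)
From Stdlib Require Import List Arith Lia Relations Bool.
Open Scope bool_scope.
Import ListNotations.

(* An edge {u,v} is stored once, normalized as (u,v) with u < v.        *)
Record graph := Graph { gn : nat ; gE : list (nat * nat) }.

Definition wf_graph (G : graph) : Prop :=
  NoDup (gE G) /\ forall u v, In (u, v) (gE G) -> u < v < gn G.

Definition adj (G : graph) (u v : nat) : Prop :=
  In (u, v) (gE G) \/ In (v, u) (gE G).

Definition pair_eqb (a b : nat * nat) : bool :=
  Nat.eqb (fst a) (fst b) && Nat.eqb (snd a) (snd b).

Definition adjb (G : graph) (u v : nat) : bool :=
  existsb (pair_eqb (u, v)) (gE G) || existsb (pair_eqb (v, u)) (gE G).

Definition is_subgraph (G : graph) (V' : list nat) (E' : list (nat * nat)) : Prop :=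
  NoDup V' /\ NoDup E' /\ (forall x, In x V' -> x < gn G) /\
  incl E' (gE G) /\ (forall u v, In (u, v) E' -> In u V' /\ In v V').

Definition bounded_density (l : nat) (G : graph) : Prop :=
  forall V' E', is_subgraph G V' E' -> length E' <= l * length V'.

Definition in_closed_nbhd (G : graph) (V' : list nat) (x : nat) : bool :=
  existsb (fun y => Nat.eqb x y || adjb G y x) V'.

Definition cost (G : graph) (V' : list nat) : nat :=
  count_occ Bool.bool_dec (map (in_closed_nbhd G V') (seq 0 (gn G))) true.

Fixpoint adj_chain (G : graph) (p : list nat) : Prop :=
  match p with
  | x :: ((y :: _) as q) => adj G x y /\ adj_chain G q
  | _ => True
  end.

Definition is_st_path (G : graph) (s t : nat) (p : list nat) : Prop :=
  NoDup p /\ (forall x, In x p -> x < gn G) /\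
  hd_error p = Some s /\ last p s = t /\ adj_chain G p.

Definition edge_rel (E' : list (nat * nat)) (u v : nat) : Prop :=
  In (u, v) E' \/ In (v, u) E'.

Definition is_tree (G : graph) (V' : list nat) (E' : list (nat * nat)) : Prop :=
  is_subgraph G V' E' /\ V' <> [] /\
  (forall x y, In x V' -> In y V' -> clos_refl_trans nat (edge_rel E') x y) /\
  length E' + 1 = length V'.

Inductive instr :=
| Inc (r : nat)
| Dec (r : nat)
| Jz (r : nat) (j : nat)
| LoadI (r a : nat)
| StoreI (a r : nat).

Definition program := list instr.
Definition memory := nat -> nat.
Definition config : Type := (nat * memory)%type.

Definition upd (m : memory) (r v : nat) : memory :=
  fun x => if Nat.eqb x r then v else m x.

Definition step (P : program) (c : config) : config :=
  let (pc, m) := c in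
  match nth_error P pc with
  | None => c
  | Some (Inc r) => (S pc, upd m r (S (m r)))
  | Some (Dec r) => (S pc, upd m r (pred (m r)))
  | Some (Jz r j) => (if Nat.eqb (m r) 0 then j else S pc, m)
  | Some (LoadI r a) => (S pc, upd m r (m (m a)))
  | Some (StoreI a r) => (S pc, upd m (m a) (m r))
  end.

Definition halted (P : program) (c : config) : Prop := length P <= fst c.

Definition init_mem (l : list nat) : memory :=
  fun x => match x with 0 => length l | S i => nth i l 0 end.

Definition read_output (m : memory) : list nat :=
  map (fun i => m (S i)) (seq 0 (m 0)).

Definition runs_within (P : program) (l : list nat) (T : nat) (o : list nat) : Prop :=
  exists t, t <= T /\
    halted P (Nat.iter t (step P) (0, init_mem l)) /\
    read_output (snd (Nat.iter t (step P) (0, init_mem l))) = o.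

Definition encode_edges (E : list (nat * nat)) : list nat :=
  flat_map (fun e => [fst e; snd e]) E.

Definition encode_path_instance (G : graph) (s t : nat) : list nat :=
  gn G :: length (gE G) :: encode_edges (gE G) ++ [s; t].

Definition encode_steiner_instance (G : graph) (X : list nat) : list nat :=
  gn G :: length (gE G) :: encode_edges (gE G) ++ length X :: X.

Fixpoint decode_pairs (l : list nat) : list (nat * nat) :=
  match l with
  | a :: b :: r => (a, b) :: decode_pairs r
  | _ => []
  end.

(* Tree output: a, v1..va, b, u1, w1, ..., ub, wb *)
Definition decode_tree (o : list nat) : list nat * list (nat * nat) :=
  match o with
  | [] => ([], [])
  | a :: r =>
      (firstn a r,
       match skipn a r with
       | [] => []
       | b :: r' => firstn b (decode_pairs r')
       end)
  end.

(* Main.v *)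
(* Give a vertex v the weight w(v) = deg(v) + 1.  Then cost(V) <= w(V), and since the edges that
   touch V lie inside N[V], bounded density gives w(V) <= (2 l + 1) cost(V).  So it suffices to
   treat node weights.  A shortest path is optimal for them.  For Steiner trees we buy spiders
   (a center with shortest paths to at least two active terminals) at a price of lam per
   foot, for lam = 1, 2, ..., and keep one foot of each spider active.  If no spider of price p is
   available while a terminals are active, then every tree through the terminals has weight at
   least p (a - 1): push tokens from the active terminals towards a root of the tree; tokens that
   meet form a spider.  Hence the prices paid add up to a harmonic sum.  Termination at
   lam = T > w(all vertices) is automatic, because then a <= 1.

   Running times: algorithms are written in a language whose loops are bounded by variables
   that the loop does not change and whose values grow by increments only, so that every program
   is polynomial; it is compiled to the given machine. *)
Require Import Defs.
From Stdlib Require Import List Arith.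
From Stdlib Require Import Lia Bool Relations Permutation.
Import ListNotations.

(** * A loop language *)

(** A spider with [f >= 2] feet costs at most [lam * f] but retires only [f - 1] terminals, since
    one foot stays active; [f <= 2 * (f - 1)] explains the factor 2 before the harmonic sum. Price
    [lam] is used only when price [lam - 1] is exhausted at every center, so with [a >= 2] active
    terminals [lam <= W / (a - 1) + 1], where [W] is the weight of a tree through the terminals. The
    summands 1 add up to at most [2 * (k - 1)], which is absorbed because every vertex weighs at
    least 1. One scan of the centers per price suffices: retiring terminals can only remove spiders,
    so an exhausted center stays exhausted.

    On the machine the obstacle is the memory: the input fills the cells from 0 on and the output
    must end up there too, so no cell at a fixed address is free at the start or at the end.
    Hand-written code moves the data before and after the compiled program. *)

Record state := St { sv : nat -> nat; sa : nat -> nat -> nat }.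

Definition setv (s : state) (x v : nat) : state :=
  St (fun z => if z =? x then v else sv s z) (sa s).

Definition seta (s : state) (a i v : nat) : state :=
  St (sv s) (fun b j => if (b =? a) && (j =? i) then v else sa s b j).

Inductive cmd :=
| Skip
| Set_ (x k : nat)
| Mov (x y : nat)
| CInc (x : nat)
| Sub (x y : nat)
| Get (x a y : nat)
| Put (a y x : nat)
| Seq (c1 c2 : cmd)
| IfLt (x y : nat) (c1 c2 : cmd)
| For (h x : nat) (c : cmd).

Notation "c1 ;; c2" := (Seq c1 c2) (at level 61, right associativity).

(** Loops run from [k - 1] down to 0 because the compiled loop decrements its counter and tests it
    for 0. *)
Fixpoint down {S : Type} (k : nat) (f : nat -> S -> S) (s : S) : S :=
  match k with
  | 0 => s
  | S k' => down k' f (f k' s)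
  end.

Fixpoint exec (c : cmd) (s : state) : state :=
  match c with
  | Skip => s
  | Set_ x k => setv s x k
  | Mov x y => setv s x (sv s y)
  | CInc x => setv s x (S (sv s x))
  | Sub x y => setv s x (sv s x - sv s y)
  | Get x a y => setv s x (sa s a (sv s y))
  | Put a y x => seta s a (sv s y) (sv s x)
  | Seq c1 c2 => exec c2 (exec c1 s)
  | IfLt x y c1 c2 => if sv s x <? sv s y then exec c1 s else exec c2 s
  | For h x c =>
      down (sv s x) (fun k s => exec c (setv s h k)) (setv s h (sv s x))
  end.

Fixpoint wv (c : cmd) : list nat :=
  match c with
  | Skip | Put _ _ _ => []
  | Set_ x _ | Mov x _ | CInc x | Sub x _ | Get x _ _ => [x]
  | Seq c1 c2 | IfLt _ _ c1 c2 => wv c1 ++ wv c2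
  | For h _ c => h :: wv c
  end.

Fixpoint wa (c : cmd) : list nat :=
  match c with
  | Put a _ _ => [a]
  | Seq c1 c2 | IfLt _ _ c1 c2 => wa c1 ++ wa c2
  | For _ _ c => wa c
  | _ => []
  end.

Definition inb (l : list nat) (x : nat) : bool := existsb (Nat.eqb x) l.

Lemma inb_app (l l' : list nat) (x : nat) : inb (l ++ l') x = inb l x || inb l' x.
Proof. apply existsb_app. Qed.

(** The invariant is indexed by the number of rounds still to come, so it starts at [n] and ends at
    0. *)
Lemma down_inv {S : Type} (P : nat -> S -> Prop) (f : nat -> S -> S) (n : nat) (s : S) :
  P n s -> (forall k s, k < n -> P (Datatypes.S k) s -> P k (f k s)) -> P 0 (down n f s).
Proof.
  revert s; induction n as [|n IH]; intros s H0 Hs; simpl; auto.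
Qed.

(** For a concrete program the hypothesis is decided by computation; this lemma and [frame_a] carry
    most facts about untouched parts of the state. *)
Lemma frame_v (c : cmd) (s : state) (x : nat) :
  inb (wv c) x = false -> sv (exec c s) x = sv s x.
Proof.
  revert s; induction c; simpl; intros s H; auto;
    try (apply orb_false_iff in H; destruct H as [H _]; now rewrite H).
  - rewrite inb_app in H; apply orb_false_iff in H; destruct H.
    rewrite IHc2, IHc1; auto.
  - rewrite inb_app in H; apply orb_false_iff in H; destruct H.
    destruct (_ <? _); auto.
  - apply orb_false_iff in H; destruct H as [H1 H2].
    apply (down_inv (fun _ s' => sv s' x = sv s x)).
    + simpl. now rewrite H1.
    + intros k s' _ E. rewrite IHc; auto. simpl. now rewrite H1.
Qed.

Lemma frame_a (c : cmd) (s : state) (a : nat) :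
  inb (wa c) a = false -> sa (exec c s) a = sa s a.
Proof.
  revert s; induction c; simpl; intros s H; auto.
  - apply orb_false_iff in H; destruct H as [H _]. now rewrite H.
  - rewrite inb_app in H; apply orb_false_iff in H; destruct H.
    rewrite IHc2, IHc1; auto.
  - rewrite inb_app in H; apply orb_false_iff in H; destruct H.
    destruct (_ <? _); auto.
  - apply (down_inv (fun _ s' => sa s' a = sa s a)); simpl; auto.
    intros k s' _ E. rewrite IHc; auto.
Qed.

(** * Compilation to the machine *)

(* Scalar [x] lives in cell [x] and entry [i] of array [a] in cell
   [a + stride * (i + 1)], so the layout does not depend on array sizes.
   Cell 0 holds 0 while compiled code runs, which turns [Jz 0 j] into a jump and
   [LoadI r 0] into a reset; cells 1, 2, 3 are scratch. *)
Definition stride : nat := 40.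

(** [stride] becomes opaque so that unrolled code and cell addresses stay symbolic; this equation
    hands the value to [lia] where it matters. *)
Lemma stride_val : stride = 40.
Proof. reflexivity. Qed.

#[local] Opaque stride.

Definition cell (a i : nat) : nat := a + stride * S i.

Definition ldc (r k : nat) : program := LoadI r 0 :: repeat (Inc r) k.
(** The machine cannot copy a cell directly: the address [y] is built in cell 1 and then read
    indirectly, which leaves cell [y] intact. *)
Definition mov (x y : nat) : program := ldc 1 y ++ [LoadI x 1].
Definition monus_loop (off x : nat) : program := [Jz 2 (off + 4); Dec 2; Dec x; Jz 0 off].
(** Multiplication of the index in cell 2 by [stride]: each round adds [stride] to cell 1 by
    unrolled increments. *)
Definition addr_loop (off : nat) : program :=
  [Jz 2 (off + (stride + 3)); Dec 2] ++ repeat (Inc 1) stride ++ [Jz 0 off].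
Definition addr (off a y : nat) : program :=
  let code := mov 2 y ++ ldc 1 (a + stride) in
  code ++ addr_loop (off + length code).

(** Jump targets are absolute, hence the argument [off]. The test [x < y] becomes a test of [y - x]
    against 0 in cell 3. *)
Fixpoint compile (off : nat) (c : cmd) : program :=
  match c with
  | Skip => []
  | Set_ x k => ldc x k
  | Mov x y => mov x y
  | CInc x => [Inc x]
  | Sub x y => mov 2 y ++ monus_loop (off + length (mov 2 y)) x
  | Get x a y => addr off a y ++ [LoadI x 1]
  | Put a y x => addr off a y ++ [StoreI 1 x]
  | Seq c1 c2 =>
      let p1 := compile off c1 in p1 ++ compile (off + length p1) c2
  | IfLt x y c1 c2 =>
      let p0 := mov 2 x ++ mov 3 y in
      let test := p0 ++ monus_loop (off + length p0) 3 in
      let o1 := off + length test + 1 in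
      let p1 := compile o1 c1 in
      let o2 := o1 + length p1 + 1 in
      let p2 := compile o2 c2 in
      test ++ [Jz 3 o2] ++ p1 ++ [Jz 0 (o2 + length p2)] ++ p2
  | For h x c =>
      let p0 := mov h x in
      let o1 := off + length p0 in
      let p1 := compile (o1 + 2) c in
      p0 ++ [Jz h (o1 + 3 + length p1); Dec h] ++ p1 ++ [Jz 0 o1]
  end.

(** An upper bound and not an exact count: the register numbers that enter the cost of [mov] are
    replaced by [stride]. A [For] loop carries state and time along together. *)
Fixpoint time (c : cmd) (s : state) : nat :=
  match c with
  | Skip => 0
  | Set_ x k => k + 1
  | Mov x y => stride + 2
  | CInc x => 1
  | Sub x y => stride + 3 + 4 * sv s y
  | Get x a y | Put a y x => 4 * stride + (stride + 3) * sv s y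
  | Seq c1 c2 => time c1 s + time c2 (exec c1 s)
  | IfLt x y c1 c2 =>
      2 * stride + 7 + 4 * sv s x +
      (if sv s x <? sv s y then time c1 s else time c2 s)
  | For h x c =>
      stride + 3 +
      snd (down (sv s x)
             (fun k '(s, t) => (exec c (setv s h k), t + 3 + time c (setv s h k)))
             (setv s h (sv s x), 0))
  end.

(** Register 0 is a readable constant 0, and cells 1 to 3 are hidden from programs because compiled
    code uses them as scratch. *)
Definition wvar (x : nat) : bool := (4 <=? x) && (x <? stride).
Definition rvar (x : nat) : bool := (x =? 0) || wvar x.

(** The body of a loop must leave [h] alone: the semantics reassigns [h] in each round, whereas the
    machine decrements whatever it finds there. *)
Fixpoint wf (c : cmd) : bool :=
  match c with
  | Skip => true
  | Set_ x _ | CInc x => wvar x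
  | Mov x y | Sub x y => wvar x && rvar y
  | Get x a y => wvar x && (a <? stride) && rvar y
  | Put a y x => rvar x && (a <? stride) && rvar y
  | Seq c1 c2 => wf c1 && wf c2
  | IfLt x y c1 c2 => rvar x && rvar y && wf c1 && wf c2
  | For h x c => wvar h && rvar x && wf c && negb (inb (wv c) h)
  end.

Definition repr (s : state) (m : memory) : Prop :=
  m 0 = 0 /\ sv s 0 = 0 /\ (forall x, wvar x = true -> m x = sv s x) /\
  (forall a i, a < stride -> m (cell a i) = sa s a i).

Definition code_at (P : program) (off : nat) (code : program) : Prop :=
  forall i, i < length code -> nth_error P (off + i) = nth_error code i.

Definition run (P : program) (t : nat) (c c' : config) : Prop :=
  Nat.iter t (step P) c = c'.

Lemma run_trans (P : program) (t1 t2 : nat) (c1 c2 c3 : config) :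
  run P t1 c1 c2 -> run P t2 c2 c3 -> run P (t1 + t2) c1 c3.
Proof.
  unfold run; intros <- <-. rewrite Nat.add_comm. apply Nat.iter_add.
Qed.

Definition istep (i : instr) (pc : nat) (m : memory) : config :=
  match i with
  | Inc r => (S pc, upd m r (S (m r)))
  | Dec r => (S pc, upd m r (pred (m r)))
  | Jz r j => (if m r =? 0 then j else S pc, m)
  | LoadI r a => (S pc, upd m r (m (m a)))
  | StoreI a r => (S pc, upd m (m a) (m r))
  end.

Lemma run_step (P : program) (t pc : nat) (m : memory) (i : instr) (c' : config) :
  nth_error P pc = Some i -> run P t (istep i pc m) c' -> run P (S t) (pc, m) c'.
Proof.
  intros H R. apply (run_trans P 1 t _ (istep i pc m)); auto.
  unfold run, Nat.iter, step; simpl. rewrite H. destruct i; reflexivity.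
Qed.

Lemma run_0 (P : program) (pc pc' : nat) (m : memory) :
  pc = pc' -> run P 0 (pc, m) (pc', m).
Proof. now intros <-. Qed.

Lemma code_at_app (P : program) (off : nat) (p q : program) :
  code_at P off (p ++ q) -> code_at P off p /\ code_at P (off + length p) q.
Proof.
  intros H; split; intros i Hi.
  - rewrite H by (rewrite length_app; lia). now rewrite nth_error_app1.
  - rewrite <- Nat.add_assoc, H by (rewrite length_app; lia).
    rewrite nth_error_app2 by lia. f_equal; lia.
Qed.

Lemma code_at_cons (P : program) (off : nat) (i : instr) (q : program) :
  code_at P off (i :: q) -> nth_error P off = Some i /\ code_at P (S off) q.
Proof.
  intros H. destruct (code_at_app P off [i] q H) as [H1 H2]. split.
  - specialize (H1 0 ltac:(simpl; lia)). now rewrite Nat.add_0_r in H1.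
  - simpl in H2. now rewrite Nat.add_1_r in H2.
Qed.

Definition upto (m : memory) (r v : nat) (m' : memory) : Prop :=
  m' r = v /\ forall x, x <> r -> m' x = m x.

Lemma upd_same (m : memory) (r v : nat) : upd m r v r = v.
Proof. unfold upd. now rewrite Nat.eqb_refl. Qed.

Lemma upd_other (m : memory) (r v x : nat) : x <> r -> upd m r v x = m x.
Proof. unfold upd. intros H. apply Nat.eqb_neq in H. now rewrite H. Qed.

Lemma run_incs (P : program) (off r k : nat) (m : memory) :
  code_at P off (repeat (Inc r) k) ->
  exists m', run P k (off, m) (off + k, m') /\ upto m r (m r + k) m'.
Proof.
  revert off m; induction k as [|k IH]; intros off m H.
  - exists m. split; [unfold run; simpl; f_equal; lia|split; auto; lia].
  - apply code_at_cons in H as [H1 H2].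
    destruct (IH (S off) (upd m r (S (m r))) H2) as (m' & R & E1 & E2).
    exists m'. split.
    + eapply run_step; [exact H1|].
      replace (off + S k) with (S off + k) by lia. exact R.
    + split. { rewrite E1, upd_same; lia. }
      intros x Hx. now rewrite E2, upd_other.
Qed.

Lemma run_decs (P : program) (off r k : nat) (m : memory) :
  code_at P off (repeat (Dec r) k) ->
  exists m', run P k (off, m) (off + k, m') /\ upto m r (m r - k) m'.
Proof.
  revert off m; induction k as [|k IH]; intros off m H.
  - exists m. split; [unfold run; simpl; f_equal; lia|split; auto; lia].
  - apply code_at_cons in H as [H1 H2].
    destruct (IH (S off) (upd m r (pred (m r))) H2) as (m' & R & E1 & E2).
    exists m'. split.
    + eapply run_step; [exact H1|].
      replace (off + S k) with (S off + k) by lia. exact R.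
    + split. { rewrite E1, upd_same; lia. }
      intros x Hx. now rewrite E2, upd_other.
Qed.

Lemma run_ldc (P : program) (off r k : nat) (m : memory) :
  code_at P off (ldc r k) -> m 0 = 0 ->
  exists m', run P (k + 1) (off, m) (off + length (ldc r k), m') /\ upto m r k m'.
Proof.
  intros H Z. apply code_at_cons in H as [H1 H2].
  destruct (run_incs P (S off) r k (upd m r 0) H2) as (m' & R & E1 & E2).
  exists m'. split.
  - rewrite Nat.add_1_r. eapply run_step; [exact H1|]. cbn [istep]. rewrite !Z.
    unfold ldc; simpl length; rewrite repeat_length.
    replace (off + S k) with (S off + k) by lia. exact R.
  - split. { rewrite E1, upd_same; lia. }
    intros x Hx. now rewrite E2, upd_other.
Qed.

Lemma length_mov (x y : nat) : length (mov x y) = y + 2.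
Proof. unfold mov, ldc. simpl. rewrite length_app, repeat_length. simpl; lia. Qed.

Lemma run_mov (P : program) (off x y : nat) (m : memory) :
  code_at P off (mov x y) -> m 0 = 0 -> y <> 1 ->
  exists m', run P (y + 2) (off, m) (off + length (mov x y), m') /\
    m' x = m y /\ forall z, z <> x -> z <> 1 -> m' z = m z.
Proof.
  intros H Z Hy. apply code_at_app in H as [H1 H2].
  destruct (run_ldc P off 1 y m H1 Z) as (m' & R & E1 & E2).
  apply code_at_cons in H2 as [H2 _].
  exists (upd m' x (m' (m' 1))). split; [|split].
  - replace (y + 2) with ((y + 1) + 1) by lia.
    eapply run_trans; [exact R|]. eapply run_step; [exact H2|]. apply run_0.
    rewrite length_mov. unfold ldc; simpl; rewrite repeat_length; lia.
  - rewrite upd_same, E1. now rewrite E2.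
  - intros z Hz Hz1. now rewrite upd_other, E2.
Qed.

Lemma run_monus_loop (P : program) (off x : nat) (m : memory) :
  code_at P off (monus_loop off x) -> m 0 = 0 -> x <> 0 -> x <> 2 ->
  exists m', run P (4 * m 2 + 1) (off, m) (off + 4, m') /\
    m' x = m x - m 2 /\ forall z, z <> x -> z <> 2 -> m' z = m z.
Proof.
  intros H Z X0 X2. remember (m 2) as k eqn:K. revert m Z K.
  apply code_at_cons in H as [H1 H]. apply code_at_cons in H as [H2 H].
  apply code_at_cons in H as [H3 H]. apply code_at_cons in H as [H4 _].
  induction k as [|k IH]; intros m Z K.
  - exists m. split; [|split; auto; lia].
    eapply run_step; [exact H1|]. cbn [istep]. rewrite <- K. now apply run_0.
  - set (m1 := upd (upd m 2 k) x (pred (m x))).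
    destruct (IH m1) as (m' & R & E1 & E2).
    + unfold m1; rewrite !upd_other; auto; lia.
    + unfold m1; rewrite upd_other, upd_same; auto.
    + exists m'. split; [|split].
      * replace (4 * S k + 1) with (4 + (4 * k + 1)) by lia.
        eapply run_trans; [|exact R].
        eapply run_step; [exact H1|]. cbn [istep]. rewrite <- K. simpl Nat.eqb. cbv iota.
        eapply run_step; [exact H2|]. cbn [istep]. rewrite <- K.
        eapply run_step; [exact H3|]. cbn [istep].
        eapply run_step; [exact H4|]. cbn [istep].
        rewrite (upd_other m 2 _ x) by auto.
        rewrite (upd_other _ x _ 0), (upd_other _ 2 _ 0), Z by auto. now apply run_0.
      * rewrite E1. unfold m1. rewrite upd_same. lia.
      * intros z Hz Hz2. rewrite E2 by auto. unfold m1. now rewrite !upd_other.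
Qed.

Lemma run_addr_loop (P : program) (off : nat) (m : memory) :
  code_at P off (addr_loop off) -> m 0 = 0 ->
  exists m', run P ((stride + 3) * m 2 + 1) (off, m) (off + (stride + 3), m') /\
    m' 1 = m 1 + stride * m 2 /\ forall z, z <> 1 -> z <> 2 -> m' z = m z.
Proof.
  intros H Z. remember (m 2) as k eqn:K. revert m Z K.
  apply code_at_cons in H as [H1 H]. apply code_at_cons in H as [H2 H].
  apply code_at_app in H as [H3 H4]. apply code_at_cons in H4 as [H4 _].
  rewrite repeat_length in H4.
  induction k as [|k IH]; intros m Z K.
  - exists m. split; [|split; auto; lia]. rewrite Nat.mul_0_r.
    eapply run_step; [exact H1|]. cbn [istep]. rewrite <- K. now apply run_0.
  - destruct (run_incs P (S (S off)) 1 stride (upd m 2 k) H3) as (m1 & R1 & E1 & E2).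
    destruct (IH m1) as (m' & R & F1 & F2).
    + rewrite E2, upd_other; auto.
    + rewrite E2, upd_same; auto.
    + exists m'. split; [|split].
      * replace ((stride + 3) * S k + 1) with (2 + (stride + (1 + ((stride + 3) * k + 1)))) by lia.
        eapply run_step; [exact H1|]. cbn [istep]. rewrite <- K. simpl Nat.eqb. cbv iota.
        eapply run_step; [exact H2|]. cbn [istep]. rewrite <- K.
        eapply run_trans; [exact R1|]. eapply run_step; [exact H4|]. cbn [istep].
        rewrite E2, upd_other, Z by lia. exact R.
      * rewrite F1, E1, upd_other by lia. lia.
      * intros z Hz Hz2. rewrite F2, E2, upd_other by auto. auto.
Qed.

Lemma run_addr (P : program) (off a y : nat) (m : memory) :
  code_at P off (addr off a y) -> m 0 = 0 -> y <> 1 -> a < stride -> y < stride ->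
  exists m' t, t < 4 * stride + (stride + 3) * m y /\
    run P t (off, m) (off + length (addr off a y), m') /\
    m' 1 = cell a (m y) /\ forall z, z <> 1 -> z <> 2 -> m' z = m z.
Proof.
  intros H Z Hy Ha Hy2. apply code_at_app in H as [H H3].
  apply code_at_app in H as [H1 H2].
  destruct (run_mov P off 2 y m H1 Z Hy) as (m1 & R1 & E1 & E2).
  destruct (run_ldc P _ 1 (a + stride) m1 H2) as (m2 & R2 & F1 & F2).
  { rewrite E2; auto. }
  destruct (run_addr_loop P _ m2 H3) as (m3 & R3 & G1 & G2).
  { rewrite F2, E2; auto. }
  exists m3. eexists. split; [|split; [|split]].
  2:{ eapply run_trans; [exact R1|]. eapply run_trans; [exact R2|].
      unfold addr. rewrite !length_app in *. rewrite <- !Nat.add_assoc in *.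
      unfold addr_loop at 1. simpl (length (_ ++ _)). exact R3. }
  - rewrite (F2 2), E1 by lia. pose proof stride_val. lia.
  - rewrite G1, F1, F2, E1 by lia. unfold cell. lia.
  - intros z Hz1 Hz2. rewrite G2, F2, E2; auto.
Qed.

Definition scratch (z : nat) : Prop := 1 <= z <= 3.

Lemma wvar_spec (x : nat) : wvar x = true -> 4 <= x < stride.
Proof.
  unfold wvar. intros [H1 H2]%andb_true_iff.
  apply Nat.leb_le in H1. apply Nat.ltb_lt in H2. auto.
Qed.

Lemma rvar_spec (x : nat) : rvar x = true -> x < stride /\ ~ scratch x.
Proof.
  unfold rvar, scratch. intros [->%Nat.eqb_eq|H%wvar_spec]%orb_true_iff; [pose proof stride_val|]; lia.
Qed.

Lemma cell_ge (a i : nat) : stride <= cell a i.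
Proof. unfold cell. nia. Qed.

Lemma cell_inj (a b i j : nat) :
  a < stride -> b < stride -> cell a i = cell b j -> a = b /\ i = j.
Proof. unfold cell. pose proof stride_val. lia. Qed.

Lemma repr_var (s : state) (m : memory) (x : nat) :
  repr s m -> rvar x = true -> m x = sv s x.
Proof.
  intros (Z & Z' & V & _). unfold rvar.
  intros [->%Nat.eqb_eq|H]%orb_true_iff; [congruence|auto].
Qed.

Lemma repr_scratch (s : state) (m m' : memory) :
  repr s m -> (forall z, ~ scratch z -> m' z = m z) -> repr s m'.
Proof.
  intros (Z & Z' & V & A) E. split; [|split; [|split]]; auto.
  - rewrite E; auto. unfold scratch; lia.
  - intros x Hx. rewrite E; auto. apply wvar_spec in Hx. unfold scratch; lia.
  - intros a i Ha. rewrite E; auto. pose proof (cell_ge a i).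
    pose proof stride_val; unfold scratch in *; lia.
Qed.

Lemma repr_setv (s : state) (m m' : memory) (x v : nat) :
  repr s m -> wvar x = true -> m' x = v ->
  (forall z, z <> x -> ~ scratch z -> m' z = m z) -> repr (setv s x v) m'.
Proof.
  intros (Z & Z' & V & A) Hx Ex E. pose proof (wvar_spec x Hx).
  split; [|split; [|split]]; simpl.
  - rewrite E; auto; unfold scratch; lia.
  - destruct x; [lia|auto].
  - intros y Hy. destruct (Nat.eqb_spec y x); subst; auto.
    apply wvar_spec in Hy as ?. rewrite E; auto. unfold scratch; lia.
  - intros a i Ha. rewrite E; auto; pose proof (cell_ge a i);
      pose proof stride_val; unfold scratch in *; lia.
Qed.

Lemma repr_seta (s : state) (m m' : memory) (a i v : nat) :
  repr s m -> a < stride -> upto m (cell a i) v m' -> repr (seta s a i v) m'.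
Proof.
  intros (Z & Z' & V & A) Ha (E1 & E2). pose proof (cell_ge a i).
  split; [|split; [|split]]; simpl; auto.
  - rewrite E2; auto. pose proof stride_val; lia.
  - intros x Hx. rewrite E2; auto. apply wvar_spec in Hx. lia.
  - intros b j Hb. destruct (Nat.eqb_spec b a), (Nat.eqb_spec j i); subst; simpl; auto;
      rewrite E2; auto; intros [? ?]%cell_inj; auto.
Qed.

Ltac split_andb :=
  repeat match goal with H : _ && _ = true |- _ => apply andb_true_iff in H as [? ?] end.

Theorem compile_correct (c : cmd) (P : program) (off : nat) (s : state) (m : memory) :
  wf c = true -> code_at P off (compile off c) -> repr s m ->
  exists m' t, t <= time c s /\
    run P t (off, m) (off + length (compile off c), m') /\ repr (exec c s) m'.
Proof.
  revert off s m; induction c; intros off s m W C R; simpl wf in W; split_andb;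
    pose proof (proj1 R) as Z.
  - exists m, 0. split; auto. split; auto. apply run_0. simpl; lia.
  - destruct (run_ldc P off x k m C Z) as (m' & R1 & E1 & E2).
    exists m', (k + 1). split; [|split]; auto. eapply repr_setv; eauto.
  - pose proof (rvar_spec _ H0) as [Hy Sy].
    destruct (run_mov P off x y m C Z) as (m' & R1 & E1 & E2). { unfold scratch in *; lia. }
    exists m', (y + 2). split; [|split]; auto. { simpl; lia. }
    eapply repr_setv; eauto. { rewrite E1. eapply repr_var; eauto. }
    intros z ? ?; apply E2; unfold scratch in *; lia.
  - exists (upd m x (S (m x))), 1. split; [|split]; auto.
    + apply code_at_cons in C as [C _]. eapply run_step; [exact C|]. apply run_0. simpl; lia.
    + eapply repr_setv; eauto. { rewrite upd_same. f_equal. apply R; auto. }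
      intros; now apply upd_other.
  - pose proof (rvar_spec _ H0) as [Hy Sy]. pose proof (wvar_spec _ H) as Hx.
    apply code_at_app in C as [C1 C2].
    destruct (run_mov P off 2 y m C1 Z) as (m1 & R1 & E1 & E2). { unfold scratch in *; lia. }
    destruct (run_monus_loop P _ x m1 C2) as (m2 & R2 & F1 & F2); try lia.
    { rewrite E2; auto. }
    exists m2. eexists. split; [|split].
    2:{ eapply run_trans; [exact R1|].
        replace (off + length (compile off (Sub x y))) with (off + length (mov 2 y) + 4);
          [exact R2|].
        cbn [compile]. rewrite length_app. cbn [length monus_loop]. lia. }
    + rewrite E1, (repr_var s m y R H0). simpl; lia.
    + eapply repr_setv; eauto.
      * rewrite F1, E1, E2 by lia.
        now rewrite !(repr_var s m) by (auto; unfold rvar; rewrite H; apply orb_true_r).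
      * intros z ? ?. rewrite F2, E2; unfold scratch in *; lia.
  - pose proof (rvar_spec _ H0) as [Hy Sy]. pose proof (wvar_spec _ H) as Hx.
    apply Nat.ltb_lt in H1. apply code_at_app in C as [C1 C2].
    destruct (run_addr P off a y m C1 Z) as (m1 & t & T & R1 & E1 & E2); auto.
    { unfold scratch in *; lia. }
    apply code_at_cons in C2 as [C2 _].
    exists (upd m1 x (m1 (m1 1))), (t + 1). split; [|split].
    + rewrite (repr_var s m y R H0) in T. simpl time. lia.
    + eapply run_trans; [exact R1|]. eapply run_step; [exact C2|]. apply run_0.
      cbn [compile]. rewrite length_app; simpl; lia.
    + assert (E : m1 (m1 1) = sa s a (sv s y)).
      { pose proof (cell_ge a (m y)). pose proof stride_val.
        rewrite E1, E2, (repr_var s m y R H0) by lia. now apply R. }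
      rewrite E. eapply repr_setv; eauto. { apply upd_same. }
      intros z ? ?. rewrite upd_other, E2; unfold scratch in *; lia.
  - pose proof (rvar_spec _ H0) as [Hy Sy]. pose proof (rvar_spec _ H) as [Hx Sx].
    apply Nat.ltb_lt in H1. apply code_at_app in C as [C1 C2].
    destruct (run_addr P off a y m C1 Z) as (m1 & t & T & R1 & E1 & E2); auto.
    { unfold scratch in *; lia. }
    apply code_at_cons in C2 as [C2 _].
    exists (upd m1 (m1 1) (m1 x)), (t + 1). split; [|split].
    + rewrite (repr_var s m y R H0) in T. simpl time. lia.
    + eapply run_trans; [exact R1|]. eapply run_step; [exact C2|]. apply run_0.
      cbn [compile]. rewrite length_app; simpl; lia.
    + assert (R' : repr s m1).
      { apply (repr_scratch s m); auto. intros; apply E2; unfold scratch in *; lia. }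
      simpl exec. eapply repr_seta; eauto.
      rewrite E1, (repr_var s m y R H0), (repr_var s m1 x R' H).
      split; [apply upd_same|]. intros; now apply upd_other.
  - simpl in C. apply code_at_app in C as [C1 C2].
    destruct (IHc1 off s m H C1 R) as (m1 & t1 & T1 & R1 & S1).
    destruct (IHc2 _ _ m1 H0 C2 S1) as (m2 & t2 & T2 & R2 & S2).
    exists m2, (t1 + t2). split; [|split]; auto. { simpl; lia. }
    eapply run_trans; [exact R1|]. cbn [compile]. rewrite length_app, Nat.add_assoc. exact R2.
  - pose proof (rvar_spec _ H2) as [Hy Sy]. pose proof (rvar_spec _ H) as [Hx Sx].
    cbn [compile] in C |- *.
    set (p0 := mov 2 x ++ mov 3 y) in *.
    set (test := p0 ++ monus_loop (off + length p0) 3) in *.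
    set (o1 := off + length test + 1) in *.
    set (p1 := compile o1 c1) in *.
    set (o2 := o1 + length p1 + 1) in *.
    set (p2 := compile o2 c2) in *.
    apply code_at_app in C as [Ct C]. apply code_at_app in Ct as [Ct Cm].
    apply code_at_app in Ct as [Cx Cy].
    apply code_at_cons in C as [Cj C]. apply code_at_app in C as [C1 C].
    apply code_at_cons in C as [Cg C2].
    destruct (run_mov P off 2 x m Cx Z) as (m1 & R1 & E1 & E2). { unfold scratch in *; lia. }
    destruct (run_mov P _ 3 y m1 Cy) as (m2 & R2 & F1 & F2).
    { rewrite E2; auto. } { unfold scratch in *; lia. }
    destruct (run_monus_loop P _ 3 m2 Cm) as (m3 & R3 & G1 & G2); try lia.
    { rewrite F2, E2; auto. }
    assert (Rt : run P (x + 2 + (y + 2) + (4 * sv s x + 1)) (off, m) (off + length test, m3)).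
    { eapply run_trans. { eapply run_trans; [exact R1|exact R2]. }
      rewrite F2, E1, (repr_var s m x R H) in R3 by lia.
      unfold test, p0 in *. rewrite !length_app in *. rewrite !Nat.add_assoc in *. exact R3. }
    assert (S3 : repr s m3).
    { apply (repr_scratch s m); auto.
      intros; rewrite G2, F2, E2; unfold scratch in *; lia. }
    assert (E3 : m3 3 = sv s y - sv s x).
    { rewrite G1, F1, E2, F2, E1 by (unfold scratch in *; lia).
      now rewrite (repr_var s m x R H), (repr_var s m y R H2). }
    cbn [exec time].
    destruct (Nat.ltb_spec (sv s x) (sv s y)) as [L|L].
    + destruct (IHc1 o1 s m3) as (m' & t & T & Rc & Sc); auto.
      { unfold o1 at 1. rewrite Nat.add_1_r. exact C1. }
      exists m'. eexists. split; [|split]; [| |exact Sc].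
      2:{ eapply run_trans; [exact Rt|]. eapply run_step; [exact Cj|]. cbn [istep].
          replace (m3 3 =? 0) with false by (symmetry; apply Nat.eqb_neq; lia).
          replace (S (off + length test)) with o1 by (unfold o1; lia).
          eapply run_trans; [exact Rc|].
          replace (o1 + length (compile o1 c1)) with (S (off + length test) + length p1)
            by (unfold p1, o1; lia).
          eapply run_step; [exact Cg|]. cbn [istep]. rewrite (proj1 Sc). apply run_0.
          unfold o2, o1. simpl Nat.eqb; cbv iota.
          rewrite !length_app. simpl length. rewrite !length_app. simpl length. lia. }
      lia.
    + destruct (IHc2 o2 s m3) as (m' & t & T & Rc & Sc); auto.
      { unfold o2 at 1, o1. replace (off + length test + 1 + length p1 + 1)
          with (S (S (off + length test) + length p1)) by lia. exact C2. }
      exists m'. eexists. split; [|split]; [| |exact Sc].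
      2:{ eapply run_trans; [exact Rt|]. eapply run_step; [exact Cj|]. cbn [istep].
          replace (m3 3 =? 0) with true by (symmetry; apply Nat.eqb_eq; lia).
          replace (off + _) with (o2 + length p2); [exact Rc|].
          unfold o2, o1.
          rewrite !length_app. simpl length. rewrite !length_app. simpl length. lia. }
      lia.
  - pose proof (rvar_spec _ H2) as [Hx Sx]. pose proof (wvar_spec _ H) as Hh.
    cbn [compile] in C |- *.
    set (o1 := off + length (mov h x)) in *.
    set (p1 := compile (o1 + 2) c) in *.
    apply code_at_app in C as [Cx C]. apply code_at_cons in C as [Cj C].
    apply code_at_cons in C as [Cd C]. apply code_at_app in C as [C1 C].
    apply code_at_cons in C as [Cg _]. fold o1 in Cj, Cd, C1, Cg.
    destruct (run_mov P off h x m Cx Z) as (m1 & R1 & E1 & E2). { unfold scratch in *; lia. }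
    assert (S1 : repr (setv s h (sv s x)) m1).
    { eapply repr_setv; eauto. { rewrite E1. eapply repr_var; eauto. }
      intros; apply E2; unfold scratch in *; lia. }
    cbn [exec time].
    set (s1 := setv s h (sv s x)) in *.
    assert (K : sv s1 h = sv s x) by (simpl; now rewrite Nat.eqb_refl).
    (* Generalized over the time [t0] spent so far, because [down] accumulates it; the extra 1 is
       the last test, which leaves the loop. Each round adds 3 for the test, the decrement and the
       jump back. *)
    assert (L : forall k t0 s1 m1, repr s1 m1 -> sv s1 h = k ->
      exists m' t, t0 + t <= 1 + snd (down k
             (fun k '(s, t) => (exec c (setv s h k), t + 3 + time c (setv s h k))) (s1, t0)) /\
        run P t (o1, m1) (o1 + 3 + length p1, m') /\
        repr (down k (fun k s => exec c (setv s h k)) s1) m').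
    { clear s1 S1 K m1 R1 E1 E2. intros k; induction k as [|k IH]; intros t0 s1 m1 S1 K.
      - exists m1, 1. split; [simpl; lia|split; auto].
        eapply run_step; [exact Cj|]. cbn [istep].
        replace (m1 h) with 0; [cbn; apply run_0; lia|].
        rewrite <- K. symmetry. now apply S1.
      - simpl down.
        assert (Q : repr (setv s1 h k) (upd m1 h k)).
        { eapply repr_setv; eauto. { apply upd_same. } intros; now apply upd_other. }
        destruct (IHc (o1 + 2) (setv s1 h k) (upd m1 h k)) as (m2 & t2 & T2 & R2 & S2); auto.
        { replace (o1 + 2) with (S (S o1)) by lia. unfold p1 in C1.
          now replace (o1 + 2) with (S (S o1)) in C1 by lia. }
        destruct (IH (t0 + 3 + time c (setv s1 h k)) (exec c (setv s1 h k)) m2)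
          as (m' & t & T & R' & S'); auto.
        { rewrite frame_v by (now apply negb_true_iff). simpl. now rewrite Nat.eqb_refl. }
        exists m', (2 + (t2 + (1 + t))). split; [lia|split; auto].
        assert (Eh : m1 h = S k) by (rewrite <- K; now apply S1).
        eapply run_step; [exact Cj|]. cbn [istep]. rewrite Eh. simpl Nat.eqb. cbv iota.
        eapply run_step; [exact Cd|]. cbn [istep]. rewrite Eh. simpl pred.
        replace (S (S o1)) with (o1 + 2) by lia.
        eapply run_trans; [exact R2|].
        replace (o1 + 2 + length (compile (o1 + 2) c)) with (S (S o1) + length p1)
          by (unfold p1; lia).
        eapply run_step; [exact Cg|]. cbn [istep]. rewrite (proj1 S2). exact R'. }
    destruct (L _ 0 _ _ S1 K) as (m' & t & T & R' & S').
    exists m', (x + 2 + t). split; [lia|split; auto].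
    eapply run_trans; [exact R1|]. fold o1.
    replace (off + _) with (o1 + 3 + length p1); [exact R'|].
    unfold o1. rewrite !length_app. simpl length. rewrite !length_app. simpl. lia.
Qed.

(** * Polynomial running time *)

Definition bnd (s : state) (V : nat) : Prop :=
  (forall x, sv s x <= V) /\ (forall a i, sa s a i <= V).

Fixpoint lv (c : cmd) : list nat :=
  match c with
  | Seq c1 c2 | IfLt _ _ c1 c2 => lv c1 ++ lv c2
  | For _ x c => x :: lv c
  | _ => []
  end.

(* When every loop bound is at most [M], this bounds both the number of basic steps
   and, since only [CInc] and [Set_] create new values, the growth of the values. *)
Fixpoint cnt (c : cmd) (M : nat) : nat :=
  match c with
  | Skip => 0
  | Set_ _ k => k + 1
  | Mov _ _ | CInc _ | Sub _ _ | Get _ _ _ | Put _ _ _ => 1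
  | Seq c1 c2 => cnt c1 M + cnt c2 M
  | IfLt _ _ c1 c2 => 1 + cnt c1 M + cnt c2 M
  | For _ _ c => 1 + M * (1 + cnt c M)
  end.

Lemma bnd_setv (s : state) (x v V W : nat) : bnd s V -> V <= W -> v <= W -> bnd (setv s x v) W.
Proof.
  intros [H1 H2] L Lv. split; simpl; intros.
  - destruct (_ =? _); auto. specialize (H1 x0). lia.
  - specialize (H2 a i). lia.
Qed.

Lemma bnd_le (s : state) (V W : nat) : bnd s V -> V <= W -> bnd s W.
Proof. intros [H1 H2] L. split; intros; [specialize (H1 x)|specialize (H2 a i)]; lia. Qed.

(** [Q] stays fixed while the induction descends. No subcommand writes to it, so the bound of an
    inner loop still has its initial value, at most [M], whenever the loop is entered. The factor
    200 covers the most expensive basic step, an array access of cost [160 + 43 * v] for an index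
    [v]. *)
Lemma exec_growth (Q : list nat) (M : nat) (c : cmd) :
  (forall x, In x Q -> inb (wv c) x = false) -> incl (lv c) Q ->
  forall s V, (forall x, In x Q -> sv s x <= M) -> bnd s V ->
  bnd (exec c s) (V + cnt c M) /\
  forall B, V + cnt c M <= B -> time c s <= cnt c M * (200 * (B + 1)).
Proof.
  induction c; intros F I s V HM HV; cbn [exec cnt time lv wv] in *;
    pose proof stride_val as SV; pose proof (proj1 HV) as HV1; pose proof (proj2 HV) as HV2.
  - split; [eapply bnd_le; eauto|]; lia.
  - split; [eapply bnd_setv; eauto|]; nia.
  - split; [eapply bnd_setv; eauto; specialize (HV1 y)|]; lia.
  - split; [eapply bnd_setv; eauto; specialize (HV1 x)|]; lia.
  - split; [eapply bnd_setv; eauto; specialize (HV1 x)|specialize (HV1 y)]; lia.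
  - split; [eapply bnd_setv; eauto; specialize (HV2 a (sv s y))|specialize (HV1 y)]; lia.
  - split; [|specialize (HV1 y); lia]. split; simpl.
    + intros z. specialize (HV1 z). lia.
    + intros b i. specialize (HV1 x). specialize (HV2 b i). destruct (_ && _); lia.
  - assert (F1 : forall x, In x Q -> inb (wv c1) x = false /\ inb (wv c2) x = false).
    { intros x Hx. specialize (F x Hx). rewrite inb_app in F. now apply orb_false_iff. }
    apply incl_app_inv in I as [I1 I2].
    destruct (IHc1 (fun x Hx => proj1 (F1 x Hx)) I1 s V HM HV) as [A1 A2].
    destruct (IHc2 (fun x Hx => proj2 (F1 x Hx)) I2 (exec c1 s) (V + cnt c1 M)) as [B1 B2]; auto.
    { intros x Hx. rewrite frame_v; auto. now apply F1. }
    split; [eapply bnd_le; eauto; lia|].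
    intros B HB. specialize (A2 B ltac:(lia)). specialize (B2 B ltac:(lia)). lia.
  - assert (F1 : forall x, In x Q -> inb (wv c1) x = false /\ inb (wv c2) x = false).
    { intros z Hx. specialize (F z Hx). rewrite inb_app in F. now apply orb_false_iff. }
    apply incl_app_inv in I as [I1 I2].
    destruct (IHc1 (fun x Hx => proj1 (F1 x Hx)) I1 s V HM HV) as [A1 A2].
    destruct (IHc2 (fun x Hx => proj2 (F1 x Hx)) I2 s V HM HV) as [B1 B2].
    specialize (HV1 x).
    split; [destruct (_ <? _); eapply bnd_le; eauto; lia|].
    intros B HB. specialize (A2 B ltac:(lia)). specialize (B2 B ltac:(lia)).
    destruct (_ <? _); lia.
  - assert (F1 : forall z, In z Q -> inb (wv c) z = false).
    { intros z Hz. specialize (F z Hz). now apply orb_false_iff in F. }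
    assert (F2 : forall z, In z Q -> z =? h = false).
    { intros z Hz. specialize (F z Hz). now apply orb_false_iff in F. }
    assert (I2 : incl (lv c) Q) by (intros z Hz; apply I; now right).
    assert (Hx : sv s x <= M) by (apply HM, I; now left).
    specialize (IHc F1 I2).
    assert (HM1 : forall z, In z Q -> sv (setv s h (sv s x)) z <= M).
    { intros z Hz. simpl. rewrite F2; auto. }
    assert (HV1' : bnd (setv s h (sv s x)) V) by (eapply bnd_setv; eauto).
    pose proof (HV1 x) as Hk.
    remember (setv s h (sv s x)) as s1 eqn:Es; clear Es.
    remember (sv s x) as k eqn:Ek; clear Ek.
    (* The value bound must grow from round to round, so [V1] is generalized along with the state;
       [j <= V1] covers the assignment to the counter. *)
    assert (L : forall j t0 s1 V1, j <= V1 -> (forall z, In z Q -> sv s1 z <= M) -> bnd s1 V1 ->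
      bnd (down j (fun k s => exec c (setv s h k)) s1) (V1 + j * (1 + cnt c M)) /\
      forall B, V1 + j * (1 + cnt c M) <= B ->
        snd (down j (fun k '(s, t) => (exec c (setv s h k), t + 3 + time c (setv s h k))) (s1, t0))
        <= t0 + j * ((1 + cnt c M) * (200 * (B + 1)))).
    { clear - IHc F1 F2. intros j. induction j as [|j IH]; intros t0 s V Hj HM HV; simpl down.
      - split; [eapply bnd_le; eauto; lia|simpl; lia].
      - destruct (IHc (setv s h j) V) as [A1 A2].
        { intros z Hz. simpl. rewrite F2; auto. }
        { eapply bnd_setv; eauto. lia. }
        destruct (IH (t0 + 3 + time c (setv s h j)) (exec c (setv s h j)) (V + (1 + cnt c M)))
          as [B1 B2].
        { lia. }
        { intros z Hz. rewrite frame_v; auto. simpl. rewrite F2; auto. }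
        { eapply bnd_le; eauto. lia. }
        split; [eapply bnd_le; eauto; lia|].
        intros B HB. specialize (A2 B ltac:(lia)). specialize (B2 B ltac:(lia)).
        etransitivity; [exact B2|]. lia. }
    destruct (L k 0 s1 V Hk HM1 HV1') as [L1 L2].
    split; [eapply bnd_le; eauto; nia|].
    intros B HB. specialize (L2 B ltac:(nia)). rewrite SV.
    etransitivity; [apply Nat.add_le_mono_l, L2|].
    assert (k * ((1 + cnt c M) * (200 * (B + 1))) <= M * ((1 + cnt c M) * (200 * (B + 1))))
      by (apply Nat.mul_le_mono_r; auto).
    lia.
Qed.

(** One number is both coefficient and degree, which is the form of the time bound in the
    theorem. *)
Definition poly (f : nat -> nat) : Prop := exists d, forall x, f x <= d * (x + 2) ^ d.

Lemma poly_le (f g : nat -> nat) : (forall x, f x <= g x) -> poly g -> poly f.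
Proof. intros H [d D]. exists d. intros x. etransitivity; eauto. Qed.

Lemma poly_const (k : nat) : poly (fun _ => k).
Proof.
  exists k. intros x. pose proof (Nat.pow_nonzero (x + 2) k ltac:(lia)). nia.
Qed.

Lemma poly_id : poly (fun x => x).
Proof. exists 1. intros x. simpl. lia. Qed.

Lemma poly_add (f g : nat -> nat) : poly f -> poly g -> poly (fun x => f x + g x).
Proof.
  intros [d D] [e E]. exists (d + e). intros x.
  assert ((x + 2) ^ d <= (x + 2) ^ (d + e)) by (apply Nat.pow_le_mono_r; lia).
  assert ((x + 2) ^ e <= (x + 2) ^ (d + e)) by (apply Nat.pow_le_mono_r; lia).
  specialize (D x). specialize (E x). nia.
Qed.

Lemma poly_mul (f g : nat -> nat) : poly f -> poly g -> poly (fun x => f x * g x).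
Proof.
  intros [d D] [e E]. exists (d * e + d + e). intros x.
  etransitivity; [apply Nat.mul_le_mono; [apply D|apply E]|].
  replace (d * (x + 2) ^ d * (e * (x + 2) ^ e)) with (d * e * (x + 2) ^ (d + e))
    by (rewrite Nat.pow_add_r; ring).
  apply Nat.mul_le_mono; [lia|]. apply Nat.pow_le_mono_r; lia.
Qed.

Lemma poly_pow (f : nat -> nat) (k : nat) : poly f -> poly (fun x => f x ^ k).
Proof.
  intros F. induction k as [|k IH]; [apply (poly_const 1)|].
  apply (poly_mul f (fun x => f x ^ k)); auto.
Qed.

Lemma poly_comp (f g : nat -> nat) : poly f -> poly g -> poly (fun x => f (g x)).
Proof.
  intros [d D] G. eapply poly_le; [intros x; apply D|].
  apply poly_mul; [apply poly_const|]. apply poly_pow, poly_add; auto. apply poly_const.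
Qed.

Lemma poly_cnt (c : cmd) : poly (cnt c).
Proof.
  induction c; simpl cnt; auto using poly_const, poly_add.
  - apply (poly_add (fun M => 1 + cnt c1 M)); auto. apply (poly_add (fun _ => 1)); auto using poly_const.
  - apply (poly_add (fun _ => 1)); auto using poly_const.
    apply poly_mul; auto using poly_id. apply (poly_add (fun _ => 1)); auto using poly_const.
Qed.

(** The bound on the final values makes the notion closed under sequencing: the second command
    starts from values up to [f V]. *)
Definition polytime (c : cmd) : Prop :=
  exists f, poly f /\ forall s V, bnd s V -> time c s <= f V /\ bnd (exec c s) (f V).

Definition loops_ok (c : cmd) : bool := forallb (fun x => negb (inb (wv c) x)) (lv c).

Lemma polytime_loops (c : cmd) : loops_ok c = true -> polytime c.
Proof.
  intros H. unfold loops_ok in H. rewrite forallb_forall in H.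
  exists (fun V => cnt c V * (200 * (V + cnt c V + 1)) + (V + cnt c V)). split.
  - pose proof (poly_cnt c). pose proof poly_id. pose proof poly_const.
    apply poly_add; [|apply poly_add; auto].
    apply poly_mul; auto. apply poly_mul; auto.
    apply (poly_add (fun V => V + cnt c V)); auto. apply poly_add; auto.
  - intros s V HV.
    destruct (exec_growth (lv c) V c) with (s := s) (V := V) as [G1 G2]; auto.
    + intros x Hx. now apply negb_true_iff, H.
    + apply incl_refl.
    + intros; apply HV.
    + split; [specialize (G2 _ (le_n _)); lia|eapply bnd_le; eauto; lia].
Qed.

(** A complete program reads its loop bounds from the input and so violates [loops_ok]; it is cut
    into pieces that satisfy it. *)
Lemma polytime_seq (c1 c2 : cmd) : polytime c1 -> polytime c2 -> polytime (c1 ;; c2).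
Proof.
  intros [f [F1 F2]] [g [G1 G2]].
  exists (fun V => f V + g (f V)). split.
  - apply poly_add; auto. now apply poly_comp.
  - intros s V HV. destruct (F2 s V HV) as [A1 A2]. destruct (G2 _ _ A2) as [B1 B2].
    simpl. split; [lia|]. eapply bnd_le; eauto. lia.
Qed.

(** * Input and output *)

Lemma code_at_prefix (P : program) (off off' : nat) (p q : program) :
  code_at P off (p ++ q) -> off' = off + length p -> code_at P off p /\ code_at P off' q.
Proof. intros H ->. now apply code_at_app. Qed.

(** Empties cell 0, leaving copies in cells 2 and 4 and the [stride]-fold in cell 3, the future
    target address. As cell 0 is not yet 0, the cleared cell 1 provides the unconditional jump. *)
Definition dup_loop (off : nat) : program :=
  [Jz 0 (off + (stride + 5)); Dec 0; Inc 2; Inc 4] ++ repeat (Inc 3) stride ++ [Jz 1 off].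

Lemma run_dup_loop (P : program) (off k : nat) (m : memory) :
  code_at P off (dup_loop off) -> m 0 = k -> m 1 = 0 ->
  exists m', run P ((stride + 5) * k + 1) (off, m) (off + (stride + 5), m') /\
    m' 0 = 0 /\ m' 2 = m 2 + k /\ m' 3 = m 3 + stride * k /\ m' 4 = m 4 + k /\
    forall z, z <> 0 -> z <> 2 -> z <> 3 -> z <> 4 -> m' z = m z.
Proof.
  intros H. apply code_at_cons in H as [H1 H]. apply code_at_cons in H as [H2 H].
  apply code_at_cons in H as [H3 H]. apply code_at_cons in H as [H4 H].
  apply code_at_app in H as [H5 H]. apply code_at_cons in H as [H6 _].
  rewrite repeat_length in H6. revert m.
  induction k as [|k IH]; intros m K Z.
  - exists m. split; [|repeat split; auto; lia]. rewrite Nat.mul_0_r.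
    eapply run_step; [exact H1|]. cbn [istep]. rewrite K. now apply run_0.
  - set (m1 := upd (upd (upd m 0 k) 2 (S (m 2))) 4 (S (m 4))).
    destruct (run_incs P _ 3 stride m1 H5) as (m2 & R2 & E1 & E2).
    destruct (IH m2) as (m' & R & F0 & F2 & F3 & F4 & F).
    + rewrite E2; auto.
    + rewrite E2; auto.
    + exists m'. split; [|repeat split; auto].
      * replace ((stride + 5) * S k + 1) with (4 + (stride + (1 + ((stride + 5) * k + 1)))) by lia.
        eapply run_step; [exact H1|]. cbn [istep]. rewrite K. cbn [Nat.eqb].
        eapply run_step; [exact H2|]. cbn [istep]. rewrite K. cbn [pred].
        eapply run_step; [exact H3|]. cbn [istep].
        eapply run_step; [exact H4|]. cbn [istep].
        eapply run_trans; [exact R2|].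
        eapply run_step; [exact H6|]. cbn [istep].
        replace (m2 1) with 0; [exact R|]. rewrite E2 by auto. symmetry. exact Z.
      * rewrite F2, E2 by auto. cbn. lia.
      * rewrite F3, E1. unfold m1. rewrite !upd_other by auto. lia.
      * rewrite F4, E2 by auto. cbn. lia.
      * intros z z0 z2 z3 z4. rewrite F, E2 by auto. unfold m1. now rewrite !upd_other.
Qed.

(** Cells 1 to 4 are registers by now, so only entries from 5 on are moved; the four decrements,
    undone after the test, make the loop stop at index 4. *)
Definition load_loop (off : nat) : program :=
  repeat (Dec 2) 4 ++ [Jz 2 (off + (stride + 13))] ++ repeat (Inc 2) 4 ++
  [LoadI 1 2; StoreI 3 1; Dec 2] ++ repeat (Dec 3) stride ++ [Jz 0 off].

(* The entries are moved upwards starting with the last one, so that none is overwritten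
   before it has been moved. *)
Lemma run_load_loop (P : program) (off k : nat) (m : memory) :
  code_at P off (load_loop off) -> m 2 = k + 4 -> m 0 = 0 -> m 3 = cell 0 (k + 4) ->
  exists m', run P ((stride + 13) * k + 5) (off, m) (off + (stride + 13), m') /\
    m' 2 = 0 /\ (forall j, 5 <= j <= k + 4 -> m' (cell 0 j) = m j) /\
    (forall z, z <> 1 -> z <> 2 -> z <> 3 ->
       (forall j, 5 <= j <= k + 4 -> z <> cell 0 j) -> m' z = m z) /\
    forall V, (forall z, m z <= V) -> forall z, m' z <= V.
Proof.
  intros H. apply code_at_app in H as [H1 H]. apply code_at_cons in H as [H2 H].
  apply code_at_app in H as [H3 H]. apply code_at_cons in H as [H4 H].
  apply code_at_cons in H as [H5 H]. apply code_at_cons in H as [H6 H].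
  apply code_at_app in H as [H7 H]. apply code_at_cons in H as [H8 _].
  rewrite !repeat_length in *. pose proof stride_val as SV. revert m.
  induction k as [|k IH]; intros m K Z Q; destruct (run_decs P off 2 4 m H1) as (m1 & R1 & E1 & E2).
  - exists m1. split; [|repeat split; auto].
    + rewrite Nat.mul_0_r. change (0 + 5) with (4 + 1). eapply run_trans; [exact R1|].
      eapply run_step; [exact H2|]. cbn [istep]. rewrite E1, K. now apply run_0.
    + lia.
    + intros j Hj. lia.
    + intros V HV z. destruct (Nat.eq_dec z 2) as [->|N]; [lia|]. rewrite E2; auto.
  - destruct (run_incs P _ 2 4 m1 H3) as (m2 & R2 & F1 & F2).
    assert (A0 : m2 2 = S k + 4) by lia.
    assert (A : forall z, z <> 2 -> m2 z = m z) by (intros; rewrite F2, E2; auto).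
    set (m3 := upd m2 1 (m (S k + 4))).
    set (m4 := upd m3 (cell 0 (S k + 4)) (m (S k + 4))).
    assert (C : cell 0 (S k + 4) = stride * S (S k + 4)) by reflexivity.
    assert (B : forall z, z <> 1 -> z <> cell 0 (S k + 4) -> m4 z = m2 z).
    { intros z z2 zc. unfold m4, m3. now rewrite !upd_other. }
    destruct (run_decs P _ 3 stride (upd m4 2 (k + 4)) H7) as (m5 & R5 & G1 & G2).
    assert (D : forall z, z <> 1 -> z <> 2 -> z <> 3 -> z <> cell 0 (S k + 4) -> m5 z = m z).
    { intros z ? ? ? ?. rewrite G2, upd_other, B, A; auto. }
    destruct (IH m5) as (m' & R & I0 & I1 & I2 & I3).
    + rewrite G2, upd_same; auto.
    + rewrite D; auto; lia.
    + rewrite G1, upd_other, B, A, Q by lia. unfold cell. lia.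
    + exists m'. split; [|repeat split; auto].
      * replace ((stride + 13) * S k + 5)
          with (4 + (1 + (4 + (3 + (stride + (1 + ((stride + 13) * k + 5))))))) by lia.
        eapply run_trans; [exact R1|].
        eapply run_step; [exact H2|]. cbn [istep].
        replace (m1 2 =? 0) with false by (symmetry; apply Nat.eqb_neq; lia).
        eapply run_trans; [exact R2|].
        eapply run_step; [exact H4|]. cbn [istep]. rewrite A0, A by lia. fold m3.
        eapply run_step; [exact H5|]. cbn [istep].
        replace (m3 3) with (cell 0 (S k + 4))
          by (unfold m3; rewrite upd_other, A by lia; auto).
        replace (m3 1) with (m (S k + 4)) by (unfold m3; now rewrite upd_same). fold m4.
        eapply run_step; [exact H6|]. cbn [istep].
        replace (pred (m4 2)) with (k + 4) by (rewrite B; lia).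
        eapply run_trans; [exact R5|].
        eapply run_step; [exact H8|]. cbn [istep].
        replace (m5 0) with 0 by (rewrite D; auto; lia). exact R.
      * intros j Hj. destruct (Nat.eq_dec j (S k + 4)) as [->|N].
        -- rewrite I2; try lia.
           ++ rewrite G2, upd_other by lia. unfold m4. now rewrite upd_same.
           ++ intros j' Hj' E. apply cell_inj in E; lia.
        -- rewrite I1 by lia. apply D; lia.
      * intros z z0 z2 z3 zj. rewrite I2; auto; [apply D; auto|]; intros; apply zj; lia.
      * intros V HV. apply I3. intros z. pose proof (HV (S k + 4)). pose proof (HV 3).
        pose proof (HV 2).
        destruct (Nat.eq_dec z 3) as [->|z3].
        { rewrite G1, upd_other, B, A by lia. lia. }
        destruct (Nat.eq_dec z 2) as [->|z0]; [rewrite G2, upd_same by auto; lia|].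
        rewrite G2, upd_other by auto. unfold m4, upd, m3.
        destruct (z =? _); auto. unfold upd. destruct (z =? 1); auto. rewrite A; auto.
Qed.

Definition save (r : nat) : program := [Inc 0; StoreI 0 r].

Lemma run_save (P : program) (off r : nat) (m : memory) :
  code_at P off (save r) -> 0 < r <= m 0 ->
  exists m', run P 2 (off, m) (off + 2, m') /\ m' 0 = S (m 0) /\ m' (S (m 0)) = m r /\
    forall z, z <> 0 -> z <> S (m 0) -> m' z = m z.
Proof.
  intros H Hr. apply code_at_cons in H as [H1 H]. apply code_at_cons in H as [H2 _].
  exists (upd (upd m 0 (S (m 0))) (S (m 0)) (m r)). repeat split.
  - eapply run_step; [exact H1|]. cbn [istep]. eapply run_step; [exact H2|]. cbn [istep].
    rewrite upd_same, (upd_other m 0 _ r) by lia. apply run_0. lia.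
  - apply upd_same.
  - intros. now rewrite !upd_other.
Qed.

(** Cell 0 holds the input length and is used as a stack pointer: the contents of cells 1 to 4 are
    pushed behind the input. After one more increment cell 0 points to a fresh cell containing 0,
    from which the four cells are cleared. *)
Definition prologue_head : program :=
  save 1 ++ save 2 ++ save 3 ++ save 4 ++
  [Inc 0; LoadI 1 0; LoadI 2 0; LoadI 3 0; LoadI 4 0; Dec 0].

Lemma run_reset (P : program) (off r : nat) (m : memory) :
  nth_error P off = Some (LoadI r 0) -> r <> 0 -> m (m 0) = 0 ->
  exists m', run P 1 (off, m) (S off, m') /\ upto m r 0 m' /\ m' (m' 0) = 0.
Proof.
  intros H Hr Z. exists (upd m r 0). split; [|split].
  - eapply run_step; [exact H|]. cbn [istep]. rewrite Z. now apply run_0.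
  - split; [apply upd_same|]. intros; now apply upd_other.
  - rewrite (upd_other m r 0 0) by auto. unfold upd. destruct (_ =? r); auto.
Qed.

Lemma run_prologue_head (P : program) (m : memory) :
  code_at P 0 prologue_head -> 4 <= m 0 -> (forall z, m 0 < z -> m z = 0) ->
  exists m', run P 14 (0, m) (14, m') /\ m' 0 = m 0 + 4 /\
    (forall z, 1 <= z <= 4 -> m' z = 0) /\
    (forall z, 5 <= z <= m 0 -> m' z = m z) /\
    (forall z, 1 <= z <= 4 -> m' (m 0 + z) = m z) /\
    (forall z, m 0 + 4 < z -> m' z = 0).
Proof.
  intros H L Z. apply code_at_app in H as [H1 H]. apply code_at_app in H as [H2 H].
  apply code_at_app in H as [H3 H]. apply code_at_app in H as [H4 H].
  apply code_at_cons in H as [H5 H]. apply code_at_cons in H as [H6 H].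
  apply code_at_cons in H as [H7 H]. apply code_at_cons in H as [H8 H].
  apply code_at_cons in H as [H9 H]. apply code_at_cons in H as [H10 _].
  destruct (run_save P _ 1 m H1) as (m1 & R1 & A1 & B1 & C1); [lia|].
  destruct (run_save P _ 2 m1 H2) as (m2 & R2 & A2 & B2 & C2); [lia|].
  destruct (run_save P _ 3 m2 H3) as (m3 & R3 & A3 & B3 & C3); [lia|].
  destruct (run_save P _ 4 m3 H4) as (m4 & R4 & A4 & B4 & C4); [lia|].
  rewrite A3, A2, A1 in *.
  assert (D : forall z, z <> 0 -> z <= m 0 \/ m 0 + 4 < z -> m4 z = m z).
  { intros z z0 zL. rewrite C4, C3, C2, C1; auto; lia. }
  set (m5 := upd m4 0 (S (m4 0))).
  assert (Z5 : m5 (m5 0) = 0).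
  { unfold m5. rewrite upd_same, upd_other, D, Z; lia. }
  destruct (run_reset P _ 1 m5 H6 ltac:(lia) Z5) as (m6 & R6 & [E6 F6] & Z6).
  destruct (run_reset P _ 2 m6 H7 ltac:(lia) Z6) as (m7 & R7 & [E7 F7] & Z7).
  destruct (run_reset P _ 3 m7 H8 ltac:(lia) Z7) as (m8 & R8 & [E8 F8] & Z8).
  destruct (run_reset P _ 4 m8 H9 ltac:(lia) Z8) as (m9 & R9 & [E9 F9] & Z9).
  assert (F : forall z, 5 <= z -> upd m9 0 (m 0 + 4) z = m4 z).
  { intros z Hz. rewrite upd_other, F9, F8, F7, F6 by lia. apply upd_other. lia. }
  exists (upd m9 0 (m 0 + 4)). split; [|split; [|split; [|split; [|split]]]].
  - change 14 with (2 + (2 + (2 + (2 + (1 + (1 + (1 + (1 + (1 + 1))))))))) at 1.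
    eapply run_trans; [exact R1|]. eapply run_trans; [exact R2|].
    eapply run_trans; [exact R3|]. eapply run_trans; [exact R4|].
    eapply run_step; [exact H5|]. cbn [istep]. fold m5.
    eapply run_trans; [exact R6|]. eapply run_trans; [exact R7|].
    eapply run_trans; [exact R8|]. eapply run_trans; [exact R9|].
    eapply run_step; [exact H10|]. cbn [istep].
    replace (pred (m9 0)) with (m 0 + 4); [now apply run_0|].
    rewrite F9, F8, F7, F6 by lia. unfold m5. rewrite upd_same. lia.
  - apply upd_same.
  - intros z Hz. rewrite upd_other by lia.
    assert (z = 1 \/ z = 2 \/ z = 3 \/ z = 4) as [->|[->|[->| ->]]] by lia;
      rewrite ?E9, ?F9, ?E8, ?F8, ?E7, ?F7, ?E6 by lia; auto.
  - intros z Hz. rewrite F by lia. apply D; lia.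
  - intros z Hz. rewrite F by lia.
    assert (z = 1 \/ z = 2 \/ z = 3 \/ z = 4) as [->|[->|[->| ->]]] by lia.
    + rewrite C4, C3, C2 by lia. rewrite Nat.add_1_r. exact B1.
    + rewrite C4, C3 by lia. replace (m 0 + 2) with (S (S (m 0))) by lia.
      rewrite B2, C1; auto; lia.
    + rewrite C4 by lia. replace (m 0 + 3) with (S (S (S (m 0)))) by lia.
      rewrite B3, C2, C1; auto; lia.
    + replace (m 0 + 4) with (S (S (S (S (m 0))))) by lia.
      rewrite B4, C3, C2, C1; auto; lia.
  - intros z Hz. rewrite F, D by lia. apply Z. lia.
Qed.

Definition prologue : program :=
  prologue_head ++ dup_loop 14 ++ repeat (Inc 3) stride ++
  load_loop (stride + 19 + stride).

Definition loaded (l : list nat) (m : memory) : Prop :=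
  m 0 = 0 /\ m 4 = length l + 4 /\
  (forall j, 5 <= j <= length l -> m (cell 0 j) = nth (j - 1) l 0) /\
  (forall j, 1 <= j <= 4 -> m (cell 0 (length l + j)) = nth (j - 1) l 0).

Lemma nth_le_max (l : list nat) (i : nat) : nth i l 0 <= list_max l.
Proof.
  destruct (Nat.lt_ge_cases i (length l)) as [H|H]; [|rewrite nth_overflow; lia].
  pose proof (list_max_le l (list_max l)) as [E _]. specialize (E (le_n _)).
  rewrite Forall_forall in E. apply E, nth_In; auto.
Qed.

Lemma run_prologue (P : program) (l : list nat) :
  code_at P 0 prologue -> 4 <= length l ->
  exists m' t, t <= 200 * (length l + 2) /\
    run P t (0, init_mem l) (length prologue, m') /\ loaded l m' /\
    forall z, m' z <= list_max l + stride * (length l + 6).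
Proof.
  intros H L. pose proof stride_val as SV.
  assert (LP : length prologue = (stride + 19 + stride) + (stride + 13)).
  { unfold prologue, dup_loop, load_loop.
    repeat (rewrite ?length_app, ?repeat_length; cbn [length]). cbn. lia. }
  rewrite LP. clear LP.
  apply code_at_prefix with (off' := 14) in H as [H1 H]; [|reflexivity].
  apply code_at_prefix with (off' := stride + 19) in H as [H2 H];
    [|unfold dup_loop; rewrite !length_app, repeat_length; cbn [length]; lia].
  apply code_at_prefix with (off' := stride + 19 + stride) in H as [H4 H5];
    [|now rewrite repeat_length].
  destruct (run_prologue_head P (init_mem l) H1) as (m1 & R1 & A0 & A1 & A2 & A3 & A4); auto.
  { intros [|z] Hz; simpl in *; [lia|]. apply nth_overflow. lia. }
  change (init_mem l 0) with (length l) in *.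
  destruct (run_dup_loop P _ (length l + 4) m1 H2) as (m2 & R2 & B0 & B2 & B3 & B4 & B); auto.
  { apply A1; lia. }
  destruct (run_incs P _ 3 stride m2 H4) as (m4 & R4 & D1 & D2).
  destruct (run_load_loop P _ (length l) m4 H5) as (m5 & R5 & E0 & E1 & E2 & E3).
  { rewrite D2, B2, A1; lia. }
  { rewrite D2, B0; lia. }
  { rewrite D1, B3, A1 by lia. unfold cell. lia. }
  assert (F : forall z, 5 <= z -> m4 z = m1 z).
  { intros z Hz. rewrite D2, B; lia. }
  exists m5. eexists. split; [|split; [|split]].
  2:{ eapply run_trans; [exact R1|]. eapply run_trans; [exact R2|].
      replace (14 + (stride + 5)) with (stride + 19) by lia.
      eapply run_trans; [exact R4|]. exact R5. }
  - lia.
  - split; [|split; [|split]].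
    + rewrite E2; try lia.
      * rewrite D2, B0; lia.
      * intros j Hj. pose proof (cell_ge 0 j). lia.
    + rewrite E2; try lia.
      * rewrite D2, B4, A1; lia.
      * intros j Hj. pose proof (cell_ge 0 j). lia.
    + intros j Hj. rewrite E1, F, A2 by lia. destruct j; [lia|]. simpl. now rewrite Nat.sub_0_r.
    + intros j Hj. rewrite E1, F, A3 by lia. destruct j; [lia|]. simpl. now rewrite Nat.sub_0_r.
  - apply E3. intros z. pose proof (nth_le_max l) as N.
    destruct (Nat.lt_ge_cases z 5) as [Hz|Hz].
    + assert (z = 0 \/ z = 1 \/ z = 2 \/ z = 3 \/ z = 4) as [->|[->|[->|[->| ->]]]] by lia.
      * rewrite D2, B0 by lia. lia.
      * rewrite D2, B, A1; lia.
      * rewrite D2, B2, A1; lia.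
      * rewrite D1, B3, A1; lia.
      * rewrite D2, B4, A1; lia.
    + rewrite F by auto. destruct (Nat.lt_ge_cases (length l + 4) z); [rewrite A4; lia|].
      destruct (Nat.lt_ge_cases (length l) z).
      * replace z with (length l + (z - length l)) by lia. rewrite A3 by lia.
        destruct (z - length l) as [|i] eqn:Ei; [lia|].
        change (init_mem l (S i)) with (nth i l 0). specialize (N i). lia.
      * rewrite A2 by lia. destruct z as [|i]; [lia|].
        change (init_mem l (S i)) with (nth i l 0). specialize (N i). lia.
Qed.

(** * Moving the result into the output cells *)

Definition fetch (r : nat) : program := LoadI r 5 :: repeat (Inc 5) stride.

Lemma run_fetch (P : program) (off r a i : nat) (m : memory) :
  code_at P off (fetch r) -> r < 5 -> m 5 = cell a i ->
  exists m', run P (1 + stride) (off, m) (off + (1 + stride), m') /\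
    m' 5 = cell a (S i) /\ m' r = m (cell a i) /\ forall z, z <> r -> z <> 5 -> m' z = m z.
Proof.
  intros H Hr E. apply code_at_cons in H as [H1 H].
  destruct (run_incs P _ 5 stride (upd m r (m (m 5))) H) as (m' & R & E1 & E2).
  exists m'. repeat split.
  - replace (off + (1 + stride)) with (S off + stride) by lia.
    eapply run_step; [exact H1|]. exact R.
  - rewrite E1, upd_other, E by lia. unfold cell. lia.
  - rewrite E2, upd_same by lia. now rewrite E.
  - intros. now rewrite E2, upd_other.
Qed.

(** Started at entry 5, since the cells up to 5 are still registers. It runs for the full length and
    not for five rounds less: then the pointer in cell 5 stops exactly at the spare copies, and the
    surplus cells lie beyond the announced length. *)
Definition store_loop (off : nat) : program :=
  [Jz 2 (off + (stride + 6)); LoadI 1 5; StoreI 3 1; Inc 3; Dec 2] ++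
  repeat (Inc 5) stride ++ [Jz 0 off].

Lemma run_store_loop (P : program) (off a k i : nat) (m : memory) :
  code_at P off (store_loop off) -> m 0 = 0 -> m 2 = k -> m 3 = S i -> m 5 = cell a i ->
  5 <= i ->
  exists m', run P ((stride + 6) * k + 1) (off, m) (off + (stride + 6), m') /\
    m' 5 = cell a (i + k) /\
    (forall j, i <= j < i + k -> m' (S j) = m (cell a j)) /\
    (forall z, z <> 1 -> z <> 2 -> z <> 3 -> z <> 5 -> z <= i \/ i + k < z -> m' z = m z).
Proof.
  intros H. apply code_at_cons in H as [H1 H]. apply code_at_cons in H as [H2 H].
  apply code_at_cons in H as [H3 H]. apply code_at_cons in H as [H4 H].
  apply code_at_cons in H as [H5 H]. apply code_at_app in H as [H6 H].
  apply code_at_cons in H as [H7 _]. rewrite repeat_length in H7.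
  pose proof stride_val as SV. revert i m.
  induction k as [|k IH]; intros i m Z K D S I.
  - exists m. split; [|repeat split; auto; try lia].
    + rewrite Nat.mul_0_r. eapply run_step; [exact H1|]. cbn [istep]. rewrite K. now apply run_0.
    + now rewrite Nat.add_0_r.
  - set (v := m (cell a i)).
    set (m1 := upd (upd (upd (upd m 1 v) (Datatypes.S i) v) 3 (Datatypes.S (Datatypes.S i))) 2 k).
    assert (A : forall z, z <> 1 -> z <> 2 -> z <> 3 -> z <> Datatypes.S i -> m1 z = m z).
    { intros z ? ? ? ?. unfold m1. now rewrite !upd_other. }
    destruct (run_incs P _ 5 stride m1 H6) as (m2 & R2 & E1 & E2).
    destruct (IH (Datatypes.S i) m2) as (m' & R & F1 & F2 & F3).
    + rewrite E2, A; lia.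
    + rewrite E2 by lia. unfold m1. now rewrite upd_same.
    + rewrite E2 by lia. unfold m1. now rewrite upd_other, upd_same.
    + rewrite E1, A, S by lia. unfold cell. lia.
    + lia.
    + exists m'. split; [|repeat split].
      * replace ((stride + 6) * Datatypes.S k + 1)
          with (5 + (stride + (1 + ((stride + 6) * k + 1)))) by lia.
        eapply run_step; [exact H1|]. cbn [istep]. rewrite K. cbn [Nat.eqb].
        eapply run_step; [exact H2|]. cbn [istep]. rewrite S. fold v.
        eapply run_step; [exact H3|]. cbn [istep].
        rewrite (upd_other m 1 v 3), D, upd_same by auto.
        eapply run_step; [exact H4|]. cbn [istep].
        rewrite (upd_other _ (Datatypes.S i) v 3), (upd_other m 1 v 3), D by lia.
        eapply run_step; [exact H5|]. cbn [istep].
        rewrite (upd_other _ 3 _ 2), (upd_other _ (Datatypes.S i) v 2), (upd_other m 1 v 2), K by lia.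
        eapply run_trans; [exact R2|].
        eapply run_step; [exact H7|]. cbn [istep].
        replace (m2 0) with 0 by (rewrite E2, A; lia). exact R.
      * rewrite F1. f_equal. lia.
      * intros j Hj. destruct (Nat.eq_dec j i) as [->|N].
        -- rewrite F3, E2 by lia. unfold m1. now rewrite 2 upd_other, upd_same by lia.
        -- pose proof (cell_ge a j). rewrite F2, E2, A; try lia. unfold cell. nia.
      * intros z ? ? ? ? Hz. rewrite F3, E2, A; lia.
Qed.

(* The machine registers overlap the first output cells, so five spare copies of these
   outputs are expected behind the output array and fetched at the very end. *)
Definition epilogue (off a len : nat) : program :=
  let p := mov 2 len ++ mov 4 len ++ ldc 3 6 ++ ldc 5 (a + stride * 6) in
  p ++ store_loop (off + length p) ++ fetch 1 ++ fetch 2 ++ fetch 3 ++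
  repeat (Inc 0) 4 ++ [LoadI 0 0] ++ fetch 4 ++ [LoadI 5 5].

Lemma run_epilogue (P : program) (off a len : nat) (s : state) (m : memory) :
  code_at P off (epilogue off a len) -> repr s m -> a < stride -> 6 <= len < stride ->
  (forall j, j < 5 -> sa s a (5 + sv s len + j) = sa s a j) ->
  exists m' t, t <= 500 * (sv s len + 2) /\
    run P t (off, m) (off + length (epilogue off a len), m') /\
    read_output m' = map (sa s a) (seq 0 (sv s len)).
Proof.
  intros H R Ha Hl Hs. pose proof stride_val as SV. pose proof (proj1 R) as Z.
  assert (V : wvar len = true).
  { unfold wvar. apply andb_true_iff; split; [apply Nat.leb_le|apply Nat.ltb_lt]; lia. }
  assert (RA : forall i, m (cell a i) = sa s a i) by (intros; now apply R).
  assert (RL : m len = sv s len) by now apply R.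
  set (n := sv s len) in *.
  set (p := mov 2 len ++ mov 4 len ++ ldc 3 6 ++ ldc 5 (a + stride * 6)) in *.
  change (epilogue off a len) with
    (p ++ store_loop (off + length p) ++ fetch 1 ++ fetch 2 ++ fetch 3 ++
     repeat (Inc 0) 4 ++ [LoadI 0 0] ++ fetch 4 ++ [LoadI 5 5]) in *.
  assert (Lf : forall r, length (fetch r) = 1 + stride).
  { intros r. unfold fetch. cbn [length]. now rewrite repeat_length. }
  assert (Ls : forall o, length (store_loop o) = stride + 6).
  { intros o. unfold store_loop. rewrite !length_app, repeat_length. cbn. lia. }
  apply code_at_app in H as [H0 H].
  apply code_at_prefix with (off' := off + length p + (stride + 6)) in H as [Hst H];
    [|now rewrite Ls].
  set (o := off + length p) in *.
  apply code_at_prefix with (off' := o + (stride + 6) + (1 + stride)) in H as [Hf1 H];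
    [|now rewrite Lf].
  apply code_at_prefix with (off' := o + (stride + 6) + (1 + stride) + (1 + stride)) in H as [Hf2 H];
    [|now rewrite Lf].
  apply code_at_prefix with
    (off' := o + (stride + 6) + (1 + stride) + (1 + stride) + (1 + stride)) in H as [Hf3 H];
    [|now rewrite Lf].
  set (o3 := o + (stride + 6) + (1 + stride) + (1 + stride) + (1 + stride)) in *.
  apply code_at_prefix with (off' := o3 + 4) in H as [Hi H]; [|reflexivity].
  apply code_at_prefix with (off' := o3 + 5) in H as [Hl0 H]; [|simpl; lia].
  apply code_at_prefix with (off' := o3 + 5 + (1 + stride)) in H as [Hf4 Hl5]; [|now rewrite Lf].
  apply code_at_cons in Hl0 as [Hl0 _]. apply code_at_cons in Hl5 as [Hl5 _].
  apply code_at_app in H0 as [Ha1 H0]. apply code_at_app in H0 as [Ha2 H0].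
  apply code_at_app in H0 as [Ha3 Ha4].
  destruct (run_mov P off 2 len m Ha1 Z) as (m1 & R1 & A1 & B1); [lia|].
  destruct (run_mov P _ 4 len m1 Ha2) as (m2 & R2 & A2 & B2); [rewrite B1; auto|lia|].
  destruct (run_ldc P _ 3 6 m2 Ha3) as (m3 & R3 & A3 & B3); [rewrite B2, B1; auto|].
  destruct (run_ldc P _ 5 _ m3 Ha4) as (m4 & R4 & A4 & B4); [rewrite B3, B2, B1; auto|].
  assert (E4 : forall z, z = 0 \/ 6 <= z -> m4 z = m z).
  { intros z Hz. rewrite B4, B3, B2, B1; lia. }
  destruct (run_store_loop P o a n 5 m4 Hst) as (m5 & R5 & A5 & B5 & C5); auto.
  { rewrite E4; auto. }
  { rewrite B4, B3, B2, A1; auto. }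
  { rewrite B4, A3; auto. }
  assert (E5 : forall i, 5 + n <= i -> m5 (cell a i) = sa s a i).
  { intros i Hi'. pose proof (cell_ge a i).
    rewrite C5, E4, RA; auto; try lia. right. unfold cell. nia. }
  destruct (run_fetch P _ 1 a (5 + n) m5 Hf1) as (m6 & R6 & A6 & B6 & C6); [lia|exact A5|].
  destruct (run_fetch P _ 2 a (S (5 + n)) m6 Hf2) as (m7 & R7 & A7 & B7 & C7); [lia|exact A6|].
  destruct (run_fetch P _ 3 a (S (S (5 + n))) m7 Hf3) as (m8 & R8 & A8 & B8 & C8); [lia|exact A7|].
  destruct (run_incs P _ 0 4 m8 Hi) as (m9 & R9 & A9 & B9).
  (* After four increments cell 0 points to cell 4, where the length was kept; [LoadI 0 0] then
     fetches the length without another register. *)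
  assert (N9 : m9 (m9 0) = n).
  { rewrite A9, C8, C7, C6, C5, E4, Z by lia. simpl.
    rewrite B9, C8, C7, C6, C5, B4, B3, A2, B1; lia. }
  set (m10 := upd m9 0 n).
  destruct (run_fetch P _ 4 a (S (S (S (5 + n)))) m10 Hf4) as (m11 & R11 & A11 & B11 & C11); [lia|..].
  { unfold m10. rewrite upd_other, B9, A8; auto. }
  assert (E8 : forall i, 5 + n <= i -> m8 (cell a i) = sa s a i).
  { intros i Hi'. pose proof (cell_ge a i). rewrite C8, C7, C6, E5; lia. }
  assert (E11 : forall i, 5 + n <= i -> m11 (cell a i) = sa s a i).
  { intros i Hi'. pose proof (cell_ge a i). rewrite C11 by lia.
    unfold m10. rewrite upd_other, B9, E8; lia. }
  (* The pointer lives in the last output cell still missing, so it is replaced by the entry to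
     which it points. *)
  set (m12 := upd m11 5 (m11 (m11 5))).
  assert (G : forall z, z <> 0 -> z <> 4 -> z <> 5 -> m12 z = m8 z).
  { intros z ? ? ?. unfold m12. rewrite upd_other, C11 by auto.
    unfold m10. rewrite upd_other, B9; auto. }
  exists m12. eexists. split; [|split].
  2:{ eapply run_trans; [exact R1|]. eapply run_trans; [exact R2|].
      eapply run_trans; [exact R3|]. eapply run_trans; [exact R4|].
      replace (off + length (mov 2 len) + length (mov 4 len) + length (ldc 3 6) +
        length (ldc 5 (a + stride * 6))) with o by (unfold o, p; rewrite !length_app; lia).
      eapply run_trans; [exact R5|]. eapply run_trans; [exact R6|].
      eapply run_trans; [exact R7|]. eapply run_trans; [exact R8|].
      fold o3. eapply run_trans; [exact R9|].
      eapply (run_trans _ 1).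
      { eapply run_step; [exact Hl0|]. cbn [istep]. rewrite N9. fold m10.
        apply (run_0 P _ (o3 + 5)). lia. }
      eapply run_trans; [exact R11|].
      eapply run_step; [exact Hl5|]. cbn [istep]. fold m12. apply run_0.
      repeat (rewrite ?length_app, ?repeat_length, ?Ls, ?Lf; cbn [length]). unfold o3, o. lia. }
  - nia.
  - unfold read_output.
    replace (m12 0) with n
      by (unfold m12; rewrite upd_other, C11 by lia; unfold m10; now rewrite upd_same).
    apply map_ext_in. intros i Hi'%in_seq.
    destruct (Nat.lt_ge_cases i 5) as [L|L].
    + assert (i = 0 \/ i = 1 \/ i = 2 \/ i = 3 \/ i = 4) as [->|[->|[->|[->| ->]]]] by lia.
      * rewrite G, C8, C7, B6, E5 by lia. rewrite <- (Hs 0) by lia. f_equal. lia.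
      * rewrite G, C8, B7, C6, E5 by (try lia; pose proof (cell_ge a (S (5 + n))); lia).
        rewrite <- (Hs 1) by lia. f_equal. lia.
      * pose proof (cell_ge a (S (S (5 + n)))).
        rewrite G, B8, C7, C6, E5 by lia. rewrite <- (Hs 2) by lia. f_equal. lia.
      * pose proof (cell_ge a (S (S (S (5 + n))))).
        unfold m12. rewrite upd_other, B11 by lia. unfold m10. rewrite upd_other, B9, E8 by lia.
        rewrite <- (Hs 3) by lia. f_equal. lia.
      * unfold m12. rewrite upd_same, A11, E11 by lia. rewrite <- (Hs 4) by lia. f_equal. lia.
    + rewrite G, C8, C7, C6, B5, E4, RA by (try (pose proof (cell_ge a i)); lia). reflexivity.
Qed.

(** * Joining a loop program to its input and output code *)

Notation aIN := 0 (only parsing).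
Notation aOUT := 5 (only parsing).
Notation vLEN := 22 (only parsing).

(* The prologue puts the first four entries behind the others and [length l + 4] into cell 4. *)
Definition fetch_head : cmd :=
  Mov 5 4 ;; Set_ 6 4 ;; Sub 5 6 ;;
  CInc 5 ;; Get 7 aIN 5 ;; Set_ 6 1 ;; Put aIN 6 7 ;;
  CInc 5 ;; Get 7 aIN 5 ;; Set_ 6 2 ;; Put aIN 6 7 ;;
  CInc 5 ;; Get 7 aIN 5 ;; Set_ 6 3 ;; Put aIN 6 7 ;;
  CInc 5 ;; Get 7 aIN 5 ;; Set_ 6 4 ;; Put aIN 6 7.

Definition spare_copies : cmd :=
  Mov 5 vLEN ;; CInc 5 ;; CInc 5 ;; CInc 5 ;; CInc 5 ;; CInc 5 ;;
  Set_ 6 0 ;; Get 7 aOUT 6 ;; Put aOUT 5 7 ;; CInc 5 ;;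
  Set_ 6 1 ;; Get 7 aOUT 6 ;; Put aOUT 5 7 ;; CInc 5 ;;
  Set_ 6 2 ;; Get 7 aOUT 6 ;; Put aOUT 5 7 ;; CInc 5 ;;
  Set_ 6 3 ;; Get 7 aOUT 6 ;; Put aOUT 5 7 ;; CInc 5 ;;
  Set_ 6 4 ;; Get 7 aOUT 6 ;; Put aOUT 5 7.

Definition input (l : list nat) (s : state) : Prop :=
  sv s 0 = 0 /\ forall j, j < length l -> sa s aIN (S j) = nth j l 0.

Definition output (s : state) : list nat := map (sa s aOUT) (seq 0 (sv s vLEN)).

Lemma exec_fetch_head (l : list nat) (m : memory) :
  4 <= length l -> loaded l m -> input l (exec fetch_head (St m (fun a i => m (cell a i)))).
Proof.
  intros L (H0 & H4 & H5 & H1). unfold fetch_head, input. cbn.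
  rewrite H4. replace (length l + 4 - 4) with (length l) by lia. split; auto.
  pose proof (H1 1 ltac:(lia)) as E1. pose proof (H1 2 ltac:(lia)) as E2.
  pose proof (H1 3 ltac:(lia)) as E3. pose proof (H1 4 ltac:(lia)) as E4.
  rewrite Nat.add_comm in E1, E2, E3, E4. cbn in E1, E2, E3, E4.
  destruct l as [|x0 [|x1 [|x2 [|x3 l]]]]; cbn in L; try lia.
  intros [|[|[|[|j]]]] Hj; cbn in *; auto.
  rewrite H5 by lia. reflexivity.
Qed.

Lemma exec_spare_copies (s : state) :
  output (exec spare_copies s) = output s /\
  sv (exec spare_copies s) vLEN = sv s vLEN /\
  forall j, j < 5 ->
    sa (exec spare_copies s) aOUT (5 + sv s vLEN + j) = sa (exec spare_copies s) aOUT j.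
Proof.
  unfold output, spare_copies. cbn.
  split; [|split; auto].
  - apply map_ext_in. intros i Hi%in_seq.
    repeat (match goal with |- context [?i =? ?k] => destruct (Nat.eqb_spec i k) end);
      subst; try lia; reflexivity.
  - intros j Hj.
    assert (j = 0 \/ j = 1 \/ j = 2 \/ j = 3 \/ j = 4) as [->|[->|[->|[->| ->]]]] by lia; cbn;
    rewrite ?Nat.add_0_r;
    repeat (match goal with |- context [?i =? ?k] => destruct (Nat.eqb_spec i k) end);
      subst; try lia; reflexivity.
Qed.

Lemma exec_seq (c1 c2 : cmd) (s : state) : exec (c1 ;; c2) s = exec c2 (exec c1 s).
Proof. reflexivity. Qed.

Lemma exec_for (h x : nat) (c : cmd) (s : state) :
  exec (For h x c) s =
    down (sv s x) (fun k s => exec c (setv s h k)) (setv s h (sv s x)).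
Proof. reflexivity. Qed.

#[local] Opaque fetch_head spare_copies.

Lemma poly_bound (d k : nat) :
  exists d', forall x y, y <= k * (x + 2) -> d * (y + 2) ^ d <= d' * (x + 2) ^ d'.
Proof.
  assert (H : poly (fun x => d * (k * (x + 2) + 2) ^ d)).
  { pose proof poly_id as Pi. pose proof poly_const as Pc.
    apply poly_mul; auto. apply poly_pow, poly_add; auto. apply poly_mul; auto.
    apply poly_add; auto. }
  destruct H as (d' & H). exists d'. intros x y Hy. etransitivity; [|apply H].
  apply Nat.mul_le_mono_l, Nat.pow_le_mono_l. lia.
Qed.

Lemma runs_within_le (P : program) (l o : list nat) (T T' : nat) :
  T <= T' -> runs_within P l T o -> runs_within P l T' o.
Proof. intros H (t & Ht & R). exists t. split; [lia|exact R]. Qed.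

(** The state [s] is existential because the prologue leaves arbitrary values in other registers and
    arrays: correctness of [c] may rely on [input l s] only. Four input entries are required because
    the prologue saves cells 1 to 4. *)
Theorem cmd_implementable (c : cmd) :
  wf c = true -> polytime c ->
  exists (P : program) (d : nat),
    forall l, 4 <= length l -> exists s, input l s /\
      runs_within P l (d * (list_max l + length l + 2) ^ d) (output (exec c s)).
Proof.
  intros W T.
  set (c' := fetch_head ;; c ;; spare_copies).
  assert (W' : wf c' = true).
  { unfold c'. cbn [wf]. now rewrite W. }
  assert (T' : polytime c').
  { apply polytime_seq; [now apply polytime_loops|]. apply polytime_seq; auto.
    now apply polytime_loops. }
  destruct T' as (f & F & HF).
  set (p1 := compile (length prologue) c').
  set (P := prologue ++ p1 ++ epilogue (length prologue + length p1) aOUT vLEN).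
  (* [g] bounds every value in memory when the compiled code starts; the target addresses used by
     the prologue cause the factor [stride]. *)
  set (g := fun x => x + stride * (x + 6)).
  assert (PT : poly (fun x => 200 * (x + 2) + f (g x) + 500 * (f (g x) + 2))).
  { pose proof poly_id as Pi. pose proof poly_const as Pc.
    assert (G : poly g) by (apply poly_add, poly_mul, poly_add; auto).
    pose proof (poly_comp f g F G).
    apply poly_add; [apply poly_add|]; auto; apply poly_mul; auto; apply poly_add; auto. }
  destruct PT as (d & PT). exists P, d. intros l L. pose proof stride_val as SV.
  assert (CP : code_at P 0 P) by (intros i _; reflexivity).
  apply code_at_app in CP as [C1 CP]. apply code_at_app in CP as [C2 C3].
  destruct (run_prologue P l C1 L) as (m1 & t1 & T1 & R1 & I & B).
  set (s := St m1 (fun a i => m1 (cell a i))).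
  assert (S1 : repr s m1) by (repeat split; auto; apply I).
  destruct (compile_correct c' P _ s m1 W' C2 S1) as (m2 & t2 & T2 & R2 & S2).
  destruct (HF s (g (list_max l + length l))) as [G1 G2].
  { split; intros; simpl; (etransitivity; [apply B|unfold g; lia]). }
  pose proof (exec_spare_copies (exec c (exec fetch_head s))) as (E1 & E2 & E3).
  pose proof (exec_seq fetch_head (c ;; spare_copies) s) as Q. rewrite (exec_seq c) in Q.
  fold c' in Q. rewrite <- Q in E1, E2, E3.
  destruct (run_epilogue P _ aOUT vLEN (exec c' s) m2 C3 S2) as (m3 & t3 & T3 & R3 & O); try lia.
  { intros j Hj. rewrite E2. now apply E3. }
  exists (exec fetch_head s). split; [now apply exec_fetch_head|].
  exists (t1 + (t2 + t3)). pose proof (proj1 G2 vLEN). split.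
  - etransitivity; [|apply PT]. set (y := f (g (list_max l + length l))) in *. lia.
  - assert (R : run P (t1 + (t2 + t3)) (0, init_mem l) (length P, m3)).
    { eapply run_trans; [exact R1|]. eapply run_trans; [exact R2|].
      replace (length P) with (0 + length prologue + length p1 +
        length (epilogue (length prologue + length p1) aOUT vLEN))
        by (unfold P; rewrite !length_app; lia). exact R3. }
    unfold run in R. rewrite R. split; [unfold halted; simpl; lia|].
    simpl snd. rewrite O. exact E1.
Qed.

(** * Degrees and the cost *)

Definition sumf {T : Type} (f : T -> nat) (l : list T) : nat := list_sum (map f l).

Lemma sumf_app {T : Type} (f : T -> nat) (l l' : list T) : sumf f (l ++ l') = sumf f l + sumf f l'.
Proof. unfold sumf. now rewrite map_app, list_sum_app. Qed.

Lemma sumf_add {T : Type} (f g : T -> nat) (l : list T) :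
  sumf (fun x => f x + g x) l = sumf f l + sumf g l.
Proof. unfold sumf. induction l; simpl; lia. Qed.

Lemma sumf_le {T : Type} (f g : T -> nat) (l : list T) :
  (forall x, In x l -> f x <= g x) -> sumf f l <= sumf g l.
Proof.
  unfold sumf. induction l as [|a l IH]; intros H; simpl; auto.
  pose proof (H a (or_introl eq_refl)). assert (list_sum (map f l) <= list_sum (map g l)); [|lia].
  apply IH. intros; apply H; now right.
Qed.

Lemma sumf_const {T : Type} (k : nat) (l : list T) : sumf (fun _ => k) l = k * length l.
Proof. unfold sumf. induction l; simpl; lia. Qed.

Lemma sumf_mul {T : Type} (k : nat) (f : T -> nat) (l : list T) :
  sumf (fun x => k * f x) l = k * sumf f l.
Proof.
  induction l as [|a l IH]; [unfold sumf; simpl; lia|].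
  change (k * f a + sumf (fun x => k * f x) l = k * (f a + sumf f l)). lia.
Qed.

Lemma sumf_exchange {S T : Type} (f : S -> T -> nat) (l : list S) (l' : list T) :
  sumf (fun x => sumf (f x) l') l = sumf (fun y => sumf (fun x => f x y) l) l'.
Proof.
  induction l as [|a l IH].
  - unfold sumf at 1; simpl. rewrite (sumf_const 0). reflexivity.
  - change (sumf (f a) l' + sumf (fun x => sumf (f x) l') l =
      sumf (fun y => f a y + sumf (fun x => f x y) l) l').
    rewrite sumf_add. now f_equal.
Qed.

Lemma sumf_filter {T : Type} (f : T -> nat) (p : T -> bool) (l : list T) :
  sumf f l = sumf f (filter p l) + sumf f (filter (fun x => negb (p x)) l).
Proof.
  unfold sumf. induction l as [|a l IH]; simpl; auto. destruct (p a); simpl; lia.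
Qed.

Lemma sumf_perm {T : Type} (f : T -> nat) (l l' : list T) :
  Permutation l l' -> sumf f l = sumf f l'.
Proof. unfold sumf. induction 1; simpl; lia. Qed.

Lemma sumf_incl (f : nat -> nat) (l l' : list nat) :
  NoDup l -> incl l l' -> sumf f l <= sumf f l'.
Proof.
  revert l'. induction l as [|a l IH]; intros l' N I; [unfold sumf at 1; simpl; lia|].
  inversion_clear N as [|? ? Na Nl].
  destruct (in_split a l') as (l1 & l2 & ->); [apply I; now left|].
  rewrite (sumf_perm f (l1 ++ a :: l2) (a :: l1 ++ l2))
    by (symmetry; apply Permutation_middle).
  assert (H : sumf f l <= sumf f (l1 ++ l2)).
  { apply IH; auto. intros x Hx. specialize (I x (or_intror Hx)).
    apply in_app_iff in I as [?|[->|?]]; [|contradiction|]; apply in_app_iff; auto. }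
  unfold sumf in *; simpl; lia.
Qed.

Lemma length_filter_sumf {T : Type} (p : T -> bool) (l : list T) :
  length (filter p l) = sumf (fun x => Nat.b2n (p x)) l.
Proof. unfold sumf. induction l as [|a l IH]; simpl; auto. destruct (p a); simpl; lia. Qed.

Lemma sumf_eqb_le (V : list nat) (x : nat) :
  NoDup V -> sumf (fun v => Nat.b2n (x =? v)) V <= Nat.b2n (existsb (Nat.eqb x) V).
Proof.
  induction V as [|a V IH]; intros N; [unfold sumf; simpl; lia|].
  inversion_clear N as [|? ? Na NV]. specialize (IH NV).
  change (Nat.b2n (x =? a) + sumf (fun v => Nat.b2n (x =? v)) V <=
    Nat.b2n ((x =? a) || existsb (Nat.eqb x) V)).
  destruct (Nat.eqb_spec x a) as [->|]; simpl; auto.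
  destruct (existsb (Nat.eqb a) V) eqn:E; simpl in IH; [|lia].
  exfalso. apply existsb_exists in E as (b & Hb & ->%Nat.eqb_eq). contradiction.
Qed.

Definition ends (e : nat * nat) (v : nat) : nat := Nat.b2n (fst e =? v) + Nat.b2n (snd e =? v).

Definition wt (G : graph) (v : nat) : nat := S (sumf (fun e => ends e v) (gE G)).

Lemma sumf_ends_le (V : list nat) (e : nat * nat) : NoDup V ->
  sumf (ends e) V <= 2 * Nat.b2n (existsb (Nat.eqb (fst e)) V || existsb (Nat.eqb (snd e)) V).
Proof.
  intros N. unfold ends. rewrite sumf_add.
  pose proof (sumf_eqb_le V (fst e) N). pose proof (sumf_eqb_le V (snd e) N).
  destruct (existsb (Nat.eqb (fst e)) V), (existsb (Nat.eqb (snd e)) V); simpl in *; lia.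
Qed.

(** Double counting: an edge adds at most 2 to the degrees inside [V], and nothing unless it has an
    end there. *)
Lemma sumf_wt (G : graph) (V : list nat) : NoDup V ->
  sumf (wt G) V <= length V + 2 * length (filter
    (fun e => existsb (Nat.eqb (fst e)) V || existsb (Nat.eqb (snd e)) V) (gE G)).
Proof.
  intros N. unfold wt. change (fun v => S ?f) with (fun v : nat => 1 + f).
  rewrite (sumf_add (fun _ => 1)), sumf_const.
  rewrite (sumf_exchange (fun v e => ends e v)), length_filter_sumf, Nat.mul_1_l.
  apply Nat.add_le_mono_l.
  transitivity (sumf (fun e => 2 * Nat.b2n (existsb (Nat.eqb (fst e)) V ||
    existsb (Nat.eqb (snd e)) V)) (gE G)).
  - apply sumf_le. intros e _. now apply sumf_ends_le.
  - now rewrite sumf_mul.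
Qed.

Lemma adjb_spec (G : graph) (u v : nat) : adjb G u v = true <-> adj G u v.
Proof.
  assert (H : forall a, existsb (pair_eqb a) (gE G) = true <-> In a (gE G)).
  { intros [x y]. rewrite existsb_exists. split.
    - intros ([x' y'] & Hi & Hp). unfold pair_eqb in Hp. simpl in Hp.
      apply andb_true_iff in Hp as [->%Nat.eqb_eq ->%Nat.eqb_eq]. auto.
    - intros Hi. exists (x, y). split; auto. unfold pair_eqb. simpl. now rewrite !Nat.eqb_refl. }
  unfold adjb, adj. now rewrite orb_true_iff, !H.
Qed.

Definition nbhd (G : graph) (V : list nat) : list nat :=
  filter (in_closed_nbhd G V) (seq 0 (gn G)).

Lemma cost_nbhd (G : graph) (V : list nat) : cost G V = length (nbhd G V).
Proof.
  unfold cost, nbhd. induction (seq 0 (gn G)) as [|a l IH]; simpl; auto.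
  destruct (in_closed_nbhd G V a), (bool_dec _ true); simpl; congruence.
Qed.

Lemma in_closed_nbhd_spec (G : graph) (V : list nat) (x : nat) :
  in_closed_nbhd G V x = true <-> exists y, In y V /\ (x = y \/ adj G y x).
Proof.
  unfold in_closed_nbhd. rewrite existsb_exists. split.
  - intros (y & Hy & H). exists y. split; auto.
    apply orb_true_iff in H as [->%Nat.eqb_eq|H%adjb_spec]; auto.
  - intros (y & Hy & H). exists y. split; auto. apply orb_true_iff.
    destruct H as [->|H]; [left; apply Nat.eqb_refl|right; now apply adjb_spec].
Qed.

Lemma in_nbhd (G : graph) (V : list nat) (x : nat) :
  In x (nbhd G V) <-> x < gn G /\ exists y, In y V /\ (x = y \/ adj G y x).
Proof.
  unfold nbhd. rewrite filter_In, in_closed_nbhd_spec, in_seq. intuition lia.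
Qed.

Lemma cost_le_wt (G : graph) (V : list nat) : cost G V <= sumf (wt G) V.
Proof.
  rewrite cost_nbhd.
  (* [nb v] lists [v] and one neighbor per incident edge, so its length is at most [wt G v], and
     these lists cover the closed neighborhood. *)
  set (nb := fun v => v :: flat_map (fun e => (if fst e =? v then [snd e] else []) ++
    (if snd e =? v then [fst e] else [])) (gE G)).
  transitivity (length (flat_map nb V)).
  - apply NoDup_incl_length; [apply NoDup_filter, seq_NoDup|].
    intros x [_ (y & Hy & H)]%in_nbhd. apply in_flat_map. exists y. split; auto.
    unfold nb. destruct H as [->|[H|H]]; [now left|right..].
    + apply in_flat_map. exists (y, x). split; auto. simpl. rewrite Nat.eqb_refl. now left.
    + apply in_flat_map. exists (x, y). split; auto. simpl. rewrite Nat.eqb_refl.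
      apply in_app_iff. right. now left.
  - rewrite length_flat_map. apply sumf_le. intros v _. unfold nb, wt. simpl.
    rewrite length_flat_map. apply le_n_S. apply sumf_le. intros [a b] _. unfold ends. simpl.
    rewrite length_app. destruct (a =? v), (b =? v); simpl; lia.
Qed.

Lemma wt_le_cost (G : graph) (l : nat) (V : list nat) :
  wf_graph G -> bounded_density l G -> NoDup V -> (forall x, In x V -> x < gn G) ->
  sumf (wt G) V <= (2 * l + 1) * cost G V.
Proof.
  intros [NE WE] BD N HV. rewrite cost_nbhd.
  pose proof (sumf_wt G V N) as H.
  set (E' := filter _ (gE G)) in H.
  (* In the factor [2 * l + 1], the 1 pays for [length V] and [2 * l] for the touching edges, each
     counted twice. *)
  assert (L1 : length V <= length (nbhd G V)).
  { apply NoDup_incl_length; auto. intros x Hx. apply in_nbhd. split; auto. exists x. auto. }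
  assert (L2 : length E' <= l * length (nbhd G V)); [|lia].
  apply BD. unfold E'. repeat split.
  - apply NoDup_filter, seq_NoDup.
  - now apply NoDup_filter.
  - intros x Hx. now apply in_nbhd in Hx.
  - apply incl_filter.
  - apply filter_In in H0 as [Hi Ho]. pose proof (WE _ _ Hi). simpl in Ho.
    apply in_nbhd. split; [lia|]. apply orb_true_iff in Ho as [Ho|Ho];
      apply existsb_exists in Ho as (y & Hy & ->%Nat.eqb_eq).
    + exists y; auto.
    + exists y. split; auto. right. now right.
  - apply filter_In in H0 as [Hi Ho]. pose proof (WE _ _ Hi). simpl in Ho.
    apply in_nbhd. split; [lia|]. apply orb_true_iff in Ho as [Ho|Ho];
      apply existsb_exists in Ho as (y & Hy & ->%Nat.eqb_eq).
    + exists y. split; auto. right. now left.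
    + exists y; auto.
Qed.

(** * Walks and spiders *)

(* [reach A w u v c]: some walk from [u] to [v] has weight [c], where the weight of [u] itself
   is not counted. *)
Inductive reach (A : nat -> nat -> Prop) (w : nat -> nat) : nat -> nat -> nat -> Prop :=
| reach_refl r : reach A w r r 0
| reach_step u v r a : A u v -> reach A w v r a -> reach A w u r (a + w v).

(** The aspect of a tree on which the token argument rests. The head has a neighbor further down the
    list and the last entry is the root, so removing heads one by one pushes tokens towards the
    root. *)
Inductive grown (A : nat -> nat -> Prop) : list nat -> Prop :=
| grown_nil : grown A []
| grown_cons v V :
    V = [] \/ (exists u, In u V /\ A u v) -> ~ In v V -> grown A V -> grown A (v :: V).

(* No spider with center [v], at least two feet in [R] and legs of weight at most [p] has
   weight at most [p] per foot. *)
Definition blocked (A : nat -> nat -> Prop) (w : nat -> nat) (R : nat -> Prop) (p v : nat) : Prop :=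
  forall S : list (nat * nat),
    NoDup (map fst S) ->
    (forall r a, In (r, a) S -> R r /\ reach A w v r a /\ a <= p) ->
    2 <= length S -> p * length S < w v + sumf snd S.

Definition foot (t : nat * nat * nat) : nat := fst (fst t).
Definition site (t : nat * nat * nat) : nat := snd (fst t).
Definition paid (t : nat * nat * nat) : nat := snd t.

Lemma NoDup_map_filter {S T : Type} (f : S -> T) (p : S -> bool) (l : list S) :
  NoDup (map f l) -> NoDup (map f (filter p l)).
Proof.
  induction l as [|a l IH]; simpl; auto. intros N. inversion_clear N as [|? ? Na Nl].
  destruct (p a); simpl; auto. constructor; auto.
  intros (x & E & Hx)%in_map_iff. apply Na. rewrite <- E. apply filter_In in Hx as [Hx _].
  now apply in_map.
Qed.

Lemma sumf_ge_const {T : Type} (f : T -> nat) (k : nat) (l : list T) :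
  (forall x, In x l -> k <= f x) -> k * length l <= sumf f l.
Proof. intros H. rewrite <- sumf_const. now apply sumf_le. Qed.

(* A token [(r, u, a)] stands for a terminal [r] that has been moved to the vertex [u] at
   price [a].  Tokens move along the tree towards its root.  A token that costs at least [p]
   has paid for itself; tokens which meet at a vertex form a spider. *)
Lemma tokens_pay (A : nat -> nat -> Prop) (w : nat -> nat) (R : nat -> Prop) (p : nat) (V : list nat) :
  grown A V -> (forall v, In v V -> blocked A w R p v) ->
  forall tk : list (nat * nat * nat),
    NoDup (map foot tk) ->
    (forall t, In t tk -> R (foot t) /\ In (site t) V /\ reach A w (site t) (foot t) (paid t)) ->
    p * length tk <= p + sumf w V + sumf paid tk.
Proof.
  intros G. induction G as [|v V Hc Hv GV IH]; intros HB tk N HT.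
  { destruct tk as [|t tk]; [simpl; lia|]. destruct (HT t (or_introl eq_refl)) as (_ & [] & _). }
  assert (HB' : forall u, In u V -> blocked A w R p u) by (intros; apply HB; now right).
  specialize (IH HB').
  set (at_v := fun t => site t =? v).
  set (big := fun t => p <=? paid t).
  set (tA := filter at_v tk). set (O := filter (fun t => negb (at_v t)) tk).
  set (tB := filter big tA). set (tS := filter (fun t => negb (big t)) tA).
  assert (Lw : sumf w (v :: V) = w v + sumf w V) by reflexivity.
  assert (L1 : length tk = length tA + length O) by (unfold tA, O; rewrite filter_length; auto).
  assert (L2 : length tA = length tB + length tS) by (unfold tB, tS; rewrite filter_length; auto).
  assert (S1 : sumf paid tk = sumf paid tA + sumf paid O) by apply sumf_filter.
  assert (S2 : sumf paid tA = sumf paid tB + sumf paid tS) by apply sumf_filter.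
  assert (PB : p * length tB <= sumf paid tB).
  { apply sumf_ge_const. intros t [_ Ht]%filter_In. now apply Nat.leb_le. }
  assert (HO : forall t, In t O -> In t tk /\ In (site t) V).
  { intros t [Ht Hn]%filter_In. split; auto. destruct (HT t Ht) as (_ & [E|E] & _); auto.
    unfold at_v in Hn. rewrite <- E, Nat.eqb_refl in Hn. discriminate. }
  assert (HS : forall t, In t tS -> In t tk /\ site t = v /\ paid t < p).
  { intros t [Ht Hn]%filter_In. apply filter_In in Ht as [Ht He%Nat.eqb_eq]. repeat split; auto.
    unfold big in Hn. apply negb_true_iff, Nat.leb_gt in Hn. lia. }
  assert (IO : p * length O <= p + sumf w V + sumf paid O).
  { apply IH; [now apply NoDup_map_filter|]. intros t Ht. destruct (HO t Ht) as [Hk Hs].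
    destruct (HT t Hk) as (? & _ & ?). auto. }
  (* Cases by the number of cheap tokens at [v]. With none, the induction hypothesis suffices. A
     single one moves on to the parent and takes the weight of [v] into its price. Two or more form
     a spider, and as [v] is blocked, its weight and their prices pay [p] for each of them. *)
  destruct tS as [|t [|t' tS']] eqn:ES.
  - simpl in L2, S2. change (sumf paid []) with 0 in S2. nia.
  - destruct (HS t (or_introl eq_refl)) as (Tk & Ts & Tp).
    destruct (HT t Tk) as (TR & _ & Tr). rewrite Ts in Tr.
    change (sumf paid [t]) with (paid t + 0) in S2. simpl in L2.
    (* At the root there is no parent; the single token stranded there is covered by the summand [p]
       of the bound, which is spent nowhere else. *)
    destruct Hc as [->|(u & Hu & Ha)].
    { assert (O = []) as EO.
      { destruct O as [|o O'] eqn:EO; auto. destruct (HO o (or_introl eq_refl)) as [_ []]. }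
      rewrite EO in *. change (sumf paid []) with 0 in *. simpl in L1. nia. }
    assert (IS : p * length ((foot t, u, paid t + w v) :: O) <=
      p + sumf w V + sumf paid ((foot t, u, paid t + w v) :: O)).
    { apply IH.
      - simpl. constructor; [|now apply NoDup_map_filter].
        intros (o & Eo & Ho)%in_map_iff. change (foot o = foot t) in Eo.
        assert (o = t) as ->.
        { destruct (HO o Ho) as [Ho' _]. clear - N Eo Ho' Tk.
          induction tk as [|a tk IH]; [destruct Tk|]. simpl in N.
          inversion_clear N as [|? ? Na Nt].
          destruct Ho' as [->|Ho'], Tk as [->|Tk]; auto; exfalso; apply Na.
          - rewrite Eo. now apply in_map.
          - rewrite <- Eo. now apply in_map. }
        destruct (HO t Ho) as [_ Hs]. rewrite Ts in Hs. contradiction.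
      - intros o [<-|Ho].
        + unfold foot, site, paid; simpl. split; [exact TR|]. split; auto.
          now apply reach_step.
        + destruct (HO o Ho) as [Hk Hs]. destruct (HT o Hk) as (? & _ & ?). auto. }
    change (sumf paid ((foot t, u, paid t + w v) :: O)) with (paid t + w v + sumf paid O) in IS.
    cbn [length] in IS. nia.
  - rewrite <- ES in *.
    assert (Bl : p * length (map (fun t => (foot t, paid t)) tS) <
      w v + sumf snd (map (fun t => (foot t, paid t)) tS)).
    { apply (HB v (or_introl eq_refl)).
      - rewrite map_map. change (NoDup (map foot tS)). unfold tS, tA.
        now do 2 apply NoDup_map_filter.
      - intros r a (o & [= <- <-] & Ho)%in_map_iff. destruct (HS o Ho) as (Hk & Hs & Hp).
        destruct (HT o Hk) as (HR & _ & Hr). rewrite Hs in Hr. repeat split; auto. lia.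
      - rewrite length_map, ES. simpl. lia. }
    rewrite length_map in Bl. unfold sumf in Bl at 1. rewrite map_map in Bl.
    change (list_sum (map (fun x => snd (foot x, paid x)) tS)) with (sumf paid tS) in Bl. nia.
Qed.

(** Every member of [X] starts as a token at its own vertex with price 0. *)
Lemma blocked_bound (A : nat -> nat -> Prop) (w : nat -> nat) (R : nat -> Prop) (p : nat)
    (V X : list nat) :
  grown A V -> (forall v, In v V -> blocked A w R p v) ->
  NoDup X -> incl X V -> (forall x, In x X -> R x) ->
  p * length X <= p + sumf w V.
Proof.
  intros GV HB NX IX HX.
  pose proof (tokens_pay A w R p V GV HB (map (fun x => (x, x, 0)) X)) as H.
  assert (Z : sumf paid (map (fun x => (x, x, 0)) X) = 0).
  { unfold sumf. rewrite map_map. apply (sumf_const 0). }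
  rewrite length_map, Z, Nat.add_0_r in H.
  apply H.
  - rewrite map_map. unfold foot; simpl. now rewrite map_id.
  - intros t (x & <- & Hx)%in_map_iff. unfold foot, site, paid; simpl.
    repeat split; auto. apply reach_refl.
Qed.

Lemma grown_NoDup (A : nat -> nat -> Prop) (V : list nat) : grown A V -> NoDup V.
Proof. induction 1; constructor; auto. Qed.

Lemma crt_crossing (e : nat -> nat -> Prop) (V : list nat) (x y : nat) :
  clos_refl_trans nat e x y -> In x V -> ~ In y V ->
  exists a b, In a V /\ ~ In b V /\ e a b.
Proof.
  intros H Hx. apply clos_rt_rtn1 in H. induction H as [|b c Hbc H IH]; intros Hy; [contradiction|].
  destruct (in_dec Nat.eq_dec b V) as [Hb|Hb]; [exists b, c; auto|auto].
Qed.

(** While a vertex of the tree is missing from the list, the connection to it leaves the list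
    through some tree edge, and the far end of that edge can be added. *)
Lemma tree_grown (G : graph) (V : list nat) (E : list (nat * nat)) :
  is_tree G V E -> exists V', grown (adj G) V' /\ Permutation V' V.
Proof.
  intros ((NV & _ & _ & IE & EV) & Hne & HC & _).
  assert (H : forall k, k <= length V ->
    exists V', grown (adj G) V' /\ incl V' V /\ length V' = k).
  { induction k as [|k IH]; intros Hk.
    - exists []. repeat split; [constructor|intros x []].
    - destruct IH as (V' & GV & IV & LV); [lia|].
      destruct (Exists_dec (fun y => ~ In y V') V) as [Ex|Nx].
      { intros y. destruct (in_dec Nat.eq_dec y V'); [right|left]; auto. }
      + apply Exists_exists in Ex as (y & Hy & Hn).
        destruct V' as [|x V'].
        * exists [y]. split; [|split; [intros z [<-|[]]; auto|simpl in *; lia]].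
          constructor; auto.
        * destruct (crt_crossing (edge_rel E) (x :: V') x y) as (a & b & Ha & Hb & Hab); auto.
          { apply HC; auto. apply IV. now left. } { now left. }
          exists (b :: x :: V'). split; [|split; [intros z [<-|Hz]; auto|simpl in *; lia]].
          -- constructor; auto. right. exists a. split; auto.
             destruct Hab as [Hab|Hab]; [left|right]; now apply IE.
          -- destruct Hab as [Hab|Hab]; now apply EV in Hab.
      + exfalso. assert (I : incl V V').
        { intros y Hy. destruct (in_dec Nat.eq_dec y V'); auto. exfalso. apply Nx.
          apply Exists_exists. eauto. }
        pose proof (NoDup_incl_length NV I). lia. }
  destruct (H (length V) (le_n _)) as (V' & GV & IV & LV).
  exists V'. split; auto. apply NoDup_Permutation_bis; auto; [|lia].
  eapply grown_NoDup; eauto.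
Qed.

(** * Harmonic sums *)

(** The [n]-th harmonic number scaled by [W], rounded down term by term to stay in [nat]. *)
Fixpoint hsum (W n : nat) : nat :=
  match n with
  | 0 => 0
  | S k => W / S k + hsum W k
  end.

(** The terms of index [2 * k] and [2 * k + 1] together are at most the term of index [k]; the
    leading [W] is the term of index 1. *)
Lemma hsum_double (W n : nat) : hsum W (2 * n + 1) <= W + hsum W n.
Proof.
  induction n as [|n IH].
  { change (2 * 0 + 1) with 1. cbn [hsum]. rewrite Nat.div_1_r. lia. }
  replace (2 * S n + 1) with (S (S (2 * n + 1))) by lia. cbn [hsum].
  assert (W / S (S (2 * n + 1)) <= W / S (2 * n + 1)) by (apply Nat.div_le_compat_l; lia).
  assert (2 * (W / S (2 * n + 1)) <= W / S n).
  { replace (S (2 * n + 1)) with (S n * 2) by lia.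
    rewrite <- Nat.Div0.div_div. apply Nat.Div0.mul_div_le. }
  lia.
Qed.

Lemma hsum_mono (W n m : nat) : n <= m -> hsum W n <= hsum W m.
Proof. induction 1; simpl; lia. Qed.

Lemma hsum_log (W n : nat) : hsum W n <= W * (Nat.log2 n + 1).
Proof.
  induction n as [n IH] using lt_wf_ind.
  destruct (Nat.le_gt_cases n 1) as [H|H].
  - destruct n as [|[|]]; cbn [hsum]; [lia|rewrite Nat.div_1_r; lia|lia].
  - assert (E : n <= 2 * (n / 2) + 1).
    { pose proof (Nat.div_mod_eq n 2). pose proof (Nat.mod_upper_bound n 2 ltac:(lia)). lia. }
    assert (L : n / 2 < n) by (apply Nat.div_lt; lia).
    assert (P : 0 < n / 2) by (apply Nat.div_str_pos; lia).
    assert (Nat.log2 (n / 2) + 1 <= Nat.log2 n).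
    { rewrite Nat.add_1_r, <- Nat.log2_double by auto. apply Nat.log2_le_mono.
      apply Nat.Div0.mul_div_le. }
    pose proof (hsum_mono W _ _ E). pose proof (hsum_double W (n / 2)).
    specialize (IH _ L). nia.
Qed.

(* The price [p] per foot is charged to the terminals that leave. *)
Lemma hsum_charge (W p n m : nat) :
  (p - 1) * n <= W -> m <= n -> p * (n - m) + hsum W m <= hsum W n + (n - m).
Proof.
  intros H. induction 1 as [|n Hm IH]; [lia|].
  replace (S n - m) with (S (n - m)) by lia. cbn [hsum].
  assert (p - 1 <= W / S n) by (apply Nat.div_le_lower_bound; nia).
  specialize (IH ltac:(nia)). nia.
Qed.

(** * Distance tables *)

(** A certificate for distances: [dt_edge] makes [D] a lower bound on the weight of every walk from
    [src], and [dt_pred] lets a walk of at most that weight be traced back. Values above [T] need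
    not be attained and stand for out of reach. *)
Record dist_table (n : nat) (A : nat -> nat -> Prop) (w : nat -> nat) (T src : nat)
    (D : nat -> nat) : Prop := {
  dt_src : D src = 0;
  dt_edge : forall x y, A x y -> D y <= D x + w y;
  dt_pred : forall y, y < n -> y <> src -> D y <= T -> exists x, A x y /\ D x + w y <= D y }.

Lemma dist_reach n A w T src D r c :
  dist_table n A w T src D -> reach A w src r c -> D r <= c.
Proof.
  intros H R. enough (forall u, reach A w u r c -> D r <= D u + c) as E.
  { specialize (E src R). rewrite (dt_src _ _ _ _ _ _ H) in E. lia. }
  clear R. intros u R. induction R as [|u v r a Huv R IH]; [lia|].
  pose proof (dt_edge _ _ _ _ _ _ H u v Huv). lia.
Qed.

(** A walk back to the source along predecessors; [D] falls at each step by at least the weight of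
    the vertex that is left, so weights telescope. *)
Inductive descent (A : nat -> nat -> Prop) (w D : nat -> nat) (src : nat) : nat -> list nat -> Prop :=
| descent_src : descent A w D src src [src]
| descent_step x y p :
    A y x -> D y + w x <= D x -> descent A w D src y p -> descent A w D src x (x :: p).

Lemma descent_head A w D src x p : descent A w D src x p -> exists q, p = x :: q.
Proof. destruct 1; eauto. Qed.

Lemma descent_weight A w D src x p :
  descent A w D src x p -> sumf w p <= D x + w src.
Proof.
  induction 1; [unfold sumf; simpl; lia|].
  change (sumf w (x :: p)) with (w x + sumf w p). lia.
Qed.

Lemma descent_le A w D src x p : descent A w D src x p -> forall y, In y p -> D y <= D x.
Proof.
  induction 1; intros z Hz.
  - destruct Hz as [->|[]]; auto.
  - destruct Hz as [->|Hz]; auto. specialize (IHdescent z Hz). lia.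
Qed.

(** With positive weights [D] strictly decreases, so no vertex recurs. *)
Lemma descent_NoDup A w D src x p :
  (forall v, 0 < w v) -> descent A w D src x p -> NoDup p.
Proof.
  intros W. induction 1; [repeat constructor; auto|].
  constructor; auto. intros Hx. pose proof (descent_le _ _ _ _ _ _ H1 x Hx).
  specialize (W x). lia.
Qed.

Lemma descent_last A w D src x p d : descent A w D src x p -> last p d = src.
Proof.
  induction 1; auto. destruct (descent_head _ _ _ _ _ _ H1) as [q ->].
  exact IHdescent.
Qed.

Lemma descent_path (G : graph) (w D : nat -> nat) (src x : nat) (p : list nat) :
  wf_graph G -> src < gn G -> (forall v, 0 < w v) ->
  descent (adj G) w D src x p -> is_st_path G x src p.
Proof.
  intros [_ WE] Hs W H. repeat split.
  - eapply descent_NoDup; eauto.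
  - induction H; intros z Hz.
    + destruct Hz as [->|[]]; auto.
    + destruct Hz as [->|Hz]; auto. destruct H as [H|H]; apply WE in H; lia.
  - destruct (descent_head _ _ _ _ _ _ H) as [q ->]. reflexivity.
  - eapply descent_last; eauto.
  - induction H; simpl; auto. destruct (descent_head _ _ _ _ _ _ H1) as [q ->].
    split; auto. destruct H; [right|left]; auto.
Qed.

(** The source of the table is the target [t], so that a descent from [s] already lists the path
    from [s] to [t] in the required order. The weight of [t], which the table omits, is added on the
    left. *)
Lemma dist_path (G : graph) (T t : nat) (D : nat -> nat) (q : list nat) (s : nat) :
  dist_table (gn G) (adj G) (wt G) T t D ->
  hd_error q = Some s -> last q s = t -> adj_chain G q -> D s + wt G t <= sumf (wt G) q.
Proof.
  intros H. revert s. induction q as [|x q IH]; intros s Hs Ht Hc; [discriminate|].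
  injection Hs as ->. destruct q as [|y q].
  - simpl in Ht. subst s. rewrite (dt_src _ _ _ _ _ _ H).
    change (sumf (wt G) [t]) with (wt G t + 0). lia.
  - destruct Hc as [Hsy Hc].
    assert (L : last (y :: q) y = t).
    { rewrite <- Ht. clear. revert y. induction q; intros y; simpl; auto.
      destruct q; auto. simpl in *. destruct q; auto. }
    specialize (IH y eq_refl L Hc).
    assert (Hys : adj G y s) by (destruct Hsy; [right|left]; auto).
    pose proof (dt_edge _ _ _ _ _ _ H y s Hys).
    change (sumf (wt G) (s :: y :: q)) with (wt G s + sumf (wt G) (y :: q)). lia.
Qed.

(** * Reading the graph *)

(* Scalars 4 to 7 are used by [fetch_head] and [spare_copies]. *)
Notation aEU := 1 (only parsing).
Notation aEV := 2 (only parsing).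
Notation aW := 3 (only parsing).
Notation aD := 4 (only parsing).
Notation aH := 6 (only parsing).

Notation vn := 8 (only parsing).
Notation vm := 9 (only parsing).
Notation vT := 10 (only parsing).
Notation vI := 11 (only parsing).
Notation v1 := 12 (only parsing).
Notation vp := 13 (only parsing).
Notation vu := 14 (only parsing).
Notation vv := 15 (only parsing).
Notation vt := 16 (only parsing).
Notation vt2 := 17 (only parsing).
Notation vh := 18 (only parsing).
Notation vi := 19 (only parsing).
Notation vk := 20 (only parsing).
Notation vval := 21 (only parsing).
Notation vsrc := 23 (only parsing).
Notation vx := 24 (only parsing).
Notation vnx := 25 (only parsing).
Notation vstep := 26 (only parsing).

Ltac ex := cbn [exec setv seta sv sa Nat.eqb andb orb].
Ltac ex_in H := cbn [exec setv seta sv sa Nat.eqb andb orb] in H.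

Definition read_sizes : cmd :=
  Set_ v1 1 ;; Set_ vp 1 ;; Get vn aIN vp ;; CInc vp ;; Get vm aIN vp ;; CInc vp ;; Set_ vT 1.

Definition load_edge : cmd :=
  Get vu aIN vp ;; CInc vp ;; Get vv aIN vp ;; CInc vp ;; Put aEU vh vu ;; Put aEV vh vv.

Definition incr_at (y : nat) : cmd := Get vt aW y ;; CInc vt ;; Put aW y vt.

Definition read_edge : cmd :=
  load_edge ;; incr_at vu ;; incr_at vv ;; CInc vT ;; CInc vT.

Definition read_edges : cmd :=
  For vi vn (Put aW vi v1 ;; CInc vT) ;;
  For vh vm read_edge ;;
  Mov vI vT ;; CInc vI.

(** The weights of all vertices sum to at most [gn G + 2 * length (gE G)], so no path or tree weighs
    as much as [tot G]. It serves as the number of rounds, and its successor as infinity. *)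
Definition tot (G : graph) : nat := 1 + gn G + 2 * length (gE G).

(* The loop that reads the edges counts downwards. *)
Definition ed (G : graph) (h : nat) : nat * nat := nth (length (gE G) - S h) (gE G) (0, 0).

Record ctx (G : graph) (s : state) : Prop := {
  ctx_0 : sv s 0 = 0;
  ctx_n : sv s vn = gn G;
  ctx_m : sv s vm = length (gE G);
  ctx_T : sv s vT = tot G;
  ctx_I : sv s vI = S (tot G);
  ctx_1 : sv s v1 = 1;
  ctx_W : forall v, v < gn G -> sa s aW v = wt G v;
  ctx_U : forall h, h < length (gE G) -> sa s aEU h = fst (ed G h);
  ctx_V : forall h, h < length (gE G) -> sa s aEV h = snd (ed G h) }.

Definition ctx_vars : list nat := [0; vn; vm; vT; vI; v1].
Definition ctx_arrs : list nat := [aEU; aEV; aW].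

Lemma ctx_ext (G : graph) (s s' : state) :
  ctx G s -> (forall x, In x ctx_vars -> sv s' x = sv s x) ->
  (forall a, In a ctx_arrs -> sa s' a = sa s a) -> ctx G s'.
Proof.
  intros [] Hv Ha. split; first [rewrite Hv by (simpl; tauto)|rewrite Ha by (simpl; tauto)]; auto.
Qed.

(** Boolean, so that for a concrete command the preservation of [ctx] is settled by evaluation. *)
Definition keeps (c : cmd) (xs rs : list nat) : bool :=
  forallb (fun x => negb (inb (wv c) x)) xs && forallb (fun a => negb (inb (wa c) a)) rs.

Lemma keeps_v (c : cmd) (xs rs : list nat) (s : state) (x : nat) :
  keeps c xs rs = true -> In x xs -> sv (exec c s) x = sv s x.
Proof.
  unfold keeps. rewrite andb_true_iff, !forallb_forall. intros [H _] Hx.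
  apply frame_v. now apply negb_true_iff, H.
Qed.

Lemma keeps_a (c : cmd) (xs rs : list nat) (s : state) (a : nat) :
  keeps c xs rs = true -> In a rs -> sa (exec c s) a = sa s a.
Proof.
  unfold keeps. rewrite andb_true_iff, !forallb_forall. intros [_ H] Ha.
  apply frame_a. now apply negb_true_iff, H.
Qed.

Lemma ctx_exec (G : graph) (c : cmd) (s : state) :
  keeps c ctx_vars ctx_arrs = true -> ctx G s -> ctx G (exec c s).
Proof.
  intros K C. apply (ctx_ext G s); auto; intros; [eapply keeps_v|eapply keeps_a]; eauto.
Qed.

Lemma ctx_setv (G : graph) (s : state) (x v : nat) :
  inb ctx_vars x = false -> ctx G s -> ctx G (setv s x v).
Proof.
  intros K C. apply (ctx_ext G s); auto. intros y Hy. simpl.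
  destruct (Nat.eqb_spec y x) as [->|]; auto. exfalso.
  assert (E : inb ctx_vars x = true); [|congruence].
  apply existsb_exists. exists x. split; auto. apply Nat.eqb_refl.
Qed.

Lemma nth_encode_edges (E : list (nat * nat)) (rest : list nat) (i : nat) :
  i < length E ->
  nth (2 * i) (encode_edges E ++ rest) 0 = fst (nth i E (0, 0)) /\
  nth (S (2 * i)) (encode_edges E ++ rest) 0 = snd (nth i E (0, 0)).
Proof.
  revert i. induction E as [|e E IH]; intros i Hi; [simpl in Hi; lia|].
  destruct i as [|i]; [auto|]. replace (2 * S i) with (S (S (2 * i))) by lia.
  simpl in Hi. destruct (IH i ltac:(lia)) as [E1 E2]. split; [exact E1|exact E2].
Qed.

Lemma length_encode_edges (E : list (nat * nat)) : length (encode_edges E) = 2 * length E.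
Proof. induction E; simpl in *; lia. Qed.

Definition graph_input (G : graph) (rest : list nat) : list nat :=
  gn G :: length (gE G) :: encode_edges (gE G) ++ rest.

Lemma firstn_S_nth {T : Type} (d : T) (l : list T) (i : nat) :
  i < length l -> firstn (S i) l = firstn i l ++ [nth i l d].
Proof.
  revert i. induction l as [|a l IH]; intros i Hi; [simpl in Hi; lia|].
  destruct i as [|i]; auto. simpl in Hi |- *. now rewrite <- IH by lia.
Qed.

Lemma exec_incr_at (y : nat) (s : state) (i : nat) : y <> vt ->
  sa (exec (incr_at y) s) aW i = Nat.b2n (i =? sv s y) + sa s aW i.
Proof.
  intros Hy. unfold incr_at. ex. replace (y =? vt) with false by (symmetry; now apply Nat.eqb_neq).
  destruct (Nat.eqb_spec i (sv s y)) as [->|]; reflexivity.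
Qed.

Lemma exec_read_edge (s : state) :
  let u := sa s aIN (sv s vp) in
  let v := sa s aIN (S (sv s vp)) in
  let s' := exec read_edge s in
  sv s' vp = S (S (sv s vp)) /\ sv s' vT = S (S (sv s vT)) /\
    sa s' aIN = sa s aIN /\
    (forall i, sa s' aW i = ends (u, v) i + sa s aW i) /\
    (forall h, sa s' aEU h = if h =? sv s vh then u else sa s aEU h) /\
    (forall h, sa s' aEV h = if h =? sv s vh then v else sa s aEV h).
Proof.
  cbv zeta. unfold read_edge. rewrite !exec_seq.
  set (s1 := exec load_edge s).
  assert (A : sv s1 vp = S (S (sv s vp)) /\ sv s1 vT = sv s vT /\
    sv s1 vu = sa s aIN (sv s vp) /\ sv s1 vv = sa s aIN (S (sv s vp)) /\
    sa s1 aIN = sa s aIN /\ sa s1 aW = sa s aW /\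
    (forall h, sa s1 aEU h = if h =? sv s vh then sa s aIN (sv s vp) else sa s aEU h) /\
    (forall h, sa s1 aEV h = if h =? sv s vh then sa s aIN (S (sv s vp)) else sa s aEV h)).
  { unfold s1, load_edge. ex. repeat split; auto. }
  clearbody s1. destruct A as (Ap & AT & Au & Av & AI & AW & AU & AV). ex.
  split; [|split; [|split; [|split; [|split]]]].
  - now rewrite !frame_v.
  - now rewrite !frame_v, AT.
  - now rewrite !frame_a.
  - intros i. rewrite !exec_incr_at, frame_v, Au, Av, AW by (reflexivity || discriminate).
    unfold ends. cbn [fst snd]. rewrite (Nat.eqb_sym i), (Nat.eqb_sym i). lia.
  - intros h. now rewrite !frame_a.
  - intros h. now rewrite !frame_a.
Qed.

Lemma exec_read (G : graph) (rest : list nat) (s : state) :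
  wf_graph G -> input (graph_input G rest) s ->
  let s' := exec read_edges (exec read_sizes s) in
  ctx G s' /\ sv s' vp = 3 + 2 * length (gE G) /\
  forall j, j < length rest -> sa s' aIN (3 + 2 * length (gE G) + j) = nth j rest 0.
Proof.
  intros [_ WE] [H0 HI]. set (n := gn G). set (m := length (gE G)).
  assert (HE : forall i, i < m ->
    sa s aIN (3 + 2 * i) = fst (nth i (gE G) (0, 0)) /\
    sa s aIN (4 + 2 * i) = snd (nth i (gE G) (0, 0))).
  { intros i Hi. pose proof (length_encode_edges (gE G)) as LE. fold m in LE.
    destruct (nth_encode_edges (gE G) rest i Hi) as [<- <-].
    change (3 + 2 * i) with (S (S (S (2 * i)))). change (4 + 2 * i) with (S (S (S (S (2 * i))))).
    split; rewrite HI; auto; unfold graph_input; cbn [length]; rewrite length_app; lia. }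
  assert (HR : forall j, j < length rest -> sa s aIN (3 + 2 * m + j) = nth j rest 0).
  { intros j Hj. pose proof (length_encode_edges (gE G)) as LE. fold m in LE.
    change (3 + 2 * m + j) with (S (S (S (2 * m + j)))). rewrite HI.
    - unfold graph_input. cbn [nth]. rewrite app_nth2 by lia. f_equal. lia.
    - unfold graph_input. cbn [length]. rewrite length_app. lia. }
  set (s1 := exec read_sizes s).
  assert (A : sv s1 0 = 0 /\ sv s1 vn = n /\ sv s1 vm = m /\ sv s1 v1 = 1 /\ sv s1 vp = 3 /\
    sv s1 vT = 1 /\ forall i, sa s1 aIN i = sa s aIN i).
  { unfold s1, read_sizes. ex. repeat split; auto.
    - apply (HI 0). unfold graph_input; simpl; lia.
    - apply (HI 1). unfold graph_input; simpl; lia. }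
  clearbody s1. destruct A as (A0 & An & Am & A1 & Ap & AT & AI).
  cbv zeta. unfold read_edges. rewrite exec_seq, exec_seq.
  set (s2 := exec (For vi vn _) s1).
  assert (B : sv s2 0 = 0 /\ sv s2 vn = n /\ sv s2 vm = m /\ sv s2 v1 = 1 /\ sv s2 vp = 3 /\
    sv s2 vT = 1 + n /\ (forall i, sa s2 aIN i = sa s aIN i) /\
    forall v, v < n -> sa s2 aW v = 1).
  { unfold s2.
    assert (I : sv s2 vT + 0 = 1 + n /\ forall v, 0 <= v < n -> sa s2 aW v = 1).
    { unfold s2. ex. rewrite An.
      apply (down_inv (fun k s => sv s v1 = 1 /\ sv s vT + k = 1 + n /\
        forall v, k <= v < n -> sa s aW v = 1)).
      - ex. split; [auto|]. split; [lia|]. intros; lia.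
      - intros k t Hk (I1 & IT & IW). ex. split; [auto|]. split; [lia|].
        intros v Hv. destruct (Nat.eqb_spec v k) as [->|N]; [exact I1|]. apply IW. lia. }
    rewrite !frame_v by reflexivity. rewrite frame_a by reflexivity.
    repeat split; auto; [fold s2; lia|]. intros v Hv. apply I. lia. }
  clearbody s2. destruct B as (B0 & Bn & Bm & B1 & Bp & BT & BI & BW).
  set (s3 := exec (For vh vm _) s2).
  assert (C : sv s3 0 = 0 /\ sv s3 vn = n /\ sv s3 vm = m /\ sv s3 v1 = 1 /\
    (forall i, sa s3 aIN i = sa s aIN i)).
  { unfold s3. rewrite !frame_v by reflexivity. rewrite frame_a by reflexivity. auto. }
  destruct C as (C0 & Cn & Cm & C1 & CI).
  assert (D : (forall i, sa s3 aIN i = sa s aIN i) /\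
    sv s3 vp + 2 * 0 = 3 + 2 * m /\ sv s3 vT + 2 * 0 = 1 + n + 2 * m /\
    (forall v, v < n -> sa s3 aW v = S (sumf (fun e => ends e v) (firstn (m - 0) (gE G)))) /\
    forall h, 0 <= h < m -> sa s3 aEU h = fst (ed G h) /\ sa s3 aEV h = snd (ed G h)).
  { clear C0 Cn Cm C1 CI. unfold s3. cbn [exec]. rewrite Bm.
    apply (down_inv (fun k s3 => (forall i, sa s3 aIN i = sa s aIN i) /\
      sv s3 vp + 2 * k = 3 + 2 * m /\ sv s3 vT + 2 * k = 1 + n + 2 * m /\
      (forall v, v < n -> sa s3 aW v = S (sumf (fun e => ends e v) (firstn (m - k) (gE G)))) /\
      forall h, k <= h < m -> sa s3 aEU h = fst (ed G h) /\ sa s3 aEV h = snd (ed G h))).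
    - ex. split; [auto|]. split; [lia|]. split; [lia|]. split; [|intros; lia].
      intros v Hv. rewrite Nat.sub_diag. now rewrite BW.
    - intros k t Hk (I0 & Ip & IT & IW & IE).
      pose proof (HE (m - S k) ltac:(lia)) as [E1 E2]. fold (ed G k) in E1, E2.
      change (nth (m - S k) (gE G) (0, 0)) with (ed G k) in E1, E2.
      replace (3 + 2 * (m - S k)) with (sv t vp) in E1 by lia.
      replace (4 + 2 * (m - S k)) with (S (sv t vp)) in E2 by lia.
      destruct (exec_read_edge (setv t vh k)) as (Fp & FT & FI & FW & FU & FV).
      ex_in Fp. ex_in FT. ex_in FI. ex_in FW. ex_in FU. ex_in FV.
      rewrite !I0, E1, E2 in *.
      split; [intros i; now rewrite FI|]. split; [lia|]. split; [lia|]. split.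
      + intros v Hv. replace (m - k) with (S (m - S k)) by lia.
        rewrite (firstn_S_nth (0, 0)) by (unfold m; lia).
        change (nth (m - S k) (gE G) (0, 0)) with (ed G k).
        rewrite sumf_app. unfold sumf at 2. cbn [map list_sum fold_right].
        rewrite FW, IW by auto. destruct (ed G k). cbn [fst snd]. unfold list_sum. simpl fold_right. lia.
      + intros h Hh. rewrite FU, FV. destruct (Nat.eqb_spec h k) as [->|N]; auto. apply IE. lia. }
  clearbody s3. destruct D as (_ & Dp & DT & DW & DE).
  rewrite exec_seq. ex. split; [|split].
  - split; ex; auto; try lia.
    + unfold tot; fold m n; lia.
    + unfold tot; fold m n; lia.
    + intros v Hv. rewrite DW by auto. unfold m. rewrite Nat.sub_0_r, firstn_all. reflexivity.
    + intros h Hh. apply DE. fold m in Hh. lia.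
    + intros h Hh. apply DE. fold m in Hh. lia.
  - fold m. lia.
  - intros j Hj. rewrite CI. now apply HR.
Qed.

(** * Shortest paths *)

(** The language cannot add two variables, so [D x + w y <= val] is tested as
    [0 < val + 1 - w y - D x]. *)
Definition relax (x y : nat) : cmd :=
  Get vt aD y ;;
  IfLt vval vt
    (Mov vt2 vval ;; CInc vt2 ;; Get vt aW y ;; Sub vt2 vt ;; Get vt aD x ;; Sub vt2 vt ;;
     IfLt 0 vt2 (Put aD y vval) Skip)
    Skip.

Definition edge (c1 c2 : cmd) : cmd :=
  For vh vm (Get vu aEU vh ;; Get vv aEV vh ;; c1 ;; c2).

(** No queue is maintained: round [val] scans all edges and settles the vertices at distance [val].
    This is polynomial because the number [tot G] of rounds is linear in the size of the graph. *)
Definition sssp : cmd :=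
  For vi vn (Put aD vi vI) ;; Put aD vsrc 0 ;; Set_ vval 0 ;;
  For vk vT (CInc vval ;; edge (relax vu vv) (relax vv vu)).

Definition relaxed (w : nat -> nat) (val x y : nat) (D : nat -> nat) (i : nat) : nat :=
  if (i =? y) && (val <? D y) && (w y + D x <=? val) then val else D i.

Lemma ltb_monus (v a b : nat) : (0 <? S v - a - b) = (a + b <=? v).
Proof. destruct (Nat.ltb_spec 0 (S v - a - b)), (Nat.leb_spec (a + b) v); auto; lia. Qed.

Lemma exec_relax (x y : nat) (s : state) :
  (x = vu /\ y = vv) \/ (x = vv /\ y = vu) -> sv s 0 = 0 ->
  forall i, sa (exec (relax x y) s) aD i =
    relaxed (sa s aW) (sv s vval) (sv s x) (sv s y) (sa s aD) i.
Proof.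
  intros H Z i. unfold relax, relaxed.
  destruct H as [[-> ->]|[-> ->]]; ex; rewrite Z, ltb_monus;
    destruct (sv s vval <? _); ex; rewrite ?andb_true_r, ?andb_false_r; auto;
    destruct (_ <=? _); ex; rewrite ?andb_true_r, ?andb_false_r; auto.
Qed.

(* The table after all distances up to [val] have been settled; [I] stands for infinity. *)
Record settled (n : nat) (A : nat -> nat -> Prop) (w : nat -> nat) (I src val : nat)
    (edges : nat -> nat -> Prop) (D : nat -> nat) : Prop := {
  st_src : D src = 0;
  st_dich : forall y, y < n -> D y <= val \/ D y = I;
  st_pred : forall y, y < n -> y <> src -> D y <= val -> exists x, A x y /\ D x + w y <= D y;
  st_old : forall x y, A x y -> D x + w y < val -> D y <= D x + w y;
  st_new : forall x y, edges x y -> A x y /\ (D x + w y <= val -> D y <= val) }.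

Lemma settled_relax n A w I src val edges D D' x y :
  (forall v, 0 < w v) -> val < I -> (forall u v, A u v -> u < n /\ v < n) ->
  settled n A w I src val edges D -> A x y ->
  (forall i, D' i = relaxed w val x y D i) ->
  settled n A w I src val (fun u v => edges u v \/ (u = x /\ v = y)) D'.
Proof.
  intros W VI AN S Axy HD.
  assert (HD' : forall i, D' i = D i \/ (i = y /\ D' i = val /\ val < D y /\ w y + D x <= val)).
  { intros i. rewrite HD. unfold relaxed.
    destruct (Nat.eqb_spec i y), (Nat.ltb_spec val (D y)), (Nat.leb_spec (w y + D x) val);
      simpl; auto. }
  assert (HY : w y + D x <= val -> val < D y -> D' y = val).
  { intros H1%Nat.leb_le H2%Nat.ltb_lt. rewrite HD. unfold relaxed.
    now rewrite Nat.eqb_refl, H1, H2. }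
  clear HD.
  (* A vertex set to [val] in the current round starts no edge with [D x + w y <= val], as weights
     are positive. Hence one sweep per round suffices, whatever the order of the edges. *)
  assert (L : forall i v, D' i + w v <= val -> D' i = D i).
  { intros i v Hi. destruct (HD' i) as [|(-> & E & _)]; auto. specialize (W v). lia. }
  assert (M : forall i, D i <= val -> D' i = D i).
  { intros i Hi. destruct (HD' i) as [|(-> & E & Q & _)]; auto. lia. }
  split.
  - rewrite M; rewrite (st_src _ _ _ _ _ _ _ _ S); lia.
  - intros v Hv. destruct (HD' v) as [->|(-> & -> & _)]; auto. now apply S.
  - intros v Hv Hs Hd. destruct (HD' v) as [E|(-> & E & Q1 & Q2)].
    + rewrite E in *. destruct (st_pred _ _ _ _ _ _ _ _ S v Hv Hs Hd) as (u & Hu & Hw).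
      exists u. split; auto. rewrite M; auto. lia.
    + exists x. split; auto. rewrite E, M; lia.
  - intros u v Huv Hl. pose proof (L u v ltac:(lia)) as E. rewrite E in *.
    pose proof (st_old _ _ _ _ _ _ _ _ S u v Huv Hl). rewrite M; auto; lia.
  - intros u v [Huv|[-> ->]].
    + destruct (st_new _ _ _ _ _ _ _ _ S u v Huv) as [H1 H2]. split; auto.
      intros Hl. pose proof (L u v Hl) as E. rewrite E in *. rewrite M; auto.
    + split; auto. intros Hl. pose proof (L x y Hl) as E. rewrite E in *.
      destruct (Nat.le_gt_cases (D y) val) as [Hy|Hy]; [rewrite M; auto|].
      rewrite HY; lia.
Qed.

Lemma exec_edge (G : graph) (c1 c2 : cmd) (P : nat -> state -> Prop) (s : state) :
  keeps (c1 ;; c2) ctx_vars ctx_arrs = true -> ctx G s ->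
  P (length (gE G)) (setv s vh (length (gE G))) ->
  (forall k t, k < length (gE G) -> ctx G t -> P (S k) t ->
     P k (exec c2 (exec c1
       (setv (setv (setv t vh k) vu (fst (ed G k))) vv (snd (ed G k)))))) ->
  P 0 (exec (edge c1 c2) s).
Proof.
  intros K C H0 HS. unfold edge. cbn [exec]. rewrite (ctx_m G s C).
  apply (down_inv (fun k t => ctx G t /\ P k t)).
  - split; auto. now apply ctx_setv.
  - intros k t Hk [Ct Pt].
    replace (sa (setv t vh k) aEU (sv (setv t vh k) vh)) with (fst (ed G k))
      by (symmetry; now apply (ctx_U G t)).
    set (t1 := setv (setv t vh k) vu (fst (ed G k))).
    replace (sa t1 aEV (sv t1 vh)) with (snd (ed G k)) by (symmetry; now apply (ctx_V G t)).
    split; [|now apply HS].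
    apply (ctx_exec G (c1 ;; c2)); auto. now repeat apply ctx_setv.
Qed.

Lemma adj_ed (G : graph) (x y : nat) :
  adj G x y <-> exists h, h < length (gE G) /\ (ed G h = (x, y) \/ ed G h = (y, x)).
Proof.
  assert (H : forall e, In e (gE G) <-> exists h, h < length (gE G) /\ ed G h = e).
  { intros e. split.
    - intros (i & Hi & E)%(In_nth _ _ (0, 0)). exists (length (gE G) - S i). split; [lia|].
      unfold ed. now replace (length (gE G) - S (length (gE G) - S i)) with i by lia.
    - intros (h & Hh & <-). apply nth_In. lia. }
  unfold adj. rewrite !H. split.
  - intros [(h & ? & ?)|(h & ? & ?)]; eauto.
  - intros (h & ? & [?|?]); eauto.
Qed.

Definition edges_from (G : graph) (k x y : nat) : Prop :=
  exists h, k <= h < length (gE G) /\ (ed G h = (x, y) \/ ed G h = (y, x)).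

Lemma edges_from_S (G : graph) (k x y : nat) :
  edges_from G k x y ->
  edges_from G (S k) x y \/ ed G k = (x, y) \/ ed G k = (y, x).
Proof.
  intros (h & Hh & E). destruct (Nat.eq_dec h k) as [->|N]; auto.
  left. exists h. split; auto. lia.
Qed.

(** One rule for the three programs that scan every edge in both directions: relaxation, the search
    for a predecessor and the growth of the tree. In [P e], the relation [e] holds for the directed
    edges already examined. *)
Lemma edge_sweep (G : graph) (c : nat -> nat -> cmd) (P : (nat -> nat -> Prop) -> state -> Prop)
    (s : state) :
  (forall a b, keeps (c a b) (vh :: vu :: vv :: ctx_vars) ctx_arrs = true) -> ctx G s ->
  (forall (e e' : nat -> nat -> Prop) t, (forall x y, e' x y -> e x y) -> P e t -> P e' t) ->
  (forall e t x v, In x [vh; vu; vv] -> P e t -> P e (setv t x v)) ->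
  P (fun _ _ => False) s ->
  (forall e t a b, (a = vu /\ b = vv) \/ (a = vv /\ b = vu) -> ctx G t ->
     sv t vh < length (gE G) ->
     ed G (sv t vh) = (sv t a, sv t b) \/ ed G (sv t vh) = (sv t b, sv t a) ->
     adj G (sv t a) (sv t b) -> P e t ->
     P (fun x y => e x y \/ (x = sv t a /\ y = sv t b)) (exec (c a b) t)) ->
  P (edges_from G 0) (exec (edge (c vu vv) (c vv vu)) s).
Proof.
  intros K C W V P0 ST.
  assert (Kc : forall a b t x, In x (vh :: vu :: vv :: ctx_vars) ->
    sv (exec (c a b) t) x = sv t x) by (intros; eapply keeps_v; eauto).
  assert (Ka : forall a b t, ctx G t -> ctx G (exec (c a b) t)).
  { intros a b t Ct. apply (ctx_ext G t); auto; intros.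
    - apply Kc. simpl in *; tauto.
    - eapply keeps_a; eauto. }
  assert (L : forall t k, k < length (gE G) -> sv t vh = k -> sv t vh < length (gE G)) by congruence.
  apply (exec_edge G (c vu vv) (c vv vu) (fun k t => P (edges_from G k) t)); auto.
  - pose proof (K vu vv) as K1. pose proof (K vv vu) as K2. unfold keeps in *.
    cbn [wv wa]. rewrite !andb_true_iff, !forallb_forall in *.
    split; intros x Hx; rewrite inb_app, negb_true_iff, orb_false_iff, <- !negb_true_iff;
      split; first [apply K1|apply K2]; simpl in *; tauto.
  - apply V; [simpl; auto|]. revert P0. apply W. intros x y (h & Hh & _). lia.
  - intros k t Hk Ct Pt. set (t1 := setv _ vv _).
    assert (C1 : ctx G t1) by (unfold t1; do 3 (apply ctx_setv; [reflexivity|]); auto).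
    assert (P1 : P (edges_from G (S k)) t1) by (unfold t1; do 3 (apply V; [simpl; auto|]); auto).
    assert (H1 : sv t1 vh = k) by reflexivity.
    assert (E1 : ed G k = (sv t1 vu, sv t1 vv)) by (unfold t1; ex; apply surjective_pairing).
    clearbody t1.
    assert (A1 : adj G (sv t1 vu) (sv t1 vv)) by (apply adj_ed; eauto).
    assert (P2 := ST _ t1 vu vv ltac:(auto) C1 (L _ k Hk H1) ltac:(rewrite H1; auto) A1 P1).
    assert (E2 : forall x, In x [vh; vu; vv] -> sv (exec (c vu vv) t1) x = sv t1 x).
    { intros x Hx. apply Kc. simpl in *; tauto. }
    specialize (Ka vu vv t1 C1). set (t2 := exec (c vu vv) t1) in *. clearbody t2.
    pose proof (E2 vh ltac:(simpl; auto)) as Eh. pose proof (E2 vu ltac:(simpl; auto)) as Eu.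
    pose proof (E2 vv ltac:(simpl; auto)) as Ev. rewrite <- Eu, <- Ev, <- Eh in *.
    assert (A2 : adj G (sv t2 vv) (sv t2 vu)) by (destruct A1; [right|left]; auto).
    assert (P3 := ST _ t2 vv vu ltac:(auto) Ka (L _ k Hk H1) ltac:(rewrite H1; auto) A2 P2).
    revert P3. apply W. intros x y Hxy.
    apply edges_from_S in Hxy as [Hxy|[Hxy|Hxy]]; auto; rewrite Hxy in E1; injection E1 as -> ->; auto.
Qed.

Lemma exec_fill (a i x y : nat) (s : state) (v : nat) :
  y <> i -> v < sv s x -> sa (exec (For i x (Put a i y)) s) a v = sv s y.
Proof.
  intros Hy Hv. rewrite exec_for. set (n := sv s x) in *.
  enough (H : sv (down n (fun k s => exec (Put a i y) (setv s i k)) (setv s i n)) y = sv s y /\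
    forall v, 0 <= v < n ->
      sa (down n (fun k s => exec (Put a i y) (setv s i k)) (setv s i n)) a v = sv s y).
  { apply H. lia. }
  apply Nat.eqb_neq in Hy.
  apply (down_inv (fun k t => sv t y = sv s y /\ forall v, k <= v < n -> sa t a v = sv s y)).
  - cbn. rewrite Hy. split; auto. intros; lia.
  - intros k t Hk [T1 T2]. cbn. rewrite Hy, !Nat.eqb_refl. split; auto.
    intros u Hu. destruct (Nat.eqb_spec u k); cbn; auto. apply T2. lia.
Qed.

Lemma settled_weaken n A w I src val (e e' : nat -> nat -> Prop) D :
  (forall x y, e' x y -> e x y) -> settled n A w I src val e D -> settled n A w I src val e' D.
Proof. intros H []. split; auto. Qed.

Lemma adj_lt (G : graph) (x y : nat) : wf_graph G -> adj G x y -> x < gn G /\ y < gn G.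
Proof. intros [_ WE] [H|H]; apply WE in H; lia. Qed.

Lemma exec_relax_edges G (s : state) (src val : nat) :
  wf_graph G -> ctx G s -> val <= tot G -> sv s vval = val ->
  settled (gn G) (adj G) (wt G) (S (tot G)) src val (fun _ _ => False) (sa s aD) ->
  settled (gn G) (adj G) (wt G) (S (tot G)) src val (edges_from G 0)
    (sa (exec (edge (relax vu vv) (relax vv vu)) s) aD).
Proof.
  intros WG C HT HV HS.
  apply (edge_sweep G relax (fun e t => sv t vval = val /\
    settled (gn G) (adj G) (wt G) (S (tot G)) src val e (sa t aD))); auto.
  - intros e e' t He [H1 H2]. split; auto. eapply settled_weaken; eauto.
  - intros e t x v [<-|[<-|[<-|[]]]] H; exact H.
  - intros e t a b Hab Ct _ _ A [<- St]. split; [now rewrite frame_v|].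
    apply (settled_relax _ _ _ _ _ _ _ (sa t aD)); auto.
    + intros; unfold wt; lia.
    + lia.
    + intros u v. now apply adj_lt.
    + intros i. rewrite exec_relax by (auto; apply Ct). unfold relaxed.
      rewrite (ctx_W G t Ct); auto. now apply adj_lt in A.
Qed.

Lemma exec_sssp G (s : state) :
  wf_graph G -> ctx G s -> sv s vsrc < gn G ->
  dist_table (gn G) (adj G) (wt G) (tot G) (sv s vsrc) (sa (exec sssp s) aD) /\
  forall y, y < gn G -> sa (exec sssp s) aD y <= S (tot G).
Proof.
  intros WG C Hs. set (src := sv s vsrc) in *. set (n := gn G). set (T := tot G).
  unfold sssp. rewrite !exec_seq.
  set (s1 := exec (For vi vn _) s).
  assert (C1 : ctx G s1) by now apply ctx_exec.
  assert (D1 : forall y, y < n -> sa s1 aD y = S T).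
  { intros y Hy. unfold s1. rewrite exec_fill; [apply C|discriminate|]. now rewrite (ctx_n G s C). }
  set (s2 := exec (Set_ vval 0) _).
  assert (E2 : forall y, sa s2 aD y = if y =? src then 0 else sa s1 aD y).
  { intros y. unfold s2. ex. rewrite (ctx_0 G s1 C1).
    replace (sv s1 vsrc) with src; [reflexivity|]. symmetry. now apply frame_v. }
  assert (V2 : sv s2 vval = 0) by reflexivity.
  assert (C2 : ctx G s2) by (unfold s2; do 2 (apply ctx_exec; [reflexivity|]); auto).
  clearbody s2. clearbody s1.
  assert (S2 : settled n (adj G) (wt G) (S T) src 0 (edges_from G 0) (sa s2 aD)).
  { split.
    - now rewrite E2, Nat.eqb_refl.
    - intros y Hy. rewrite E2. destruct (y =? src); auto.
    - intros y Hy N H. rewrite E2, D1 in H by auto. destruct (Nat.eqb_spec y src); lia.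
    - intros. lia.
    - intros x y (h & Hh & E). split; [apply adj_ed; exists h; split; auto; lia|].
      unfold wt. lia. }
  cbn [exec]. rewrite (ctx_T G s2 C2). fold T.
  set (s' := down T _ _).
  assert (F : ctx G s' /\ sv s' vval + 0 = T /\
    settled n (adj G) (wt G) (S T) src (sv s' vval) (edges_from G 0) (sa s' aD)).
  { unfold s'. apply (down_inv (fun k t => ctx G t /\ sv t vval + k = T /\
      settled n (adj G) (wt G) (S T) src (sv t vval) (edges_from G 0) (sa t aD))).
    - split; [now apply ctx_setv|]. split; [ex; lia|]. ex. now rewrite V2.
    - clear s1 s2 s' C1 D1 E2 V2 C2 S2 C Hs. intros k t Hk (Ct & Hv & St).
      set (t1 := setv _ vval _).
      assert (C1 : ctx G t1) by (unfold t1; do 2 (apply ctx_setv; [reflexivity|]); exact Ct).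
      assert (V1 : sv t1 vval = S (sv t vval)) by reflexivity.
      assert (D1 : sa t1 aD = sa t aD) by reflexivity.
      clearbody t1.
      split; [now apply ctx_exec|].
      rewrite frame_v by reflexivity. rewrite V1. split; [lia|].
      apply exec_relax_edges; auto; [unfold T in *; lia|]. rewrite D1.
      destruct St as [S1 S2 S3 S4 S5]. fold n T. split; auto.
      + intros y Hy. destruct (S2 y Hy); auto.
      + intros y Hy N Hd. destruct (S2 y Hy) as [Q|Q]; [now apply S3|]. lia.
      (* For the next value, edges whose sum equals the previous value are handled by [st_new] of
         the finished sweep, those with a smaller sum by [st_old]. *)
      + intros x y Hxy Hl. destruct (S5 x y) as [_ H5].
        { apply adj_ed in Hxy as (h & Hh & E). exists h. split; [lia|auto]. }
        destruct (Nat.lt_ge_cases (sa t aD x + wt G y) (sv t vval)); [now apply S4|].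
        specialize (H5 ltac:(lia)). lia.
      + tauto. }
  destruct F as (_ & Hv & SF). rewrite Nat.add_0_r in Hv. rewrite Hv in SF.
  destruct SF as [S1 S2' S3 S4 S5]. split; [split; auto|].
  - intros x y Hxy. destruct (Nat.lt_ge_cases (sa s' aD x + wt G y) T); [now apply S4|].
    destruct (adj_lt G x y WG Hxy) as [_ Hy].
    destruct (Nat.eq_dec (sa s' aD x + wt G y) T) as [Q|Q].
    + destruct (S5 x y) as [_ H5]; [|lia].
      apply adj_ed in Hxy as (h & Hh & E). exists h. split; [lia|auto].
    (* A sum above [T] bounds every entry, since infinity is only [T + 1]. *)
    + destruct (S2' y Hy); lia.
  - intros y Hy. destruct (S2' y Hy); lia.
Qed.

(** * Tracing a shortest path back to its source *)

Definition IfEq (x y : nat) (c1 c2 : cmd) : cmd := IfLt x y c2 (IfLt y x c2 c1).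

Lemma exec_IfEq (x y : nat) (c1 c2 : cmd) (s : state) :
  exec (IfEq x y c1 c2) s = if sv s x =? sv s y then exec c1 s else exec c2 s.
Proof.
  unfold IfEq. cbn [exec].
  destruct (Nat.ltb_spec (sv s x) (sv s y)), (Nat.ltb_spec (sv s y) (sv s x)),
    (Nat.eqb_spec (sv s x) (sv s y)); auto; lia.
Qed.

Definition candidate (u x : nat) : cmd :=
  IfEq x vx
    (Get vt aD x ;; CInc vt ;; Get vt2 aD u ;; Sub vt vt2 ;; Get vt2 aW x ;; Sub vt vt2 ;;
     IfLt 0 vt (Mov vnx u) Skip)
    Skip.

(** Writes both to the output list and to the marks [aH], so that [walk] serves the path problem as
    well as the purchase of spider legs; in the latter case [emit] resets the output later. *)
Definition record : cmd := Put aOUT vLEN vx ;; CInc vLEN ;; Put aH vx v1.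

(** The predecessor is found by another scan of the edges, so no table of predecessors accompanies
    the distances. *)
Definition go_back : cmd :=
  Mov vnx vx ;; edge (candidate vu vv) (candidate vv vu) ;; Mov vx vnx.

Definition walk : cmd :=
  For vstep vT (IfEq vx vsrc Skip (record ;; go_back)) ;; record.

Lemma exec_candidate (u x : nat) (s : state) :
  (u = vu /\ x = vv) \/ (u = vv /\ x = vu) -> sv s 0 = 0 ->
  sv (exec (candidate u x) s) vnx =
    if (sv s x =? sv s vx) && (sa s aD (sv s u) + sa s aW (sv s x) <=? sa s aD (sv s x))
    then sv s u else sv s vnx.
Proof.
  intros H Z. unfold candidate. rewrite exec_IfEq.
  destruct H as [[-> ->]|[-> ->]]; destruct (_ =? _); auto; ex; rewrite Z, ltb_monus;
    destruct (_ <=? _); reflexivity.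
Qed.

Lemma exec_go_back (G : graph) (s : state) :
  wf_graph G -> ctx G s ->
  (exists y, adj G y (sv s vx) /\
     sa s aD y + wt G (sv s vx) <= sa s aD (sv s vx)) ->
  let y := sv (exec go_back s) vx in
  adj G y (sv s vx) /\ sa s aD y + wt G (sv s vx) <= sa s aD (sv s vx).
Proof.
  intros WG C (y & Ay & Dy). cbv zeta. unfold go_back. rewrite !exec_seq.
  set (s1 := exec (Mov vnx vx) s). cbn [exec]. cbn [setv sv Nat.eqb].
  assert (C1 : ctx G s1) by now apply ctx_exec.
  assert (Vx : sv s1 vx = sv s vx) by reflexivity.
  assert (D1 : sa s1 aD = sa s aD) by reflexivity.
  rewrite <- Vx, <- D1 in *. clearbody s1. clear s C Vx D1.
  set (x := sv s1 vx) in *. set (D := sa s1 aD) in *.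
  set (good := fun u => adj G u x /\ D u + wt G x <= D x).
  (* Either a valid predecessor is held in [vnx], or none has been among the examined edges; after a
     full sweep the latter contradicts the existence of [y]. *)
  pose (P := fun (e : nat -> nat -> Prop) t => sv t vx = x /\ sa t aD = D /\
    (good (sv t vnx) \/ forall u, good u -> ~ e u x)).
  assert (F : P (edges_from G 0) (exec (edge (candidate vu vv) (candidate vv vu)) s1)).
  { apply (edge_sweep G candidate P); [reflexivity|exact C1|..]; unfold P.
    - intros e e' t He (H1 & H2 & [H3|H3]); repeat split; auto. right. intros u Hu Hu'.
      apply (H3 u); auto.
    - intros e t z v [<-|[<-|[<-|[]]]] H; exact H.
    - split; [auto|]. split; auto.
    - intros e t a b Hab Ct _ _ A (Tx & TD & TG).
      rewrite frame_v, frame_a by reflexivity. split; [auto|]. split; [auto|].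
      rewrite exec_candidate by (auto; apply Ct). destruct (adj_lt G _ _ WG A) as [_ Lb].
      rewrite Tx, TD, (ctx_W G t Ct) by auto.
      destruct (Nat.eqb_spec (sv t b) x) as [Q|Q]; cbn [andb].
      + rewrite Q in *. destruct (Nat.leb_spec (D (sv t a) + wt G x) (D x)) as [L|L].
        * left. split; auto.
        * destruct TG as [TG|TG]; auto. right. intros u Hu [Hu'|[-> _]]; [now apply (TG u)|].
          destruct Hu as [_ Hu]. lia.
      + destruct TG as [TG|TG]; auto. right. intros u Hu [Hu'|[_ Hu']]; [now apply (TG u)|].
        congruence. }
  destruct F as (_ & _ & [F|F]); [exact F|].
  exfalso. apply (F y); [split; auto|].
  apply adj_ed in Ay as (h & Hh & E). exists h. split; [lia|auto].
Qed.

Lemma exec_record (s : state) :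
  let s' := exec record s in
  sv s' vLEN = S (sv s vLEN) /\
  (forall i, sa s' aOUT i = if i =? sv s vLEN then sv s vx else sa s aOUT i) /\
  (forall v, sa s' aH v = if v =? sv s vx then sv s v1 else sa s aH v).
Proof. cbv zeta. unfold record. ex. auto. Qed.

Definition recorded (s s' : state) (q : list nat) : Prop :=
  sv s' vLEN = sv s vLEN + length q /\
  (forall i, i < sv s vLEN -> sa s' aOUT i = sa s aOUT i) /\
  (forall i, i < length q -> sa s' aOUT (sv s vLEN + i) = nth i q 0) /\
  (forall v, sa s' aH v = if inb q v then 1 else sa s aH v).

Lemma recorded_step (s t : state) (q : list nat) :
  recorded s t q -> sv t v1 = 1 -> recorded s (exec record t) (q ++ [sv t vx]).
Proof.
  intros (HL & HO & HQ & HH) H1. destruct (exec_record t) as (RL & RO & RH).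
  unfold recorded. rewrite RL, length_app. cbn [length].
  split; [lia|]. split; [|split].
  - intros i Hi. rewrite RO. destruct (Nat.eqb_spec i (sv t vLEN)); [lia|auto].
  - intros i Hi. rewrite RO. destruct (Nat.eqb_spec (sv s vLEN + i) (sv t vLEN)) as [E|N].
    + rewrite app_nth2 by lia. now replace (i - length q) with 0 by lia.
    + rewrite app_nth1 by lia. apply HQ. lia.
  - intros v. rewrite RH, inb_app, H1, HH. cbn [inb existsb]. rewrite orb_false_r.
    destruct (v =? sv t vx), (inb q v); reflexivity.
Qed.

Lemma exec_walk (G : graph) (s : state) :
  wf_graph G -> ctx G s ->
  dist_table (gn G) (adj G) (wt G) (tot G) (sv s vsrc) (sa s aD) ->
  sv s vx < gn G -> sa s aD (sv s vx) <= tot G ->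
  exists p, descent (adj G) (wt G) (sa s aD) (sv s vsrc) (sv s vx) p /\
    recorded s (exec walk s) p.
Proof.
  intros WG C DT Hx HD. set (src := sv s vsrc) in *. set (D := sa s aD) in *.
  set (T := tot G) in *. unfold walk. rewrite exec_seq.
  set (s' := exec (For vstep vT _) s).
  assert (F : ctx G s' /\ sv s' vsrc = src /\ sa s' aD = D /\ exists q,
    recorded s s' q /\
    (forall p, descent (adj G) (wt G) D src (sv s' vx) p ->
       descent (adj G) (wt G) D src (sv s vx) (q ++ p)) /\
    sv s' vx < gn G /\ D (sv s' vx) <= T /\
    (sv s' vx = src \/ D (sv s' vx) <= 0)).
  { unfold s'. cbn [exec]. rewrite (ctx_T G s C). fold T.
    (* Each step back lowers [D] by at least 1, so with [k] rounds left either the source has been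
       reached or [D] is at most [k]. *)
    apply (down_inv (fun k s' => ctx G s' /\ sv s' vsrc = src /\ sa s' aD = D /\ exists q,
      recorded s s' q /\
      (forall p, descent (adj G) (wt G) D src (sv s' vx) p ->
         descent (adj G) (wt G) D src (sv s vx) (q ++ p)) /\
      sv s' vx < gn G /\ D (sv s' vx) <= T /\
      (sv s' vx = src \/ D (sv s' vx) <= k))).
    - split; [now apply ctx_setv|]. split; [reflexivity|]. split; [reflexivity|].
      exists []. ex. repeat split; auto. intros i Hi. cbn in Hi. lia.
    - clear s'. intros k t0 Hk (Ct & Ts & TD & q & Rq & Pq & Tx & TL & TK).
      set (t := setv t0 vstep k).
      assert (Ct' : ctx G t) by now apply ctx_setv.
      assert (Ts' : sv t vsrc = src) by exact Ts.
      assert (TD' : sa t aD = D) by exact TD.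
      assert (Rq' : recorded s t q) by exact Rq.
      assert (Tx' : sv t vx = sv t0 vx) by reflexivity.
      rewrite <- Tx' in *. clearbody t. clear t0 Ct Ts TD Rq Tx'.
      rewrite exec_IfEq, Ts'. destruct (Nat.eqb_spec (sv t vx) src) as [E|E].
      + cbn [exec]. split; [auto|]. split; [auto|]. split; [auto|]. exists q. auto 7.
      + destruct TK as [TK|TK]; [contradiction|].
        rewrite exec_seq. set (t1 := exec record t).
        assert (C1 : ctx G t1) by now apply ctx_exec.
        assert (X1 : sv t1 vx = sv t vx) by reflexivity.
        assert (D1 : sa t1 aD = D) by exact TD'.
        assert (R1 : recorded s t1 (q ++ [sv t vx])) by (apply recorded_step; auto; apply Ct').
        assert (S1 : sv t1 vsrc = src) by exact Ts'.
        clearbody t1.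
        destruct (dt_pred _ _ _ _ _ _ DT (sv t vx) Tx E TL) as (y0 & Ay0 & Dy0).
        destruct (exec_go_back G t1 WG C1) as [Ay Dy].
        { exists y0. rewrite X1, D1. auto. }
        rewrite X1, D1 in *. clear y0 Ay0 Dy0.
        set (y := sv (exec go_back t1) vx) in *.
        destruct (adj_lt G _ _ WG Ay) as [Ly _].
        assert (W : 0 < wt G (sv t vx)) by (unfold wt; lia).
        split; [now apply ctx_exec|].
        rewrite frame_v, frame_a by reflexivity. split; [auto|]. split; [auto|].
        exists (q ++ [sv t vx]). split; [|split; [|split; [|split]]].
        * unfold recorded. rewrite !frame_v, !frame_a by reflexivity. exact R1.
        * intros p Hp. rewrite <- app_assoc. apply Pq. now apply (descent_step _ _ _ _ _ y).
        * exact Ly.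
        * lia.
        * right. lia. }
  destruct F as (C' & S' & D' & q & Rq & Pq & Tx & TL & TK).
  clearbody s'.
  assert (E : sv s' vx = src).
  { destruct TK as [|TK]; auto. destruct (Nat.eq_dec (sv s' vx) src) as [|N]; auto.
    destruct (dt_pred _ _ _ _ _ _ DT _ Tx N TL) as (y & _ & Hy).
    assert (W : 0 < wt G (sv s' vx)) by (unfold wt; lia). lia. }
  exists (q ++ [src]). split.
  - apply Pq. rewrite E. apply descent_src.
  - rewrite <- E. apply recorded_step; auto. apply C'.
Qed.

(** * The secluded path *)

Definition path_main : cmd :=
  Get vx aIN vp ;; CInc vp ;; Get vsrc aIN vp ;; sssp ;; Set_ vLEN 0 ;; walk.

Definition path_cmd : cmd := read_sizes ;; read_edges ;; path_main.

Lemma list_max_graph_input (G : graph) (rest : list nat) :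
  wf_graph G ->
  list_max (graph_input G rest) <= gn G + length (gE G) + list_max rest.
Proof.
  intros [_ WE]. apply list_max_le. apply Forall_forall. intros x Hx.
  destruct Hx as [<-|[<-|Hx]]; [lia|lia|].
  apply in_app_iff in Hx as [Hx|Hx].
  - apply in_flat_map in Hx as ([u v] & Hi & Hx). pose proof (WE _ _ Hi).
    destruct Hx as [<-|[<-|[]]]; simpl; lia.
  - pose proof (proj1 (list_max_le rest (list_max rest)) (le_n _)) as F.
    rewrite Forall_forall in F. specialize (F x Hx). lia.
Qed.

Lemma sumf_wt_seq (G : graph) : sumf (wt G) (seq 0 (gn G)) < tot G.
Proof.
  pose proof (sumf_wt G (seq 0 (gn G)) (seq_NoDup _ _)) as H.
  rewrite length_seq in H.
  pose proof (filter_length_le (fun e => existsb (Nat.eqb (fst e)) (seq 0 (gn G)) ||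
    existsb (Nat.eqb (snd e)) (seq 0 (gn G))) (gE G)). unfold tot. lia.
Qed.

Lemma sumf_wt_lt (G : graph) (V : list nat) :
  NoDup V -> (forall x, In x V -> x < gn G) -> sumf (wt G) V < tot G.
Proof.
  intros N H. eapply Nat.le_lt_trans; [|apply sumf_wt_seq].
  apply sumf_incl; auto. intros x Hx. apply in_seq. specialize (H x Hx). lia.
Qed.

Lemma exec_path_cmd (G : graph) (s0 : state) (s t : nat) (q : list nat) :
  wf_graph G -> s < gn G -> t < gn G -> is_st_path G s t q ->
  input (graph_input G [s; t]) s0 ->
  exists D p, dist_table (gn G) (adj G) (wt G) (tot G) t D /\
    descent (adj G) (wt G) D t s p /\ output (exec path_cmd s0) = p.
Proof.
  intros WG Hs Ht (NQ & LQ & HQ & TQ & CQ) HI. unfold path_cmd. rewrite !exec_seq.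
  destruct (exec_read G [s; t] s0 WG HI) as (C & Ep & EI).
  set (s1 := exec read_edges _) in *. clearbody s1.
  unfold path_main. rewrite !exec_seq.
  set (s2 := exec (Get vsrc aIN vp) _).
  assert (C2 : ctx G s2) by (unfold s2; do 3 (apply ctx_exec; [reflexivity|]); auto).
  assert (X2 : sv s2 vx = s).
  { unfold s2. ex. rewrite Ep. etransitivity; [|apply (EI 0); simpl; lia]. f_equal. lia. }
  assert (S2 : sv s2 vsrc = t).
  { unfold s2. ex. rewrite Ep. etransitivity; [|apply (EI 1); simpl; lia]. f_equal. lia. }
  clearbody s2.
  destruct (exec_sssp G s2 WG C2) as [DT DL]; [now rewrite S2|].
  set (s3 := exec (Set_ vLEN 0) _).
  assert (C3 : ctx G s3) by (unfold s3; do 2 (apply ctx_exec; [reflexivity|]); auto).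
  assert (X3 : sv s3 vx = s) by (unfold s3; rewrite !frame_v; auto).
  assert (S3 : sv s3 vsrc = t) by (unfold s3; rewrite !frame_v; auto).
  assert (L3 : sv s3 vLEN = 0) by reflexivity.
  assert (D3 : sa s3 aD = sa (exec sssp s2) aD) by (unfold s3; now rewrite frame_a).
  clearbody s3. rewrite S2, <- D3 in DT.
  destruct (exec_walk G s3 WG C3) as (p & Hp & RL & _ & RO & _).
  { now rewrite S3. } { now rewrite X3. }
  (* The weight of the given path [q] is below [tot G], hence so is the distance of [s], which makes
     the walk back possible. *)
  { rewrite X3. pose proof (dist_path G _ _ _ _ _ DT HQ TQ CQ).
    pose proof (sumf_wt_lt G q NQ LQ). lia. }
  rewrite S3, X3 in Hp. exists (sa s3 aD), p. split; [auto|]. split; [auto|].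
  unfold output. rewrite RL, L3. cbn [Nat.add].
  apply (nth_ext _ _ 0 0); [now rewrite length_map, length_seq|].
  intros i Hi. rewrite length_map, length_seq in Hi.
  rewrite (nth_indep _ 0 (sa (exec walk s3) aOUT 0)) by now rewrite length_map, length_seq.
  rewrite map_nth, seq_nth by auto. rewrite <- RO by auto. now rewrite L3.
Qed.

Lemma polytime_path : polytime path_cmd.
Proof. repeat apply polytime_seq; now apply polytime_loops. Qed.

(** * Buying spiders *)

Notation aR := 7 (only parsing).
Notation vlam := 27 (only parsing).
Notation vll := 28 (only parsing).
Notation vcnt := 29 (only parsing).
Notation vg := 30 (only parsing).
Notation vkeep := 31 (only parsing).
Notation vr := 32 (only parsing).
Notation va := 36 (only parsing).

Definition for_feet (c : cmd) : cmd :=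
  For vr vn (Get va aR vr ;;
    IfLt 0 va (Get vt aD vr ;; IfLt vlam vt Skip c) Skip).

(** A spider with feet [F] costs at most [lam] per foot iff the slacks [lam - D r] sum to at least
    the weight of the center. No slack is negative, so taking all active terminals within [lam] is
    the best choice and no subset has to be searched. Truncated subtraction turns both conditions
    into tests for 0. *)
Definition measure : cmd :=
  Set_ vcnt 2 ;; Get vg aW vsrc ;;
  for_feet (Sub vcnt v1 ;; Mov vt2 vlam ;; Sub vt2 vt ;; Sub vg vt2).

(** [vkeep] is a flag: the first foot met stays active, every later one is retired. *)
Definition buy_leg : cmd :=
  IfLt 0 vkeep (Put aR vr 0) (Set_ vkeep 1) ;; Mov vx vr ;; walk.

Definition buy : cmd := Set_ vkeep 0 ;; for_feet buy_leg.

Definition scan : cmd :=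
  sssp ;; measure ;; IfLt 0 vcnt Skip (IfLt 0 vg Skip buy).

Definition spiders : cmd :=
  Set_ vlam 0 ;; For vll vT (CInc vlam ;; For vsrc vn scan).

Definition is_foot (R D : nat -> nat) (lam r : nat) : bool := (0 <? R r) && (D r <=? lam).

Definition feet (R D : nat -> nat) (lam k n : nat) : list nat :=
  filter (is_foot R D lam) (seq k (n - k)).

Lemma feet_S R D lam k n : k < n ->
  feet R D lam k n = if is_foot R D lam k then k :: feet R D lam (S k) n else feet R D lam (S k) n.
Proof.
  intros H. unfold feet. replace (n - k) with (S (n - S k)) by lia. reflexivity.
Qed.

Lemma in_feet R D lam k n r :
  In r (feet R D lam k n) <-> k <= r < n /\ 0 < R r /\ D r <= lam.
Proof.
  unfold feet, is_foot. rewrite filter_In, in_seq, andb_true_iff, Nat.ltb_lt, Nat.leb_le.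
  intuition lia.
Qed.

Lemma feet_nil R D lam n : feet R D lam n n = [].
Proof. unfold feet. now rewrite Nat.sub_diag. Qed.

Lemma NoDup_feet R D lam k n : NoDup (feet R D lam k n).
Proof. apply NoDup_filter, seq_NoDup. Qed.

(** The command may retire terminals while the loop runs; the last hypothesis only asks that the
    entry of [aR] about to be tested is still the original one. *)
Lemma exec_for_feet (G : graph) (c : cmd) (R D : nat -> nat) (lam : nat)
    (P : nat -> state -> Prop) (s : state) :
  keeps c (vlam :: ctx_vars) (aD :: ctx_arrs) = true ->
  ctx G s -> sa s aD = D -> sv s vlam = lam ->
  P (gn G) (setv s vr (gn G)) ->
  (forall k t v w, k < gn G -> P (S k) t -> ~ is_foot R D lam k = true ->
     P k (setv (setv (setv t vr k) va v) vt w) /\ P k (setv (setv t vr k) va v)) ->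
  (forall k t v, k < gn G -> ctx G t -> sa t aD = D -> sv t vlam = lam -> P (S k) t ->
     is_foot R D lam k = true -> P k (exec c (setv (setv (setv t vr k) va v) vt (D k)))) ->
  (forall k t, k < gn G -> P (S k) t -> sa t aR k = R k) ->
  P 0 (exec (for_feet c) s).
Proof.
  intros K C HD HL H0 HN HF HR. unfold for_feet. cbn [exec]. rewrite (ctx_n G s C).
  assert (K' : keeps c ctx_vars ctx_arrs = true /\ inb (wv c) vlam = false /\ inb (wa c) aD = false).
  { unfold keeps in K |- *. cbn [forallb] in K. rewrite !andb_true_iff, !negb_true_iff in K.
    rewrite andb_true_iff. intuition. }
  destruct K' as (K1 & K2 & K3).
  apply (down_inv (fun k t => ctx G t /\ sa t aD = D /\ sv t vlam = lam /\ P k t)).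
  - split; [now apply ctx_setv|]. auto.
  - intros k t Hk (Ct & TD & TL & TP). specialize (HR k t Hk TP).
    set (t1 := setv t vr k). set (t2 := setv t1 va _).
    assert (C2 : ctx G t2) by (unfold t2, t1; do 2 (apply ctx_setv; [reflexivity|]); auto).
    replace (sv t2 0) with 0 by (symmetry; apply C2).
    replace (sv t2 va) with (R k) by (symmetry; exact HR).
    set (t3 := setv t2 vt _).
    assert (C3 : ctx G t3) by (unfold t3; apply ctx_setv; [reflexivity|]; auto).
    replace (sv t3 vlam) with lam by (symmetry; exact TL).
    assert (E3 : sv t3 vt = D k) by (unfold t3, t2, t1; ex; now rewrite TD).
    rewrite E3.
    assert (F : is_foot R D lam k = (0 <? R k) && negb (lam <? D k)).
    { unfold is_foot. f_equal. rewrite Nat.leb_antisym. reflexivity. }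
    destruct (0 <? R k); [destruct (lam <? D k)|]; cbn [negb andb] in F.
    + split; [auto|]. split; [auto|]. split; [auto|]. refine (proj1 (HN k t _ _ Hk TP _)). now rewrite F.
    + rewrite frame_v, frame_a by auto. split; [now apply ctx_exec|].
      split; [auto|]. split; [auto|].
      unfold t3. replace (sa t2 aD (sv t2 vr)) with (D k) by (unfold t2, t1; ex; now rewrite TD).
      now apply HF.
    + split; [auto|]. split; [auto|]. split; [auto|]. refine (proj2 (HN k t _ 0 Hk TP _)). now rewrite F.
Qed.

Lemma exec_measure (G : graph) (s : state) :
  ctx G s -> sv s vsrc < gn G ->
  let F := feet (sa s aR) (sa s aD) (sv s vlam) 0 (gn G) in
  let s' := exec measure s in
  sv s' vcnt = 2 - length F /\
  sv s' vg = wt G (sv s vsrc) - sumf (fun r => sv s vlam - sa s aD r) F.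
Proof.
  intros C Hs. cbv zeta. unfold measure. rewrite !exec_seq.
  set (R := sa s aR). set (D := sa s aD). set (lam := sv s vlam).
  set (s1 := exec (Get vg aW vsrc) _).
  assert (C1 : ctx G s1) by (unfold s1; do 2 (apply ctx_exec; [reflexivity|]); auto).
  assert (G1 : sv s1 vg = wt G (sv s vsrc)).
  { unfold s1. ex. now apply (ctx_W G s). }
  set (W := wt G (sv s vsrc)) in *.
  apply (exec_for_feet G _ R D lam (fun k t => sa t aR = R /\
    sv t vcnt = 2 - length (feet R D lam k (gn G)) /\
    sv t vg = W - sumf (fun r => lam - D r) (feet R D lam k (gn G)))); auto.
  - rewrite feet_nil. ex. rewrite G1. repeat split.
  - intros k t v w Hk (TR & TC & TG) N.
    rewrite feet_S by auto. destruct (is_foot R D lam k); [tauto|]. ex. auto.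
  - intros k t v Hk Ct TD TL (TR & TC & TG) N. rewrite feet_S by auto. rewrite N.
    ex. rewrite (ctx_1 G t Ct), TC, TG, TL. cbn [length].
    split; [auto|]. split; [lia|].
    change (sumf (fun r => lam - D r) (k :: feet R D lam (S k) (gn G))) with
      (lam - D k + sumf (fun r => lam - D r) (feet R D lam (S k) (gn G))). lia.
  - intros k t Hk (TR & _). now rewrite TR.
Qed.

(** * Connectivity of the bought vertices and the effect of one purchase *)

Definition hlink (G : graph) (H : nat -> nat) (x y : nat) : Prop :=
  adj G x y /\ 0 < H x /\ 0 < H y.

Definition hconn (G : graph) (H : nat -> nat) : nat -> nat -> Prop :=
  clos_refl_trans nat (hlink G H).

Lemma crt_mono {T : Type} (e e' : T -> T -> Prop) (x y : T) :
  (forall u v, e u v -> e' u v) -> clos_refl_trans T e x y -> clos_refl_trans T e' x y.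
Proof.
  intros H. induction 1; [now apply rt_step, H|apply rt_refl|eapply rt_trans; eauto].
Qed.

Lemma crt_sym {T : Type} (e : T -> T -> Prop) (x y : T) :
  (forall u v, e u v -> e v u) -> clos_refl_trans T e x y -> clos_refl_trans T e y x.
Proof.
  intros H. induction 1; [now apply rt_step, H|apply rt_refl|eapply rt_trans; eauto].
Qed.

Lemma hconn_mono G H H' x y :
  (forall v, 0 < H v -> 0 < H' v) -> hconn G H x y -> hconn G H' x y.
Proof. intros M. apply crt_mono. unfold hlink. intuition. Qed.

Lemma hconn_sym G H x y : hconn G H x y -> hconn G H y x.
Proof. apply crt_sym. unfold hlink, adj. intuition. Qed.

Lemma descent_hconn G w D src x p H :
  descent (adj G) w D src x p -> (forall v, In v p -> 0 < H v) -> hconn G H x src.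
Proof.
  induction 1; intros HH; [apply rt_refl|].
  destruct (descent_head _ _ _ _ _ _ H2) as [q ->].
  eapply rt_trans; [apply rt_step|apply IHdescent].
  - split; [destruct H0; [right|left]; auto|]. split; apply HH; simpl; auto.
  - intros v Hv. apply HH. now right.
Qed.

(** Splits off the center, whose weight a spider pays once and not once per leg. *)
Lemma descent_split A w D src x p : descent A w D src x p ->
  exists q, p = q ++ [src] /\ sumf w q <= D x.
Proof.
  intros H. assert (E : exists q, p = q ++ [src]).
  { induction H as [|x y p _ _ _ (q & ->)]; [now exists []|now exists (x :: q)]. }
  destruct E as [q ->]. exists q. split; auto.
  pose proof (descent_weight _ _ _ _ _ _ H) as E. rewrite sumf_app in E.
  change (sumf w [src]) with (w src + 0) in E. lia.
Qed.

Lemma inb_In (l : list nat) (x : nat) : inb l x = true <-> In x l.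
Proof.
  unfold inb. rewrite existsb_exists. split; [|exists x; split; auto; apply Nat.eqb_refl].
  intros (y & Hy & ->%Nat.eqb_eq). auto.
Qed.

Lemma exec_buy (G : graph) (s : state) :
  wf_graph G -> ctx G s -> sv s vsrc < gn G -> sv s vlam <= tot G ->
  dist_table (gn G) (adj G) (wt G) (tot G) (sv s vsrc) (sa s aD) ->
  let F := feet (sa s aR) (sa s aD) (sv s vlam) 0 (gn G) in
  let s' := exec buy s in
  F <> [] ->
  exists kept U,
    In kept F /\
    (forall r, r < gn G -> sa s' aR r = if inb F r && negb (r =? kept) then 0 else sa s aR r) /\
    (forall v, 0 < sa s aH v -> 0 < sa s' aH v) /\
    (forall v, 0 < sa s' aH v -> v = sv s vsrc \/ In v U \/ 0 < sa s aH v) /\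
    sumf (wt G) U <= sumf (sa s aD) F /\
    (forall r, In r F -> hconn G (sa s' aH) r (sv s vsrc)).
Proof.
  intros WG C Hs HT DT. cbv zeta. unfold buy. rewrite exec_seq.
  set (R := sa s aR) in *. set (D := sa s aD) in *. set (lam := sv s vlam) in *.
  set (src := sv s vsrc) in *. set (H := sa s aH) in *. set (n := gn G) in *.
  set (s1 := exec (Set_ vkeep 0) s).
  assert (C1 : ctx G s1) by now apply ctx_exec.
  intros NF.
  (* [U] collects the leg vertices other than the center, with repetitions, so its weight is at most
     the sum of the distances of the feet seen so far. Before the first foot, [kept] is
     arbitrary. *)
  pose (P := fun k t => sv t vsrc = src /\ exists kept U,
    (0 < sv t vkeep /\ In kept (feet R D lam k n) \/ sv t vkeep = 0 /\ feet R D lam k n = []) /\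
    (forall r, r < n -> sa t aR r = if inb (feet R D lam k n) r && negb (r =? kept) then 0 else R r) /\
    (forall v, 0 < H v -> 0 < sa t aH v) /\
    (forall v, 0 < sa t aH v -> v = src \/ In v U \/ 0 < H v) /\
    sumf (wt G) U <= sumf D (feet R D lam k n) /\
    (forall r, In r (feet R D lam k n) -> hconn G (sa t aH) r src)).
  assert (Q : P 0 (exec (for_feet buy_leg) s1)).
  { apply (exec_for_feet G _ R D lam); auto; unfold P.
    - split; auto. exists 0, []. fold n. rewrite feet_nil. ex. repeat split; auto. intros r [].
    - intros k t v w Hk TP N. rewrite (feet_S R D lam k n Hk).
      destruct (is_foot R D lam k); [tauto|]. ex. auto.
    - intros k t v Hk Ct TD TL (Ts & kept & U & TK & TR & TM & TU & TW & TC) N.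
      rewrite (feet_S R D lam k n Hk), N. unfold buy_leg. rewrite !exec_seq.
      set (t1 := setv (setv (setv t vr k) va v) vt (D k)).
      set (t2 := exec (IfLt 0 vkeep (Put aR vr 0) (Set_ vkeep 1)) t1).
      assert (Ct1 : ctx G t1) by (unfold t1; do 3 (apply ctx_setv; [reflexivity|]); auto).
      assert (Ct2 : ctx G t2) by (apply ctx_exec; [reflexivity|auto]).
      assert (R2 : forall r, sa t2 aR r = if (0 <? sv t vkeep) && (r =? k) then 0 else sa t aR r).
      { intros r. unfold t2. cbn [exec]. replace (sv t1 0) with 0 by (symmetry; apply Ct1).
        unfold t1. ex. destruct (0 <? sv t vkeep); ex; auto. }
      assert (K2 : 0 < sv t2 vkeep).
      { unfold t2. cbn [exec]. replace (sv t1 0) with 0 by (symmetry; apply Ct1).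
        unfold t1. ex. destruct (Nat.ltb_spec 0 (sv t vkeep)); ex; auto. }
      assert (H2 : sa t2 aH = sa t aH) by (unfold t2; rewrite frame_a; auto).
      assert (D2 : sa t2 aD = D) by (unfold t2; rewrite frame_a; auto).
      assert (S2 : sv t2 vsrc = src) by (unfold t2; rewrite frame_v; auto).
      assert (X2 : sv t2 vr = k) by (unfold t2; rewrite frame_v; auto).
      clearbody t2. set (t3 := exec (Mov vx vr) t2).
      assert (C3 : ctx G t3) by now apply ctx_exec.
      assert (R3 : sa t3 aR = sa t2 aR) by reflexivity.
      assert (K3 : sv t3 vkeep = sv t2 vkeep) by reflexivity.
      assert (H3 : sa t3 aH = sa t aH) by exact H2.
      assert (D3 : sa t3 aD = D) by exact D2.
      assert (S3 : sv t3 vsrc = src) by exact S2.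
      assert (X3 : sv t3 vx = k) by exact X2.
      clearbody t3.
      assert (Dk : D k <= lam /\ 0 < R k).
      { unfold is_foot in N. apply andb_true_iff in N as [N1 N2].
        apply Nat.ltb_lt in N1. apply Nat.leb_le in N2. auto. }
      destruct (exec_walk G t3 WG C3) as (p & Hp & _ & _ & _ & PH).
      { now rewrite S3, D3. } { now rewrite X3. } { rewrite X3, D3. lia. }
      rewrite D3, S3, X3 in Hp. rewrite H3 in PH.
      destruct (descent_split _ _ _ _ _ _ Hp) as (q & Eq & Wq).
      rewrite !frame_v, frame_a by reflexivity. split; auto.
      assert (Mk : forall v, 0 < sa t aH v -> 0 < sa (exec walk t3) aH v).
      { intros u Hu. rewrite PH. destruct (inb p u); auto. }
      assert (KN : ~ In k (feet R D lam (S k) n)) by (rewrite in_feet; lia).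
      exists (if 0 <? sv t vkeep then kept else k), (q ++ U).
      split; [|split; [|split; [|split; [|split]]]].
      + left. split; [lia|]. destruct (Nat.ltb_spec 0 (sv t vkeep)); [|now left].
        destruct TK as [[_ TK]|[TK _]]; [now right|lia].
      + intros r Hr. rewrite R3, R2, TR by auto. cbn [inb existsb].
        destruct (Nat.ltb_spec 0 (sv t vkeep)) as [L|L]; cbn [andb].
        * destruct TK as [[_ TK]|[TK _]]; [|lia].
          destruct (Nat.eqb_spec r k) as [->|Nr]; cbn [orb andb]; auto.
          destruct (Nat.eqb_spec k kept) as [->|]; [contradiction|reflexivity].
        * destruct TK as [[TK _]|[_ TK]]; [lia|]. rewrite TK. cbn.
          destruct (Nat.eqb_spec r k); reflexivity.
      + auto.
      + intros u Hu. rewrite PH in Hu. destruct (inb p u) eqn:Ep.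
        * apply inb_In in Ep. rewrite Eq in Ep. apply in_app_iff in Ep as [Ep|[<-|[]]]; auto.
          right; left. apply in_app_iff; auto.
        * destruct (TU u Hu) as [|[|]]; auto. right; left. apply in_app_iff; auto.
      + rewrite sumf_app. change (sumf D (k :: feet R D lam (S k) n)) with
          (D k + sumf D (feet R D lam (S k) n)). lia.
      + intros r [<-|Hr].
        * eapply descent_hconn; [exact Hp|]. intros u Hu. rewrite PH.
          apply inb_In in Hu. rewrite Hu. auto.
        * eapply hconn_mono; [|apply TC; auto]. auto.
    - intros k t Hk (_ & kept & U & _ & TR & _). rewrite TR by exact Hk.
      replace (inb (feet R D lam (S k) n) k) with false; auto.
      symmetry. apply not_true_iff_false. rewrite inb_In, in_feet. lia. }
  destruct Q as (_ & kept & U & [[_ Q0]|[_ Q0]] & Q); [exists kept, U; auto|contradiction].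
Qed.

Definition marked (G : graph) (H : nat -> nat) : list nat :=
  filter (fun v => 0 <? H v) (seq 0 (gn G)).

Lemma in_marked (G : graph) (H : nat -> nat) (v : nat) :
  In v (marked G H) <-> v < gn G /\ 0 < H v.
Proof. unfold marked. rewrite filter_In, in_seq, Nat.ltb_lt. intuition lia. Qed.

Lemma NoDup_marked (G : graph) (H : nat -> nat) : NoDup (marked G H).
Proof. apply NoDup_filter, seq_NoDup. Qed.

Lemma NoDup_same_length (l l' : list nat) :
  NoDup l -> NoDup l' -> (forall x, In x l <-> In x l') -> length l = length l'.
Proof. intros N N' H. apply Permutation_length, NoDup_Permutation; auto. Qed.

Lemma marked_drop (G : graph) (R R' : nat -> nat) (F : list nat) (kept : nat) :
  NoDup F -> (forall r, In r F -> r < gn G /\ 0 < R r) -> In kept F ->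
  (forall r, r < gn G -> R' r = if inb F r && negb (r =? kept) then 0 else R r) ->
  length (marked G R') + length F = S (length (marked G R)).
Proof.
  intros NF HF Hk HR.
  set (gone := fun r => inb F r && negb (r =? kept)).
  assert (E1 : length (filter gone (marked G R)) + length (filter (fun r => negb (gone r)) (marked G R))
    = length (marked G R)) by apply filter_length.
  assert (E2 : length (kept :: filter gone (marked G R)) = length F).
  { apply NoDup_same_length; auto.
    - constructor; [|apply NoDup_filter, NoDup_marked]. intros [_ Hg]%filter_In.
      unfold gone in Hg. rewrite Nat.eqb_refl, andb_false_r in Hg. discriminate.
    - intros r. cbn [In]. rewrite filter_In, in_marked. unfold gone.
      rewrite andb_true_iff, inb_In, negb_true_iff, Nat.eqb_neq. split.
      + intros [<-|?]; tauto.
      + intros Hr. destruct (Nat.eq_dec kept r); auto. }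
  assert (E3 : length (marked G R') = length (filter (fun r => negb (gone r)) (marked G R))).
  { apply NoDup_same_length; [apply NoDup_marked|apply NoDup_filter, NoDup_marked|].
    intros r. rewrite filter_In, !in_marked. unfold gone.
    destruct (Nat.lt_ge_cases r (gn G)) as [L|L]; [|lia].
    rewrite HR by auto. destruct (inb F r && negb (r =? kept)); simpl; [lia|tauto]. }
  cbn [length] in E2. lia.
Qed.

(* The invariant of the purchase phase; [W] bounds the weight of a tree through [X], [R] marks
   the terminals that are still active and [H] the vertices bought so far. *)
Record purchase (G : graph) (X : list nat) (W : nat) (R H : nat -> nat) : Prop := {
  pu_sub : forall r, r < gn G -> 0 < R r -> In r X;
  pu_conn : forall x, In x X -> exists r, r < gn G /\ 0 < R r /\ hconn G H x r;
  pu_mark : forall x, In x X -> 0 < H x;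
  pu_cost : sumf (wt G) (marked G H) + 2 * hsum W (length (marked G R) - 1) +
      2 * (length (marked G R) - 1)
    <= sumf (wt G) X + 2 * hsum W (length X - 1) + 2 * (length X - 1) }.

Lemma sumf_ext {T : Type} (f g : T -> nat) (l : list T) :
  (forall x, In x l -> f x = g x) -> sumf f l = sumf g l.
Proof. intros H. apply Nat.le_antisymm; apply sumf_le; intros; rewrite H; auto. Qed.

Lemma purchase_buy (G : graph) X W R H R' H' D lam src kept U :
  purchase G X W R H -> (lam - 1) * (length (marked G R) - 1) <= W ->
  src < gn G ->
  let F := feet R D lam 0 (gn G) in
  2 <= length F -> wt G src <= sumf (fun r => lam - D r) F ->
  In kept F ->
  (forall r, r < gn G -> R' r = if inb F r && negb (r =? kept) then 0 else R r) ->
  (forall v, 0 < H v -> 0 < H' v) ->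
  (forall v, 0 < H' v -> v = src \/ In v U \/ 0 < H v) ->
  sumf (wt G) U <= sumf D F ->
  (forall r, In r F -> hconn G H' r src) ->
  purchase G X W R' H'.
Proof.
  intros [P1 P2 P3 P4] HW Hs F LF HG Hk HR M1 M2 HU HC.
  assert (InF : forall r, In r F -> r < gn G /\ 0 < R r /\ D r <= lam).
  { intros r Hr. apply in_feet in Hr. tauto. }
  assert (Rk : kept < gn G /\ 0 < R' kept).
  { destruct (InF _ Hk) as (L & Rk & _). split; auto. rewrite HR by auto.
    now rewrite Nat.eqb_refl, andb_false_r. }
  split.
  - intros r Hr Hp. apply P1; auto. rewrite HR in Hp by auto.
    destruct (_ && _); [lia|auto].
  - intros x Hx. destruct (P2 x Hx) as (r & Lr & Rr & Cr).
    apply (hconn_mono G H H') in Cr; auto.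
    destruct (inb F r && negb (r =? kept)) eqn:E.
    + exists kept. split; [tauto|]. split; [tauto|].
      apply andb_true_iff in E as [E%inb_In _].
      eapply rt_trans; [exact Cr|]. eapply rt_trans; [apply HC; exact E|].
      apply hconn_sym. now apply HC.
    + exists r. split; auto. split; auto. now rewrite HR, E.
  - auto.
  - assert (L : length (marked G R') + length F = S (length (marked G R))).
    { apply (marked_drop G R R' F kept); auto; [apply NoDup_feet|].
      intros r Hr. apply InF in Hr. tauto. }
    (* The kept foot stays active, so the subtraction of 1 from the new number of active terminals
       is not truncated. *)
    assert (L0 : 1 <= length (marked G R')).
    { assert (I : In kept (marked G R')) by now apply in_marked.
      destruct (marked G R'); [destruct I|simpl; lia]. }
    assert (S1 : sumf (wt G) (marked G H') <= sumf (wt G) (src :: U ++ marked G H)).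
    { apply sumf_incl; [apply NoDup_marked|]. intros v [Lv Hv]%in_marked.
      destruct (M2 v Hv) as [->|[Hu|Ho]]; [now left| |]; right; apply in_app_iff; auto.
      right. now apply in_marked. }
    change (sumf (wt G) (src :: U ++ marked G H)) with (wt G src + sumf (wt G) (U ++ marked G H)) in S1.
    rewrite sumf_app in S1.
    (* Slacks and distances of the feet add up to [lam] each; as the slacks cover the center, the
       whole spider costs at most [lam * length F]. *)
    assert (S2 : sumf (fun r => lam - D r) F + sumf D F = lam * length F).
    { rewrite <- sumf_add, <- sumf_const. apply sumf_ext. intros r Hr. apply InF in Hr. lia. }
    pose proof (hsum_charge W lam _ (length (marked G R') - 1) HW ltac:(lia)) as Ch.
    replace (length (marked G R) - 1 - (length (marked G R') - 1)) with (length F - 1) in Ch by lia.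
    assert (lam * length F <= 2 * (lam * (length F - 1))) by nia.
    lia.
Qed.

(** * Exhausted centers and the analysis of all price rounds *)

Definition active (G : graph) (R : nat -> nat) (r : nat) : Prop := r < gn G /\ 0 < R r.

Lemma blocked_mono A w (R R' : nat -> Prop) p v :
  (forall r, R' r -> R r) -> blocked A w R p v -> blocked A w R' p v.
Proof.
  intros H B S NS HS. apply B; auto. intros r a Hra. destruct (HS r a Hra) as (? & ? & ?). auto.
Qed.

Lemma blocked_few_feet (G : graph) (R D : nat -> nat) T src lam F :
  dist_table (gn G) (adj G) (wt G) T src D ->
  (forall r, active G R r -> D r <= lam -> In r F) ->
  length F < 2 -> blocked (adj G) (wt G) (active G R) lam src.
Proof.
  intros DT HF LF S NS HS LS. exfalso.
  assert (I : incl (map fst S) F).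
  { intros r ((r' & a) & <- & Hra)%in_map_iff. destruct (HS _ _ Hra) as (HA & Hr & Ha).
    apply HF; auto. pose proof (dist_reach _ _ _ _ _ _ _ _ DT Hr). simpl. lia. }
  pose proof (NoDup_incl_length NS I) as L. rewrite length_map in L. lia.
Qed.

(** Legs weigh at least the distances and the slacks of feet outside [S] are not negative, so no
    choice of feet has more slack than [F], which falls short of the weight of the center. *)
Lemma blocked_cheap_feet (G : graph) (R D : nat -> nat) T src lam F :
  dist_table (gn G) (adj G) (wt G) T src D ->
  (forall r, active G R r -> D r <= lam -> In r F) ->
  sumf (fun r => lam - D r) F < wt G src -> blocked (adj G) (wt G) (active G R) lam src.
Proof.
  intros DT HF LF S NS HS LS.
  assert (HD : forall r a, In (r, a) S -> D r <= a).
  { intros r a Hra. destruct (HS _ _ Hra) as (_ & Hr & _). eapply dist_reach; eauto. }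
  assert (I : incl (map fst S) F).
  { intros r ((r' & a) & <- & Hra)%in_map_iff. destruct (HS _ _ Hra) as (HA & Hr & Ha).
    apply HF; auto. specialize (HD _ _ Hra). simpl. lia. }
  pose proof (sumf_incl (fun r => lam - D r) _ _ NS I) as L1.
  assert (L2 : lam * length S <= sumf (fun r => lam - D r) (map fst S) + sumf snd S).
  { unfold sumf at 1. rewrite map_map.
    change (list_sum (map (fun x => lam - D (fst x)) S)) with (sumf (fun x => lam - D (fst x)) S).
    rewrite <- sumf_add. apply sumf_ge_const. intros [r a] Hra. specialize (HD _ _ Hra). simpl. lia. }
  lia.
Qed.

Lemma exec_scan (G : graph) (X : list nat) (W : nat) (s : state) :
  wf_graph G -> ctx G s -> sv s vsrc < gn G -> sv s vlam <= tot G ->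
  (sv s vlam - 1) * (length (marked G (sa s aR)) - 1) <= W ->
  purchase G X W (sa s aR) (sa s aH) ->
  purchase G X W (sa (exec scan s) aR) (sa (exec scan s) aH) /\
  (forall r, active G (sa (exec scan s) aR) r -> active G (sa s aR) r) /\
  blocked (adj G) (wt G) (active G (sa (exec scan s) aR)) (sv s vlam) (sv s vsrc).
Proof.
  intros WG C Hs HT HW PU. unfold scan. rewrite !exec_seq.
  destruct (exec_sssp G s WG C Hs) as [DT _].
  set (s1 := exec sssp s) in *.
  assert (C1 : ctx G s1) by now apply ctx_exec.
  assert (E1 : sv s1 vsrc = sv s vsrc /\ sv s1 vlam = sv s vlam /\ sa s1 aR = sa s aR /\
    sa s1 aH = sa s aH).
  { unfold s1. rewrite !frame_v, !frame_a by reflexivity. auto. }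
  clearbody s1. destruct E1 as (ES & EL & ER & EH).
  rewrite <- ES, <- EL, <- ER, <- EH in *. clear ES EL ER EH C s.
  destruct (exec_measure G s1 C1 Hs) as [MC MG].
  set (s2 := exec measure s1) in *.
  assert (C2 : ctx G s2) by now apply ctx_exec.
  assert (E2 : sv s2 vsrc = sv s1 vsrc /\ sv s2 vlam = sv s1 vlam /\ sa s2 aR = sa s1 aR /\
    sa s2 aH = sa s1 aH /\ sa s2 aD = sa s1 aD).
  { unfold s2. rewrite !frame_v, !frame_a by reflexivity. auto. }
  clearbody s2. destruct E2 as (ES & EL & ER & EH & ED).
  rewrite <- ES, <- EL, <- ER, <- EH, <- ED in *. clear ES EL ER EH ED C1 s1.
  set (src := sv s2 vsrc) in *. set (lam := sv s2 vlam) in *.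
  set (F := feet (sa s2 aR) (sa s2 aD) lam 0 (gn G)) in *.
  assert (HF : forall r, active G (sa s2 aR) r -> sa s2 aD r <= lam -> In r F).
  { intros r [Hr Ha] Hd. apply in_feet. split; [lia|auto]. }
  cbn [exec]. rewrite (ctx_0 G s2 C2), MC, MG.
  destruct (Nat.ltb_spec 0 (2 - length F)) as [L|L].
  { split; auto. split; auto. eapply blocked_few_feet; eauto. lia. }
  destruct (Nat.ltb_spec 0 (wt G src - sumf (fun r => lam - sa s2 aD r) F)) as [L'|L'].
  { split; auto. split; auto. eapply blocked_cheap_feet; eauto. lia. }
  destruct (exec_buy G s2) as (kept & U & HK & HR & HM & HU & SU & HC); auto.
  { fold lam F. destruct F; simpl in *; [lia|discriminate]. }
  fold src lam in HK, HR, HM, HU, SU, HC. fold F in HK, HR, SU, HC.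
  split; [|split].
  - apply (purchase_buy G X W (sa s2 aR) (sa s2 aH) _ _ (sa s2 aD) lam src kept U); auto;
      fold F; lia.
  - intros r [Hr Ha]. split; auto. rewrite HR in Ha by auto. destruct (_ && _); [lia|auto].
  (* After the purchase, [kept] is the only active terminal within [lam] of the center, so this
     center is exhausted at once. *)
  - apply (blocked_few_feet G _ (sa s2 aD) (tot G) src lam [kept]); auto.
    intros r [Hr Ha] Hd. rewrite HR in Ha by auto.
    destruct (Nat.eqb_spec r kept) as [->|N]; [now left|]. exfalso.
    assert (I : In r F).
    { apply in_feet. split; [lia|]. split; auto. destruct (_ && _); [lia|auto]. }
    apply inb_In in I. rewrite I in Ha. simpl in Ha. lia.
Qed.

(** The token bound applied to all active terminals; they lie on the tree [V] because active
    terminals belong to [X]. *)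
Lemma few_active (G : graph) (X V : list nat) (R H : nat -> nat) (W p : nat) :
  grown (adj G) V -> (forall v, In v V -> v < gn G) -> incl X V ->
  purchase G X W R H ->
  (forall v, v < gn G -> blocked (adj G) (wt G) (active G R) p v) ->
  p * (length (marked G R) - 1) <= sumf (wt G) V.
Proof.
  intros GV LV IV PU HB.
  pose proof (blocked_bound (adj G) (wt G) (active G R) p V (marked G R) GV) as Q.
  assert (p * length (marked G R) <= p + sumf (wt G) V); [|nia].
  apply Q; auto.
  - apply NoDup_marked.
  - intros r [Lr Hr]%in_marked. apply IV. eapply pu_sub; eauto.
  - intros r Hr. now apply in_marked in Hr.
Qed.

(** [V] occurs in the analysis only: the program does not depend on it, so the bound holds for every
    tree through [X], in particular for an optimal one. *)
Lemma exec_spiders (G : graph) (X V : list nat) (s : state) :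
  wf_graph G -> ctx G s ->
  grown (adj G) V -> (forall v, In v V -> v < gn G) -> incl X V -> X <> [] ->
  purchase G X (sumf (wt G) V) (sa s aR) (sa s aH) ->
  let H' := sa (exec spiders s) aH in
  (forall x y, In x X -> In y X -> hconn G H' x y) /\
  (forall x, In x X -> 0 < H' x) /\
  sumf (wt G) (marked G H') <=
    sumf (wt G) X + 2 * hsum (sumf (wt G) V) (length X - 1) + 2 * (length X - 1).
Proof.
  intros WG C GV LV IV NX PU. cbv zeta.
  set (W := sumf (wt G) V) in *. set (T := tot G).
  assert (HW : W < T) by (apply sumf_wt_lt; auto; eapply grown_NoDup; eauto).
  pose (Q := fun (k : nat) t => ctx G t /\ sv t vlam + k = T /\
    purchase G X W (sa t aR) (sa t aH) /\
    forall v, v < gn G -> blocked (adj G) (wt G) (active G (sa t aR)) (sv t vlam) v).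
  assert (F : Q 0 (exec spiders s)).
  { unfold spiders. rewrite exec_seq. set (s1 := exec (Set_ vlam 0) s).
    assert (C1 : ctx G s1) by now apply ctx_exec.
    cbn [exec]. rewrite (ctx_T G s1 C1). fold T. apply (down_inv Q).
    - unfold Q. split; [now apply ctx_setv|]. split; [reflexivity|]. split; [exact PU|].
      (* At price 0 every vertex is blocked, because its own weight is positive. *)
      intros v Hv S NS HS LS. cbn. unfold wt. lia.
    - intros k t Hk (Ct & TL & TP & TB).
      set (t1 := setv (setv t vll k) vlam _).
      assert (Ct1 : ctx G t1) by (do 2 (apply ctx_setv; [reflexivity|]); auto).
      assert (L1 : sv t1 vlam = S (sv t vlam)) by reflexivity.
      assert (R1 : sa t1 aR = sa t aR) by reflexivity.
      assert (H1 : sa t1 aH = sa t aH) by reflexivity.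
      clearbody t1. rewrite <- R1, <- H1 in *.
      set (lam := sv t vlam) in *. clearbody lam. clear t Ct R1 H1.
      rewrite (ctx_n G t1 Ct1).
      (* While the centers are scanned at price [S lam], blockedness at the old price [lam] is
         carried along: through [few_active] it limits the number of active terminals at each
         purchase. *)
      pose (P := fun (j : nat) u => ctx G u /\ sv u vlam = S lam /\
        purchase G X W (sa u aR) (sa u aH) /\
        (forall v, v < gn G -> blocked (adj G) (wt G) (active G (sa u aR)) lam v) /\
        (forall v, j <= v < gn G -> blocked (adj G) (wt G) (active G (sa u aR)) (S lam) v)).
      set (t2 := down _ _ _).
      assert (FP : P 0 t2).
      { apply (down_inv P).
        - unfold P. split; [now apply ctx_setv|]. split; [exact L1|]. split; [exact TP|].
          split; [exact TB|]. intros; lia.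
        - intros j u0 Hj (Cu & Lu & Pu & Bu & Bj).
          set (u := setv u0 vsrc j).
          assert (Cu1 : ctx G u) by now apply ctx_setv.
          assert (Lu1 : sv u vlam = S lam) by exact Lu.
          assert (Su1 : sv u vsrc = j) by reflexivity.
          assert (Ru1 : sa u aR = sa u0 aR) by reflexivity.
          assert (Hu1 : sa u aH = sa u0 aH) by reflexivity.
          clearbody u. rewrite <- Ru1, <- Hu1 in *.
          destruct (exec_scan G X W u) as (S1 & S2 & S3); auto.
          { now rewrite Su1. } { rewrite Lu1. unfold T in *. lia. }
          { rewrite Lu1. simpl. rewrite Nat.sub_0_r. unfold W. eapply few_active; eauto. }
          unfold P. split; [now apply ctx_exec|].
          split; [rewrite frame_v; auto|]. split; [exact S1|]. split.
          + intros v Hv. eapply blocked_mono; [exact S2|]. now apply Bu.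
          + intros v Hv. destruct (Nat.eq_dec v j) as [->|N].
            * rewrite Lu1, Su1 in S3. exact S3.
            * eapply blocked_mono; [exact S2|]. apply Bj. lia. }
      destruct FP as (F1 & F2 & F3 & _ & F5). unfold Q. rewrite F2.
      split; auto. split; [lia|]. split; auto. intros v Hv. apply F5. lia. }
  destruct F as (_ & FL & FP & FB). rewrite Nat.add_0_r in FL. rewrite FL in FB.
  set (s' := exec spiders s) in *. clearbody s'.
  assert (L1 : length (marked G (sa s' aR)) <= 1).
  { pose proof (few_active G X V _ _ W T GV LV IV FP FB) as Q1. fold W in Q1. nia. }
  destruct FP as [P1 P2 P3 P4].
  split; [|split; [auto|]].
  - intros x y Hx Hy. destruct (P2 x Hx) as (r & Lr & Rr & Cr).
    destruct (P2 y Hy) as (r' & Lr' & Rr' & Cr').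
    assert (I : In r (marked G (sa s' aR))) by now apply in_marked.
    assert (I' : In r' (marked G (sa s' aR))) by now apply in_marked.
    destruct (marked G (sa s' aR)) as [|z [|]]; simpl in L1; [destruct I| |lia].
    destruct I as [<-|[]], I' as [<-|[]].
    eapply rt_trans; [exact Cr|]. now apply hconn_sym.
  - lia.
Qed.

(** * Extracting a tree *)

Notation aTR := 8 (only parsing).
Notation aF := 9 (only parsing).
Notation vnv := 33 (only parsing).
Notation vkt := 34 (only parsing).
Notation vroot := 35 (only parsing).

Definition graft (x y : nat) : cmd :=
  Get vt aTR x ;;
  IfLt 0 vt
    (Get vt aTR y ;;
     IfLt 0 vt Skip
       (Get vt aH y ;; IfLt 0 vt (Put aTR y v1 ;; Put aF vh v1 ;; CInc vnv) Skip))
    Skip.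

Definition grow_start : cmd :=
  For vi vn (Put aTR vi 0) ;; For vh vm (Put aF vh 0) ;; Put aTR vroot v1 ;; Set_ vnv 1.

Definition grow_loop : cmd := For vi vn (edge (graft vu vv) (graft vv vu)).

Definition graftable (TR H : nat -> nat) (x y : nat) : Prop := 0 < TR x /\ TR y = 0 /\ 0 < H y.

Ltac case_ltb := match goal with |- context [0 <? ?e] => destruct (Nat.ltb_spec 0 e) end.

Lemma exec_graft (x y : nat) (s : state) :
  (x = vu /\ y = vv) \/ (x = vv /\ y = vu) -> sv s 0 = 0 -> sv s v1 = 1 ->
  let s' := exec (graft x y) s in
  (graftable (sa s aTR) (sa s aH) (sv s x) (sv s y) /\ sv s' vnv = S (sv s vnv) /\
   (forall i, sa s' aTR i = if i =? sv s y then 1 else sa s aTR i) /\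
   (forall i, sa s' aF i = if i =? sv s vh then 1 else sa s aF i)) \/
  (~ graftable (sa s aTR) (sa s aH) (sv s x) (sv s y) /\ sv s' vnv = sv s vnv /\
   sa s' aTR = sa s aTR /\ sa s' aF = sa s aF).
Proof.
  intros Hxy Z O. unfold graft, graftable.
  destruct Hxy as [[-> ->]|[-> ->]]; ex; rewrite Z;
    (case_ltb; [|right; ex; repeat split; auto; lia]; ex;
     case_ltb; [right; ex; repeat split; auto; lia|]; ex;
     case_ltb; [|right; ex; repeat split; auto; lia];
     left; ex; rewrite O; repeat split; auto; lia).
Qed.

Definition chosen (G : graph) (F : nat -> nat) : list nat :=
  filter (fun h => 0 <? F h) (seq 0 (length (gE G))).

Lemma in_chosen (G : graph) (F : nat -> nat) (h : nat) :
  In h (chosen G F) <-> h < length (gE G) /\ 0 < F h.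
Proof. unfold chosen. rewrite filter_In, in_seq, Nat.ltb_lt. intuition lia. Qed.

Definition flink (G : graph) (F : nat -> nat) (x y : nat) : Prop :=
  exists h, In h (chosen G F) /\ (ed G h = (x, y) \/ ed G h = (y, x)).

Record partial_tree (G : graph) (H : nat -> nat) (root : nat) (TR F : nat -> nat) (k : nat) : Prop := {
  pt_root : In root (marked G TR);
  pt_sub : forall v, In v (marked G TR) -> In v (marked G H);
  pt_verts : length (marked G TR) = k;
  pt_edges : length (chosen G F) + 1 = k;
  pt_ends : forall x y, flink G F x y -> In x (marked G TR) /\ In y (marked G TR);
  pt_conn : forall v, In v (marked G TR) -> clos_refl_trans nat (flink G F) root v }.

Lemma length_filter_insert (f f' : nat -> bool) (n y : nat) :
  y < n -> f y = false -> (forall i, f' i = (i =? y) || f i) ->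
  length (filter f' (seq 0 n)) = S (length (filter f (seq 0 n))).
Proof.
  intros Hy Fy Hf.
  change (S (length (filter f (seq 0 n)))) with (length (y :: filter f (seq 0 n))).
  apply NoDup_same_length.
  - apply NoDup_filter, seq_NoDup.
  - constructor; [|apply NoDup_filter, seq_NoDup]. rewrite filter_In. intros [_ E]. congruence.
  - intros i. cbn [In]. rewrite !filter_In, Hf, orb_true_iff, Nat.eqb_eq, in_seq.
    split; [intros (? & [->|?]); auto|intros [<-|?]; [split; [lia|auto]|tauto]].
Qed.

Lemma flink_mono G F F' x y : (forall h, 0 < F h -> 0 < F' h) -> flink G F x y -> flink G F' x y.
Proof.
  intros M (h & Hh & E). exists h. rewrite in_chosen in *. split; [split; [tauto|apply M; tauto]|auto].
Qed.

Lemma flink_sym G F x y : flink G F x y -> flink G F y x.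
Proof. intros (h & Hh & E). exists h. tauto. Qed.

Lemma partial_tree_graft (G : graph) H root TR F TR' F' k h x y :
  wf_graph G -> partial_tree G H root TR F k -> h < length (gE G) ->
  ed G h = (x, y) \/ ed G h = (y, x) -> graftable TR H x y ->
  (forall i, TR' i = if i =? y then 1 else TR i) ->
  (forall i, F' i = if i =? h then 1 else F i) ->
  partial_tree G H root TR' F' (S k).
Proof.
  intros WG [P1 P2 P3 P4 P5 P6] Hh Hxy (Gx & Gy & Gh) HT HF.
  assert (A : adj G x y) by (apply adj_ed; exists h; auto).
  destruct (adj_lt G x y WG A) as [Lx Ly].
  assert (MT : forall v, In v (marked G TR') <-> v = y \/ In v (marked G TR)).
  { intros v. rewrite !in_marked, HT. destruct (Nat.eqb_spec v y) as [->|]; intuition lia. }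
  (* Had the edge been chosen before, [y] would already be in the tree; so the edge is new and both
     counts grow by 1. *)
  assert (F0 : F h = 0).
  { destruct (Nat.eq_dec (F h) 0) as [|N]; auto. exfalso.
    assert (FL : flink G F x y) by (exists h; split; [apply in_chosen; split; [auto|lia]|auto]).
    apply P5 in FL as [_ FL]. apply in_marked in FL. lia. }
  assert (MF : forall u v, flink G F u v -> flink G F' u v).
  { intros u v. apply flink_mono. intros i Hi. rewrite HF. destruct (i =? h); lia. }
  assert (Fxy : flink G F' x y).
  { exists h. split; auto. apply in_chosen. split; auto. rewrite HF, Nat.eqb_refl. lia. }
  split.
  - apply MT. auto.
  - intros v [->|Hv]%MT; auto. now apply in_marked.
  - rewrite <- P3. apply (length_filter_insert _ _ _ y); auto.
    + now rewrite Gy.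
    + intros i. rewrite HT. destruct (i =? y); auto.
  - rewrite <- P4. rewrite !Nat.add_1_r. f_equal. apply (length_filter_insert _ _ _ h); auto.
    + now rewrite F0.
    + intros i. rewrite HF. destruct (i =? h); auto.
  - intros u v (i & Hi & E). rewrite in_chosen, HF in Hi. rewrite !MT.
    destruct (Nat.eq_dec i h) as [Eh|N].
    + subst i. assert (Mx : In x (marked G TR)) by now apply in_marked.
      destruct E as [E|E], Hxy as [Q|Q]; rewrite Q in E; injection E as <- <-; auto.
    + apply Nat.eqb_neq in N. rewrite N in Hi.
      destruct (P5 u v) as [? ?]; auto. exists i. rewrite in_chosen. auto.
  - intros v [->|Hv]%MT.
    + eapply rt_trans; [|apply rt_step, Fxy]. apply (crt_mono _ _ _ _ MF). apply P6.
      now apply in_marked.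
    + apply (crt_mono _ _ _ _ MF). now apply P6.
Qed.

Definition tree_closed (G : graph) (TR H : nat -> nat) : Prop :=
  forall x y, adj G x y -> ~ graftable TR H x y.

(* [TR0] and [c0] are the tree and its size at the start of the pass, and the edges in [e] have
   been examined. *)
Definition pass (G : graph) (H : nat -> nat) (root : nat) (TR0 : nat -> nat) (c0 : nat)
    (e : nat -> nat -> Prop) (t : state) : Prop :=
  sa t aH = H /\ partial_tree G H root (sa t aTR) (sa t aF) (sv t vnv) /\
  ((sv t vnv = c0 /\ (forall v, sa t aTR v = TR0 v) /\
    forall x y, e x y -> ~ graftable TR0 H x y) \/
   (c0 < sv t vnv /\ ~ tree_closed G TR0 H)).

Lemma exec_grow_pass (G : graph) (s : state) (H : nat -> nat) (root : nat) :
  wf_graph G -> ctx G s -> sa s aH = H ->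
  partial_tree G H root (sa s aTR) (sa s aF) (sv s vnv) ->
  pass G H root (sa s aTR) (sv s vnv) (edges_from G 0)
    (exec (edge (graft vu vv) (graft vv vu)) s).
Proof.
  intros WG C EH PT. set (TR0 := sa s aTR) in *. set (c0 := sv s vnv) in *.
  apply (edge_sweep G graft (pass G H root TR0 c0)); auto.
  - intros e e' t He (T1 & T2 & T3). split; [auto|]. split; [auto|].
    destruct T3 as [(T3 & T4 & T5)|T3]; [left|right]; auto.
  - intros e t x v [<-|[<-|[<-|[]]]] Ht; exact Ht.
  - split; [auto|]. split; [auto|]. left. auto.
  - intros e t a b Hab Ct Lk Ek A (TH & TP & TD). split; [now rewrite frame_a|].
    destruct (exec_graft a b t Hab) as [(GR & EN & ET & EF)|(GR & EN & ET & EF)];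
      try apply Ct; rewrite TH in GR.
    + split; [rewrite EN; eapply partial_tree_graft; eauto|].
      right. rewrite EN. destruct TD as [(E1 & E2 & E3)|[E1 E2]]; [|split; [lia|auto]].
      split; [lia|]. intros TC. apply (TC _ _ A). unfold graftable in *. now rewrite <- !E2.
    + rewrite EN, ET, EF. split; auto.
      destruct TD as [(E1 & E2 & E3)|TD]; [left|right; auto].
      split; auto. split; auto. intros x y [Hxy|[-> ->]]; auto.
      intros GR'. apply GR. unfold graftable in *. now rewrite !E2.
Qed.

Lemma length_filter_seq (f : nat -> bool) (n : nat) : length (filter f (seq 0 n)) <= n.
Proof. rewrite <- (length_seq n 0) at 2. apply filter_length_le. Qed.

Lemma exec_grow (G : graph) (s : state) (root : nat) :
  wf_graph G -> ctx G s -> sv s vroot = root -> In root (marked G (sa s aH)) ->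
  let s' := exec grow_loop (exec grow_start s) in
  ctx G s' /\
  partial_tree G (sa s aH) root (sa s' aTR) (sa s' aF) (sv s' vnv) /\
  tree_closed G (sa s' aTR) (sa s aH).
Proof.
  intros WG C Er Hr. cbv zeta. set (H := sa s aH) in *. set (n := gn G).
  assert (C1 : ctx G (exec grow_start s)) by now apply ctx_exec.
  assert (H1 : sa (exec grow_start s) aH = H) by now apply frame_a.
  assert (N1 : sv (exec grow_start s) vnv = 1) by reflexivity.
  assert (P1 : partial_tree G H root (sa (exec grow_start s) aTR) (sa (exec grow_start s) aF)
    (sv (exec grow_start s) vnv)).
  { rewrite N1. unfold grow_start. rewrite !exec_seq.
    set (s1 := exec (For vi vn _) s).
    assert (Cs1 : ctx G s1) by now apply ctx_exec.
    assert (T1 : forall v, v < n -> sa s1 aTR v = 0).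
    { intros v Hv. unfold s1. rewrite exec_fill; [apply C|discriminate|].
      now rewrite (ctx_n G s C). }
    assert (R1 : sv s1 vroot = root) by (rewrite <- Er; now apply frame_v).
    clearbody s1. set (s2 := exec (For vh vm _) s1).
    assert (Cs2 : ctx G s2) by now apply ctx_exec.
    assert (F2 : forall v, v < length (gE G) -> sa s2 aF v = 0).
    { intros v Hv. unfold s2. rewrite exec_fill; [apply Cs1|discriminate|].
      now rewrite (ctx_m G s1 Cs1). }
    assert (T2 : sa s2 aTR = sa s1 aTR) by now apply frame_a.
    assert (R2 : sv s2 vroot = root) by (rewrite <- R1; now apply frame_v).
    clearbody s2. ex. rewrite (ctx_1 G s2 Cs2), R2, T2.
    apply in_marked in Hr as [Lr Hr].
    assert (ME : forall v, In v (marked G (fun j => if j =? root then 1 else sa s1 aTR j)) <-> v = root).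
    { intros v. rewrite in_marked. destruct (Nat.eqb_spec v root) as [->|N]; [intuition lia|].
      split; [|congruence]. intros [Lv Hv]. rewrite T1 in Hv; [lia|unfold n; lia]. }
    assert (CE : forall h, ~ In h (chosen G (sa s2 aF))).
    { intros h [Lh Hh]%in_chosen. rewrite F2 in Hh; lia. }
    split.
    - now apply ME.
    - intros v ->%ME. now apply in_marked.
    - change 1 with (length [root]). apply NoDup_same_length; [apply NoDup_marked| |].
      + repeat constructor; auto.
      + intros v. rewrite ME. simpl. intuition.
    - destruct (chosen G (sa s2 aF)) as [|h l]; [reflexivity|]. exfalso. apply (CE h). now left.
    - intros x y (h & Hh & _). exfalso. eapply CE; eauto.
    - intros v ->%ME. apply rt_refl. }
  set (s1 := exec grow_start s) in *. clearbody s1.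
  unfold grow_loop. cbn [exec]. rewrite (ctx_n G s1 C1). fold n.
  set (s' := down n _ _).
  assert (F : ctx G s' /\ sa s' aH = H /\
    partial_tree G H root (sa s' aTR) (sa s' aF) (sv s' vnv) /\
    (tree_closed G (sa s' aTR) H \/ n + 1 <= sv s' vnv + 0)).
  { unfold s'. apply (down_inv (fun k t => ctx G t /\ sa t aH = H /\
      partial_tree G H root (sa t aTR) (sa t aF) (sv t vnv) /\
      (tree_closed G (sa t aTR) H \/ n + 1 <= sv t vnv + k))).
    - split; [now apply ctx_setv|]. split; [auto|]. split; [auto|]. right. ex. rewrite N1. lia.
    - intros k t0 Hk (Ct & TH & TP & TC). set (t := setv t0 vi k).
      assert (Ct' : ctx G t) by now apply ctx_setv.
      change (sa t0) with (sa t) in *. change (sv t0 vnv) with (sv t vnv) in *.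
      clearbody t. clear t0 Ct.
      destruct (exec_grow_pass G t H root WG Ct' TH TP) as (Q1 & Q2 & Q3).
      split; [now apply ctx_exec|]. split; [auto|]. split; [auto|].
      destruct Q3 as [(E1 & E2 & E3)|(E1 & E2)].
      + left. intros x y Axy GR. apply (E3 x y).
        * apply adj_ed in Axy as (h & Hh & E). exists h. split; [lia|auto].
        * unfold graftable in *. now rewrite <- !E2.
      + right. destruct TC as [TC|TC]; [contradiction|lia]. }
  destruct F as (F1 & F2 & F3 & F4). split; [auto|]. split; [auto|].
  destruct F4 as [F4|F4]; auto. exfalso.
  pose proof (pt_verts _ _ _ _ _ _ F3) as L.
  pose proof (length_filter_seq (fun v => 0 <? sa s' aTR v) (gn G)) as L'.
  unfold marked in L. unfold n in F4. lia.
Qed.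

(** * Writing the tree to the output *)

Definition push (x : nat) : cmd := Put aOUT vLEN x ;; CInc vLEN.

Lemma output_push (s : state) (x : nat) : output (exec (push x) s) = output s ++ [sv s x].
Proof.
  unfold output, push. ex. rewrite seq_S, map_app. cbn [map Nat.add]. rewrite Nat.eqb_refl.
  f_equal. apply map_ext_in. intros i Hi%in_seq.
  destruct (Nat.eqb_spec i (sv s vLEN)); [lia|reflexivity].
Qed.

Definition emit_verts : cmd :=
  For vi vn (Get vt aTR vi ;; IfLt 0 vt (push vi) Skip).

Definition emit_edges : cmd :=
  edge (Get vt aF vh ;; IfLt 0 vt (push vu ;; push vv) Skip) Skip.

(** A tree has one edge less than it has vertices, so the edge count is obtained from [vnv]
    itself. *)
Definition emit : cmd :=
  Set_ vLEN 0 ;; push vnv ;; emit_verts ;; Sub vnv v1 ;; push vnv ;; emit_edges.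

(** The reversal is due to loops that count downwards. *)
Lemma exec_emit_verts (G : graph) (s : state) :
  ctx G s -> output (exec emit_verts s) = output s ++ rev (marked G (sa s aTR)).
Proof.
  intros C. unfold emit_verts. rewrite exec_for, (ctx_n G s C).
  set (f := fun v => 0 <? sa s aTR v).
  set (s' := down _ _ _).
  assert (F : sv s' 0 = 0 /\ sa s' aTR = sa s aTR /\
    output s' = output s ++ rev (filter f (seq 0 (gn G - 0)))).
  { apply (down_inv (fun k t => sv t 0 = 0 /\ sa t aTR = sa s aTR /\
      output t = output s ++ rev (filter f (seq k (gn G - k))))).
    - split; [apply C|]. split; auto. rewrite Nat.sub_diag. cbn. now rewrite app_nil_r.
    - intros k t Hk (Z & T & O). replace (gn G - k) with (S (gn G - S k)) by lia.
      cbn [seq filter]. set (t1 := setv t vi k).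
      rewrite exec_seq. set (t2 := exec (Get vt aTR vi) t1).
      assert (Z2 : sv t2 0 = 0) by exact Z.
      assert (T2 : sa t2 aTR = sa s aTR) by exact T.
      assert (V2 : sv t2 vt = sa s aTR k) by (unfold t2, t1; ex; now rewrite T).
      assert (O2 : output t2 = output t) by reflexivity.
      assert (I2 : sv t2 vi = k) by reflexivity.
      clearbody t2. cbn [exec]. rewrite Z2, V2. fold (f k).
      destruct (f k).
      + split; [rewrite frame_v; auto|]. split; [rewrite frame_a; auto|].
        rewrite output_push, O2, O, I2. cbn [rev]. now rewrite app_assoc.
      + split; [auto|]. split; [auto|]. now rewrite O2, O. }
  rewrite Nat.sub_0_r in F. apply F.
Qed.

Lemma exec_emit_edges (G : graph) (s : state) :
  ctx G s ->
  output (exec emit_edges s) =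
    output s ++ encode_edges (map (ed G) (rev (chosen G (sa s aF)))).
Proof.
  intros C. set (m := length (gE G)). set (f := fun v => 0 <? sa s aF v).
  assert (F : sa (exec emit_edges s) aF = sa s aF /\ output (exec emit_edges s) =
    output s ++ encode_edges (map (ed G) (rev (filter f (seq 0 (m - 0)))))).
  { apply (exec_edge G _ _ (fun k t => sa t aF = sa s aF /\
      output t = output s ++ encode_edges (map (ed G) (rev (filter f (seq k (m - k))))))); auto.
    - fold m. rewrite Nat.sub_diag. cbn. rewrite app_nil_r. auto.
    - intros k t Hk Ct (T & O). fold m in Hk. replace (m - k) with (S (m - S k)) by lia.
      cbn [seq filter]. set (t1 := setv _ vv _). rewrite exec_seq.
      set (t2 := exec (Get vt aF vh) t1).
      assert (Z2 : sv t2 0 = 0) by apply Ct.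
      assert (T2 : sa t2 aF = sa s aF) by exact T.
      assert (V2 : sv t2 vt = sa s aF k) by (unfold t2, t1; ex; now rewrite T).
      assert (O2 : output t2 = output t) by reflexivity.
      assert (U2 : sv t2 vu = fst (ed G k) /\ sv t2 vv = snd (ed G k)) by (split; reflexivity).
      clearbody t2. destruct U2 as [U2 V2'].
      change (exec Skip ?x) with x. change (exec (IfLt 0 vt (push vu ;; push vv) Skip) t2) with
        (if sv t2 0 <? sv t2 vt then exec (push vu ;; push vv) t2 else t2).
      rewrite Z2, V2. fold (f k). destruct (f k).
      + split; [rewrite frame_a; auto|].
        rewrite exec_seq, !output_push, O2, O. rewrite frame_v, U2, V2' by reflexivity.
        cbn [rev]. rewrite map_app. unfold encode_edges. rewrite flat_map_app. cbn [map flat_map].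
        rewrite <- !app_assoc. reflexivity.
      + split; [auto|]. now rewrite O2, O. }
  rewrite Nat.sub_0_r in F. apply F.
Qed.

Lemma exec_emit (G : graph) (s : state) :
  ctx G s ->
  output (exec emit s) =
    sv s vnv :: rev (marked G (sa s aTR)) ++
    (sv s vnv - 1) :: encode_edges (map (ed G) (rev (chosen G (sa s aF)))).
Proof.
  intros C. unfold emit. rewrite !exec_seq.
  set (s1 := exec (Set_ vLEN 0) s).
  set (s2 := exec (push vnv) s1).
  assert (C2 : ctx G s2) by (unfold s2, s1; do 2 (apply ctx_exec; [reflexivity|]); auto).
  assert (O2 : output s2 = [sv s vnv]) by (unfold s2; rewrite output_push; reflexivity).
  assert (N2 : sv s2 vnv = sv s vnv) by reflexivity.
  assert (T2 : sa s2 aTR = sa s aTR) by reflexivity.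
  assert (F2 : sa s2 aF = sa s aF) by reflexivity.
  clearbody s2. clear s1.
  pose proof (exec_emit_verts G s2 C2) as O3.
  set (s3 := exec emit_verts s2) in *.
  assert (C3 : ctx G s3) by now apply ctx_exec.
  assert (N3 : sv s3 vnv = sv s vnv) by (rewrite <- N2; now apply frame_v).
  assert (F3 : sa s3 aF = sa s aF) by (rewrite <- F2; now apply frame_a).
  clearbody s3. set (s4 := exec (Sub vnv v1) s3).
  assert (C4 : ctx G s4) by now apply ctx_exec.
  assert (N4 : sv s4 vnv = sv s vnv - 1).
  { unfold s4. ex. now rewrite N3, (ctx_1 G s3 C3). }
  assert (O4 : output s4 = output s3) by reflexivity.
  assert (F4 : sa s4 aF = sa s aF) by exact F3.
  clearbody s4. rewrite (exec_emit_edges G) by now apply ctx_exec.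
  rewrite output_push, O4, O3, O2, N4, T2. rewrite frame_a, F4 by reflexivity.
  rewrite <- !app_assoc. reflexivity.
Qed.

Lemma decode_encode (vs : list nat) (es : list (nat * nat)) :
  decode_tree (length vs :: vs ++ length es :: encode_edges es) = (vs, es).
Proof.
  unfold decode_tree. rewrite firstn_app, firstn_all, Nat.sub_diag, skipn_app, skipn_all, Nat.sub_diag.
  cbn [firstn skipn]. rewrite app_nil_r. cbn [app]. f_equal.
  assert (E : decode_pairs (encode_edges es) = es).
  { induction es as [|[a b] es IH]; auto.
    change (decode_pairs (a :: b :: encode_edges es) = (a, b) :: es). cbn [decode_pairs].
    now rewrite IH. }
  rewrite E. apply firstn_all.
Qed.

Lemma ed_inj (G : graph) (h h' : nat) :
  wf_graph G -> h < length (gE G) -> h' < length (gE G) -> ed G h = ed G h' -> h = h'.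
Proof.
  intros [N _] L L' E. unfold ed in E.
  apply (proj1 (NoDup_nth _ (0, 0)) N) in E; lia.
Qed.

Lemma partial_tree_is_tree (G : graph) H root TR F k :
  wf_graph G -> partial_tree G H root TR F k ->
  is_tree G (rev (marked G TR)) (map (ed G) (rev (chosen G F))).
Proof.
  intros WG [P1 P2 P3 P4 P5 P6].
  assert (EI : forall u v, In (u, v) (map (ed G) (rev (chosen G F))) ->
    exists h, In h (chosen G F) /\ ed G h = (u, v)).
  { intros u v (h & E & Hh%in_rev)%in_map_iff. eauto. }
  split; [|split; [|split]].
  - repeat split.
    + apply NoDup_rev, NoDup_marked.
    + assert (N : NoDup (rev (chosen G F))) by apply NoDup_rev, NoDup_filter, seq_NoDup.
      assert (L : forall h, In h (rev (chosen G F)) -> h < length (gE G)).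
      { intros h Hh%in_rev. now apply in_chosen in Hh. }
      clear EI. induction (rev (chosen G F)) as [|h l IH]; cbn [map]; constructor.
      * intros (h' & E & Hh')%in_map_iff. inversion_clear N as [|? ? N1 N2]. apply N1.
        assert (h' = h) as <-; auto. apply (ed_inj G); auto; apply L; simpl; auto.
      * inversion_clear N. apply IH; auto. intros; apply L; now right.
    + intros x Hx%in_rev. now apply in_marked in Hx.
    + intros e (h & <- & Hh%in_rev)%in_map_iff. apply in_chosen in Hh as [Hh _].
      apply nth_In. lia.
    + apply EI in H0 as (h & Hh & E). apply -> in_rev. apply (P5 u v). exists h. auto.
    + apply EI in H0 as (h & Hh & E). apply -> in_rev. apply (P5 u v). exists h. auto.
  - intros E. apply in_rev in P1. rewrite E in P1. destruct P1.
  - assert (M : forall u v, flink G F u v -> edge_rel (map (ed G) (rev (chosen G F))) u v).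
    { intros u v (h & Hh & [E|E]); [left|right]; rewrite <- E; apply in_map; now apply -> in_rev. }
    intros x y Hx%in_rev Hy%in_rev. apply (rt_trans _ _ _ root).
    2:{ apply (crt_mono (flink G F) _ _ _ M). now apply P6. }
    apply (crt_mono (flink G F) _ _ _ M). apply crt_sym; [apply flink_sym|]. now apply P6.
  - rewrite length_map, !length_rev. lia.
Qed.

(** * The secluded Steiner tree *)

Definition read_count : cmd := Get vkt aIN vp ;; CInc vp.

(** After the last loop [vroot] still holds the terminal read last, which becomes the root in
    [grow_start]. *)
Definition read_terminals : cmd :=
  For vi vn (Put aH vi 0) ;; For vi vn (Put aR vi 0) ;;
  For vr vkt (Get vroot aIN vp ;; CInc vp ;; Put aH vroot v1 ;; Put aR vroot v1).

Definition steiner_cmd : cmd :=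
  read_sizes ;; read_edges ;; read_count ;; read_terminals ;; spiders ;;
  grow_start ;; grow_loop ;; emit.

Lemma inb_firstn_S (X : list nat) (i v : nat) : i < length X ->
  inb (firstn (S i) X) v = (v =? nth i X 0) || inb (firstn i X) v.
Proof.
  intros H. rewrite (firstn_S_nth 0) by auto. rewrite inb_app. cbn [inb existsb].
  rewrite orb_false_r. apply orb_comm.
Qed.

Lemma exec_read_terminals (G : graph) (X : list nat) (s : state) :
  ctx G s -> sv s vp = 3 + 2 * length (gE G) ->
  (forall j, j < length (length X :: X) ->
     sa s aIN (3 + 2 * length (gE G) + j) = nth j (length X :: X) 0) ->
  X <> [] ->
  let s' := exec read_terminals (exec read_count s) in
  ctx G s' /\ In (sv s' vroot) X /\
  (forall v, v < gn G -> sa s' aH v = Nat.b2n (inb X v)) /\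
  (forall v, v < gn G -> sa s' aR v = Nat.b2n (inb X v)).
Proof.
  intros C Ep EI NX. cbv zeta. set (n := gn G). set (k := length X).
  set (b := 3 + 2 * length (gE G)) in *.
  set (s1 := exec read_count s).
  assert (C1 : ctx G s1) by now apply ctx_exec.
  assert (K1 : sv s1 vkt = k).
  { unfold s1, read_count. ex. rewrite Ep. etransitivity; [|apply (EI 0); simpl; lia].
    f_equal. lia. }
  assert (P1 : sv s1 vp = S b) by (unfold s1, read_count; ex; now rewrite Ep).
  assert (I1 : forall j, j < k -> sa s1 aIN (S b + j) = nth j X 0).
  { intros j Hj. change (sa s1 aIN) with (sa s aIN). rewrite Nat.add_succ_comm.
    now rewrite (EI (S j)) by (simpl; unfold k in Hj; lia). }
  clearbody s1. clear s C Ep EI. unfold read_terminals. rewrite exec_seq.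
  rewrite exec_seq. set (s1' := exec (For vi vn (Put aH vi 0)) s1).
  set (s2 := exec (For vi vn (Put aR vi 0)) s1').
  assert (C1' : ctx G s1') by now apply ctx_exec.
  assert (C2 : ctx G s2) by now apply ctx_exec.
  assert (K2 : sv s2 vkt = k) by (rewrite <- K1; unfold s2, s1'; now rewrite !frame_v).
  assert (P2 : sv s2 vp = S b) by (rewrite <- P1; unfold s2, s1'; now rewrite !frame_v).
  assert (I2 : sa s2 aIN = sa s1 aIN) by (unfold s2, s1'; now rewrite !frame_a).
  assert (Z2 : forall v, v < n -> sa s2 aH v = 0 /\ sa s2 aR v = 0).
  { intros v Hv. split; unfold s2.
    - rewrite frame_a by reflexivity. unfold s1'.
      rewrite exec_fill; [apply C1|discriminate|]. now rewrite (ctx_n G s1 C1).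
    - rewrite exec_fill; [apply C1'|discriminate|]. now rewrite (ctx_n G s1' C1'). }
  clearbody s2. rewrite <- I2 in I1. clear I2 s1' C1' s1 C1 K1 P1.
  split; [now apply ctx_exec|]. cbn [exec]. rewrite K2.
  set (s' := down _ _ _).
  assert (F : sv s' v1 = 1 /\ sa s' aIN = sa s2 aIN /\ sv s' vp + 0 = S b + k /\
    (0 = k \/ In (sv s' vroot) X) /\
    forall v, v < n -> sa s' aH v = Nat.b2n (inb (firstn (k - 0) X) v) /\
      sa s' aR v = Nat.b2n (inb (firstn (k - 0) X) v)).
  { unfold s'. apply (down_inv (fun j t => sv t v1 = 1 /\ sa t aIN = sa s2 aIN /\
      sv t vp + j = S b + k /\ (j = k \/ In (sv t vroot) X) /\
      forall v, v < n -> sa t aH v = Nat.b2n (inb (firstn (k - j) X) v) /\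
        sa t aR v = Nat.b2n (inb (firstn (k - j) X) v))).
    - split; [apply C2|]. split; [auto|]. split; [ex; lia|]. split; [auto|].
      intros v Hv. rewrite Nat.sub_diag. apply Z2. lia.
    - intros j t Hj (T1 & TI & TP & _ & TX).
      assert (E : sa t aIN (sv t vp) = nth (k - S j) X 0).
      { rewrite TI, <- I1 by lia. f_equal. lia. }
      ex. rewrite E, T1. split; [auto|]. split; [auto|]. split; [lia|].
      split; [right; apply nth_In; unfold k; lia|].
      intros v Hv. replace (k - j) with (S (k - S j)) by lia.
      rewrite inb_firstn_S by (unfold k; lia).
      destruct (v =? nth (k - S j) X 0); cbn [orb Nat.b2n]; auto. }
  destruct F as (_ & _ & _ & FR & FX). rewrite Nat.sub_0_r in FX.
  unfold k in FX. rewrite firstn_all in FX.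
  split; [|split].
  - destruct FR as [FR|]; auto. destruct X; [congruence|discriminate].
  - intros v Hv. now apply FX.
  - intros v Hv. now apply FX.
Qed.

(** The terminals count as bought and active from the outset, so the budget is met with equality. *)
Lemma purchase_start (G : graph) (X : list nat) (W : nat) (R H : nat -> nat) :
  NoDup X -> (forall x, In x X -> x < gn G) ->
  (forall v, v < gn G -> H v = Nat.b2n (inb X v)) ->
  (forall v, v < gn G -> R v = Nat.b2n (inb X v)) ->
  purchase G X W R H.
Proof.
  intros NX LX HH HR.
  assert (P : forall f, (forall v, v < gn G -> f v = Nat.b2n (inb X v)) -> Permutation (marked G f) X).
  { intros f Hf. apply NoDup_Permutation; auto using NoDup_marked.
    intros v. rewrite in_marked. split.
    - intros [Lv Hv]. rewrite Hf in Hv by auto. apply inb_In. destruct (inb X v); auto.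
      simpl in Hv; lia.
    - intros Hv. split; auto. rewrite Hf by auto. apply inb_In in Hv. rewrite Hv. simpl. lia. }
  assert (PX : forall f x, (forall v, v < gn G -> f v = Nat.b2n (inb X v)) -> In x X -> 0 < f x).
  { intros f x Hf Hx. rewrite Hf by auto. apply inb_In in Hx. rewrite Hx. simpl. lia. }
  split; auto.
  - intros r Lr Hr. eapply Permutation_in; [apply (P R HR)|]. now apply in_marked.
  - intros x Hx. exists x. split; auto. split; auto. apply rt_refl.
  - rewrite (sumf_perm _ _ _ (P H HH)), (Permutation_length (P R HR)). lia.
Qed.

Lemma exec_steiner_cmd (G : graph) (X V : list nat) (s0 : state) :
  wf_graph G -> NoDup X -> (forall x, In x X -> x < gn G) -> X <> [] ->
  grown (adj G) V -> (forall v, In v V -> v < gn G) -> incl X V ->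
  input (graph_input G (length X :: X)) s0 ->
  let o := output (exec steiner_cmd s0) in
  is_tree G (fst (decode_tree o)) (snd (decode_tree o)) /\
  incl X (fst (decode_tree o)) /\
  sumf (wt G) (fst (decode_tree o)) <=
    sumf (wt G) X + 2 * hsum (sumf (wt G) V) (length X - 1) + 2 * (length X - 1).
Proof.
  intros WG NX LX EX GV LV IV HI. cbv zeta. unfold steiner_cmd. rewrite !exec_seq.
  destruct (exec_read G (length X :: X) s0 WG HI) as (C1 & Ep & EI).
  set (s1 := exec read_edges _) in *. clearbody s1.
  destruct (exec_read_terminals G X s1 C1 Ep EI EX) as (C2 & Hr & H2 & R2).
  set (s2 := exec read_terminals _) in *. clearbody s2.
  pose proof (purchase_start G X (sumf (wt G) V) _ _ NX LX H2 R2) as PU.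
  destruct (exec_spiders G X V s2 WG C2 GV LV IV EX PU) as (Q1 & Q2 & Q3).
  assert (C3 : ctx G (exec spiders s2)) by now apply ctx_exec.
  assert (E3 : sv (exec spiders s2) vroot = sv s2 vroot) by now apply frame_v.
  set (s3 := exec spiders s2) in *. clearbody s3.
  set (root := sv s2 vroot) in *.
  destruct (exec_grow G s3 root WG C3 E3) as (C4 & PT & TC).
  { apply in_marked. auto. }
  set (s4 := exec grow_loop _) in *. clearbody s4.
  rewrite (exec_emit G s4 C4).
  pose proof (pt_verts _ _ _ _ _ _ PT) as LT. pose proof (pt_edges _ _ _ _ _ _ PT) as LE.
  replace (sv s4 vnv - 1) with (length (map (ed G) (rev (chosen G (sa s4 aF)))))
    by (rewrite length_map, length_rev; lia).
  rewrite <- LT, <- (length_rev (marked G (sa s4 aTR))), decode_encode. cbn [fst snd].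
  split; [eapply partial_tree_is_tree; eauto|]. split.
  (* A closed tree absorbs every marked vertex connected to the root through marked vertices, by
     induction along the connection. *)
  - intros x Hx. apply -> in_rev. pose proof (Q1 root x Hr Hx) as Cx.
    apply clos_rt_rtn1 in Cx. clear Hx. induction Cx as [|y z [Ayz [_ Hz]] _ IH]; [apply PT|].
    destruct (adj_lt G y z WG Ayz) as [_ Lz]. apply in_marked in IH as [_ IH].
    apply in_marked. split; auto. specialize (TC y z Ayz). unfold graftable in TC. lia.
  - rewrite (sumf_perm _ _ (marked G (sa s4 aTR))) by (symmetry; apply Permutation_rev).
    etransitivity; [|exact Q3]. apply sumf_incl; [apply NoDup_marked|].
    intros v Hv. eapply pt_sub; eauto.
Qed.

Lemma polytime_steiner : polytime steiner_cmd.
Proof. repeat apply polytime_seq; now apply polytime_loops. Qed.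

Lemma list_max_lt (X : list nat) (n : nat) : (forall x, In x X -> x < n) -> list_max X <= n.
Proof.
  intros H. apply list_max_le, Forall_forall. intros x Hx. specialize (H x Hx). lia.
Qed.

Theorem theorem7 :
  forall l : nat,
    (* Secluded Path: polynomial-time O(1)-approximation *)
    (exists (P : program) (d c : nat),
       forall (G : graph) (s t : nat),
         wf_graph G -> bounded_density l G ->
         s < gn G -> t < gn G ->
         (exists q, is_st_path G s t q) ->
         exists p,
           runs_within P (encode_path_instance G s t)
             (d * (gn G + length (gE G) + 2) ^ d) p /\
           is_st_path G s t p /\
           forall q, is_st_path G s t q -> cost G p <= c * cost G q)
    /\
    (* Secluded Steiner Tree: polynomial-time O(log k)-approximation *)
    (exists (P : program) (d c : nat),
       forall (G : graph) (X : list nat),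
         wf_graph G -> bounded_density l G ->
         X <> nil -> NoDup X -> (forall x, In x X -> x < gn G) ->
         (exists V' E', is_tree G V' E' /\ incl X V') ->
         exists o,
           runs_within P (encode_steiner_instance G X)
             (d * (gn G + length (gE G) + length X + 2) ^ d) o /\
           is_tree G (fst (decode_tree o)) (snd (decode_tree o)) /\
           incl X (fst (decode_tree o)) /\
           forall V' E', is_tree G V' E' -> incl X V' ->
             cost G (fst (decode_tree o))
               <= c * (Nat.log2 (length X) + 1) * cost G V').
Proof.
  intros l. split.
  { destruct (cmd_implementable path_cmd) as (P & d & HP);
      [vm_compute; reflexivity|apply polytime_path|].
    (* The running time was bounded in terms of largest entry plus length of the encoded input; this
       is at most 4 times the size measure of the theorem. *)
    destruct (poly_bound d 4) as (d' & Hd).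
    exists P, d', (2 * l + 1). intros G s t WG BD Hs Ht (q & Hq).
    change (encode_path_instance G s t) with (graph_input G [s; t]).
    pose proof (list_max_graph_input G [s; t] WG) as LM.
    assert (LL : length (graph_input G [s; t]) = 2 * length (gE G) + 4).
    { unfold graph_input. cbn [length]. rewrite length_app, length_encode_edges. cbn [length]. lia. }
    destruct (HP (graph_input G [s; t])) as (s0 & I0 & R0); [lia|].
    destruct (exec_path_cmd G s0 s t q WG Hs Ht Hq I0) as (D & p & DT & Hp & Ho).
    exists p. rewrite Ho in R0. split; [|split].
    - eapply runs_within_le; [|exact R0]. apply Hd.
      change (list_max [s; t]) with (Nat.max s (Nat.max t 0)) in LM. lia.
    - eapply descent_path; eauto. intros v. unfold wt. lia.
    - intros q' Hq'. destruct (Hq') as (NQ & LQ & HQ & TQ & CQ).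
      pose proof (dist_path G _ _ _ _ _ DT HQ TQ CQ).
      pose proof (descent_weight _ _ _ _ _ _ Hp).
      pose proof (cost_le_wt G p). pose proof (wt_le_cost G l q' WG BD NQ LQ). lia. }
  { destruct (cmd_implementable steiner_cmd) as (P & d & HP);
      [vm_compute; reflexivity|apply polytime_steiner|].
    destruct (poly_bound d 4) as (d' & Hd).
    (* The 5 is [1 + 2 + 2]: once [W] for the terminals, twice [L * W] for the harmonic sum and
       twice [W] for the linear term, with [1 <= L]. The factor [2 * l + 1] converts weight back to
       cost. *)
    exists P, d', (5 * (2 * l + 1)). intros G X WG BD EX NX LX (V0 & E0 & T0 & I0).
    change (encode_steiner_instance G X) with (graph_input G (length X :: X)).
    pose proof (list_max_graph_input G (length X :: X) WG) as LM.
    assert (LL : length (graph_input G (length X :: X)) = 2 * length (gE G) + 3 + length X).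
    { unfold graph_input. cbn [length]. rewrite length_app, length_encode_edges. cbn [length]. lia. }
    assert (L1 : 1 <= length X) by (destruct X; [congruence|simpl; lia]).
    destruct (HP (graph_input G (length X :: X))) as (s0 & J0 & R0); [lia|].
    (* Stated for an arbitrary tree because the output does not depend on it: the given tree yields
       that the output is feasible, and each competitor yields its own ratio. *)
    assert (Main : forall V E, is_tree G V E -> incl X V ->
      let o := output (exec steiner_cmd s0) in
      is_tree G (fst (decode_tree o)) (snd (decode_tree o)) /\
      incl X (fst (decode_tree o)) /\
      cost G (fst (decode_tree o)) <= 5 * (2 * l + 1) * (Nat.log2 (length X) + 1) * cost G V).
    { intros V E TV IV. destruct (tree_grown G V E TV) as (V' & GV & PV).
      destruct (TV) as ((NV & _ & LV & _) & _).
      destruct (exec_steiner_cmd G X V' s0) as (A1 & A2 & A3); auto.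
      { intros v Hv. apply LV. eapply Permutation_in; eauto. }
      { intros x Hx. eapply Permutation_in; [apply Permutation_sym, PV|]. now apply IV. }
      split; [auto|]. split; [auto|].
      set (o := output (exec steiner_cmd s0)) in *.
      rewrite (sumf_perm _ _ _ PV) in A3.
      pose proof (cost_le_wt G (fst (decode_tree o))) as B1.
      pose proof (wt_le_cost G l V WG BD NV LV) as B2.
      pose proof (sumf_incl (wt G) X V NX IV) as B3.
      pose proof (sumf_ge_const (wt G) 1 X ltac:(intros; unfold wt; lia)) as B4.
      pose proof (hsum_mono (sumf (wt G) V) (length X - 1) (length X) ltac:(lia)) as B5.
      pose proof (hsum_log (sumf (wt G) V) (length X)) as B6.
      set (W := sumf (wt G) V) in *. set (L := Nat.log2 (length X) + 1) in *.
      assert (1 <= L) by (unfold L; lia).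
      assert (cost G (fst (decode_tree o)) <= 5 * L * W) by nia.
      assert (5 * L * W <= 5 * L * ((2 * l + 1) * cost G V)) by (apply Nat.mul_le_mono_l; auto).
      lia. }
    exists (output (exec steiner_cmd s0)). split.
    - eapply runs_within_le; [|exact R0]. apply Hd.
      change (list_max (length X :: X)) with (Nat.max (length X) (list_max X)) in LM.
      pose proof (list_max_lt X (gn G) LX). lia.
    - destruct (Main V0 E0 T0 I0) as (A1 & A2 & _). split; [auto|]. split; [auto|].
      intros V E TV IV. now apply (Main V E). }
Qed.
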